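(* Let $n,k$ be positive integers and let $\lambda$ be a partition contained in an $n\times k$ rectangle. For $p\in\{0,1\}$ define $$M^{BC}_q(\lambda+p\Lambda_n):=\det\left[\mathcal{C}_{a(i,j),b(i,j)}(q)\right]_{i,j=1}^n,\qquad a(i,j)=2n-i-j+k+p+\lambda_j,\quad b(i,j)=j-i+k-\lambda_j .$$ ($p=0$) We have $$M^{BC}_q(\lambda)\prod_{a=1}^{k-1}(q^a+1)=q^{\|\overline\lambda\|}\dim_q(\overline\lambda'+\omega_k),$$ where $\omega_k=\frac12(\epsilon_1+\cdots+\epsilon_k)$ and $\dim_q(\overline\lambda'+\omega_k)$ is the $q$-dimension of $V(\overline\lambda'+\omega_k)$ in type $D_k$. Furthermore, $M^{BC}_1(\lambda)$ equals the multiplicity of $V(\lambda)$ in $V(\Lambda_n)^{\otimes 2k}$ for type $B_n$, and $M^{BC}_q(\lambda)\in\mathbb{Z}_{\ge0}[q]$. ($p=1$) We have $$M^{BC}_q(\lambda+\Lambda_n)=q^{\|\overline\lambda\|}\dim_q(\overline\lambda')\in\mathbb{Z}_{\ge0}[q],$$ where $\dim_q(\overline\lambda')$ is the $q$-dimension of $V(\overline\lambda')$ in type $C_k$. Furthermore, $M^{BC}_1(\lambda+\Lambda_n)$ equals the multiplicity of $V(\lambda+\Lambda_n)$ in $V(\Lambda_n)^{\otimes 2k+1}$ for type $B_n$, and also equals the multiplicity of $V(\lambda)$ in $V^{\otimes k}$ for $V=\bigwedge V(\Lambda_1)$ in type $C_n$.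
   Context: $[m]_q=1+q+\cdots+q^{m-1}$, $[m]_q!=\prod_{j=1}^m[j]_q$. The $q$-Catalan triangle numbers are $\mathcal{C}_{m,r}(q)=\frac{[m+r]_q!\,[m-r+1]_q}{[r]_q!\,[m+1]_q!}$ for $m\ge0$, $0\le r\le m$, and $\mathcal{C}_{m,r}(q)=0$ if $m<0$, $r<0$, or $r>m$. A partition contained in an $n\times k$ rectangle has at most $n$ parts, each at most $k$ (padded with zeros to $n$ parts); $\overline\lambda_i=k-\lambda_{n+1-i}$ is its complement; a prime denotes the conjugate; $\|\nu\|=\sum_i(i-1)\nu_i$. A partition $\nu$ is identified with the weight $\sum_i\nu_i\epsilon_i$. Type $B_n$ is $\mathfrak{so}_{2n+1}$, and $\Lambda_n=\frac12(\epsilon_1+\cdots+\epsilon_n)$ is the highest weight of its spinor representation. Type $C_n$ is $\mathfrak{sp}_{2n}$, and $V(\Lambda_1)=\mathbb{C}^{2n}$ is its natural representation. $V(\mu)$ is the irreducible representation with highest weight $\mu$. $\dim_q(\mu)=\prod_{\alpha\in\Phi^+}\frac{1-q^{\langle\mu+\rho,\alpha^\vee\rangle}}{1-q^{\langle\rho,\alpha^\vee\rangle}}$. For type $D_k$ ($\mathfrak{so}_{2k}$) the positive coroots are $\epsilon_i\pm\epsilon_j$ ($1\le i<j\le k$; none if $k=1$), and $\rho=(k-1,\dots,1,0)$. For type $C_k$ the positive coroots are $\epsilon_i\pm\epsilon_j$ ($i<j$) and $\epsilon_i$, and $\rho=(k,k-1,\dots,1)$. *)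

(* Defs.v *)
From mathcomp Require Import all_boot all_order all_algebra.
From mathcomp Require Import reals.
From mathcomp Require Import complex mxtens.

Set Implicit Arguments.
Unset Strict Implicit.
Unset Printing Implicit Defensive.

Import Order.TTheory GRing.Theory Num.Theory.
Local Open Scope ring_scope.

(* The q-numbers below live in an arbitrary field containing [q]: the field of
   rational functions with [q] the variable gives the formal objects, and
   [q = 1] in [rat] gives their values at 1. *)

Section QCatalan.
Variables (F : fieldType) (q : F).

Definition qint (m : nat) : F := \sum_(i < m) q ^+ i.

Definition qfact (m : nat) : F := \prod_(1 <= j < m.+1) qint j.

Definition qcat (m r : int) : F :=
  match m, r with
  | Posz m, Posz r =>
      if (r <= m)%N
      then (qfact (m + r) * qint (m - r).+1) / (qfact r * qfact m.+1)
      else 0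
  | _, _ => 0
  end.

(* Row and column indices are 0-based, hence the [i.+1] and [j.+1]. *)
Definition MBC (n k : nat) (lam : 'I_n -> nat) (p : nat) : F :=
  \det (\matrix_(i < n, j < n)
     qcat ((2 * n)%:Z - i.+1%:Z - j.+1%:Z + k%:Z + p%:Z + (lam j)%:Z)
          (j.+1%:Z - i.+1%:Z + k%:Z - (lam j)%:Z)).

End QCatalan.

Definition part_in_rect (n k : nat) (lam : 'I_n -> nat) : Prop :=
  (forall i j : 'I_n, (i <= j)%N -> (lam j <= lam i)%N) /\
  (forall i, (lam i <= k)%N).

Definition compl_part (n k : nat) (lam : 'I_n -> nat) : 'I_n -> nat :=
  fun i => (k - lam (rev_ord i))%N.

(* The first [k] parts of the conjugate; these are all of its nonzero parts
   when the parts of [nu] are at most [k]. *)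
Definition conj_part (n k : nat) (nu : 'I_n -> nat) : 'I_k -> nat :=
  fun j => #|[set i : 'I_n | (j < nu i)%N]|.

Arguments conj_part {n} k nu j.

Definition part_norm (n : nat) (nu : 'I_n -> nat) : nat :=
  (\sum_(i < n) i * nu i)%N.

(* The weight sum_i mu_i eps_i is the row vector of its coordinates. *)

Definition weight (n : nat) := 'rV[rat]_n.

Definition eps (n : nat) (i : 'I_n) : weight n := delta_mx 0 i.

Definition part_weight (n : nat) (nu : 'I_n -> nat) : weight n :=
  \row_i (nu i)%:R.

(* Half the sum of the eps_i: the weight Lambda_n of type B_n, and omega_k of
   type D_k. *)
Definition half_weight (n : nat) : weight n := const_mx (1 / 2%:R).

Definition pairing (n : nat) (mu a : weight n) : rat :=
  \sum_(i < n) mu 0 i * a 0 i.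

Definition ord_pairs (k : nat) : seq ('I_k * 'I_k) :=
  [seq ij : 'I_k * 'I_k <- enum {: 'I_k * 'I_k} | (ij.1 < ij.2)%N].

Definition corootsD (k : nat) : seq (weight k) :=
  [seq eps ij.1 - eps ij.2 | ij <- ord_pairs k] ++
  [seq eps ij.1 + eps ij.2 | ij <- ord_pairs k].

Definition rhoD (k : nat) : weight k := \row_i (k - i.+1)%N%:R.

Definition corootsC (k : nat) : seq (weight k) :=
  corootsD k ++ [seq eps i | i <- enum 'I_k].

Definition rhoC (k : nat) : weight k := \row_i (k - i)%N%:R.

(* For integral weights the pairings with coroots are integers (also when the
   coordinates of the weight are half-integers), so [Num.floor] only changes
   the type of the exponent. *)
Definition qdim (F : fieldType) (q : F) (k : nat) (coroots : seq (weight k))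
    (rho mu : weight k) : F :=
  \prod_(a <- coroots)
    ((1 - q ^ Num.floor (pairing (mu + rho) a)) /
     (1 - q ^ Num.floor (pairing rho a))).

Definition qdimD (F : fieldType) (q : F) (k : nat) (mu : weight k) : F :=
  qdim q (corootsD k) (rhoD k) mu.

Definition qdimC (F : fieldType) (q : F) (k : nat) (mu : weight k) : F :=
  qdim q (corootsC k) (rhoC k) mu.

Section Representations.
Variable C : fieldType.

Definition lie_bracket (N : nat) (A B : 'M[C]_N) : 'M[C]_N :=
  A *m B - B *m A.

Definition form_algebra (N : nat) (J : 'M[C]_N) : pred 'M[C]_N :=
  fun A => A^T *m J + J *m A == 0.

(* With antidiagonal Gram matrices the diagonal matrices of the Lie algebra
   form a Cartan subalgebra, namely the diag(t_1, ..., t_n, 0, -t_n, ..., -t_1)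
   for so_(2n+1) and the diag(t_1, ..., t_n, -t_n, ..., -t_1) for sp_(2n), on
   which eps_i takes the value t_i.  The strictly upper triangular matrices of
   the Lie algebra are the sum of the root spaces for the positive roots
   eps_i +- eps_j (i < j), and eps_i for so_(2n+1), 2 eps_i for sp_(2n). *)
Definition so_odd (n : nat) : pred 'M[C]_(n + n.+1) :=
  form_algebra (\matrix_(i, j) (j == rev_ord i)%:R).

Definition sp_even (n : nat) : pred 'M[C]_(n + n) :=
  form_algebra
    (\matrix_(i, j) if j == rev_ord i then (-1) ^+ (n <= i)%N else 0).

Arguments so_odd n : clear implicits.
Arguments sp_even n : clear implicits.

(* Candidate representations of a Lie algebra of N x N matrices, on column
   vectors.  Only the values of the map on the Lie algebra matter. *)
Record mxact (N : nat) := MxAct {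
  act_dim : nat;
  act :> 'M[C]_N -> 'M[C]_act_dim
}.

Definition is_rep (N : nat) (g : pred 'M[C]_N) (V : mxact N) : Prop :=
  (forall (a : C) A B, A \in g -> B \in g ->
     V (a *: A + B) = a *: V A + V B) /\
  (forall A B, A \in g -> B \in g ->
     V (lie_bracket A B) = lie_bracket (V A) (V B)).

Definition stable_sub (N : nat) (g : pred 'M[C]_N) (V : mxact N)
    (U : {vspace 'cV[C]_(act_dim V)}) : Prop :=
  forall A v, A \in g -> v \in U -> V A *m v \in U.

Definition irreducible_sub (N : nat) (g : pred 'M[C]_N) (V : mxact N)
    (U : {vspace 'cV[C]_(act_dim V)}) : Prop :=
  [/\ stable_sub g U, U <> 0%VS &
      forall U' : {vspace 'cV[C]_(act_dim V)},
        stable_sub g U' -> (U' <= U)%VS -> U' = 0%VS \/ U' = U].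

Definition strictly_upper (N : nat) (A : 'M[C]_N) : Prop :=
  forall i j : 'I_N, (j <= i)%N -> A i j = 0.

Definition highest_weight_vector (n m : nat) (g : pred 'M[C]_(n + m))
    (V : mxact (n + m)) (mu : weight n) (v : 'cV[C]_(act_dim V)) : Prop :=
  [/\ v != 0,
      forall A, A \in g -> strictly_upper A -> V A *m v = 0 &
      forall H, H \in g -> is_diag_mx H ->
        V H *m v =
        (\sum_(i < n) ratr (mu 0 i) * H (lshift m i) (lshift m i)) *: v].

Definition is_hw_irrep_sub (n m : nat) (g : pred 'M[C]_(n + m))
    (V : mxact (n + m)) (mu : weight n)
    (U : {vspace 'cV[C]_(act_dim V)}) : Prop :=
  irreducible_sub g U /\
  (exists2 v, v \in U & highest_weight_vector g mu v).

Definition is_hw_irrep (n m : nat) (g : pred 'M[C]_(n + m)) (mu : weight n)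
    (V : mxact (n + m)) : Prop :=
  is_rep g V /\ is_hw_irrep_sub g mu (fullv : {vspace 'cV[C]_(act_dim V)}).

(* [U] decomposes [W] into irreducible submodules, and [P] is the set of the
   indices of those that are copies of V(mu). *)
Definition has_multiplicity (n m : nat) (g : pred 'M[C]_(n + m))
    (mu : weight n) (W : mxact (n + m)) (mult : nat) : Prop :=
  exists (r : nat) (U : 'I_r -> {vspace 'cV[C]_(act_dim W)}) (P : {set 'I_r}),
    [/\ forall i, irreducible_sub g (U i),
        (\sum_i U i)%VS = fullv /\ directv (\sum_i U i),
        forall i, i \in P <-> is_hw_irrep_sub g mu (U i) &
        #|P| = mult].

Definition triv_act (N : nat) : mxact N :=
  MxAct (fun _ : 'M[C]_N => (0 : 'M[C]_1)).

Definition tens_act (N : nat) (V W : mxact N) : mxact N :=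
  MxAct (fun A => V A *t (1%:M : 'M[C]_(act_dim W)) +
                  (1%:M : 'M[C]_(act_dim V)) *t W A).

Definition tens_pow (N : nat) (V : mxact N) (m : nat) : mxact N :=
  iter m (tens_act V) (triv_act N).

Definition natural_act (N : nat) : mxact N := MxAct (fun A : 'M[C]_N => A).

(* The exterior algebra of C^d has the basis of the e_S, S a subset of 'I_d,
   where e_S is the wedge of the e_s, s in S, in increasing order.  A matrix [X]
   acts as a derivation: X e_S is the sum over s in S and i of X i s times the
   wedge obtained from e_S by replacing e_s by e_i in its place.  That wedge is
   0 if i is in S :\ s; otherwise sorting it moves e_i past the e_x with x in
   S :\ s lying strictly between s and i. *)
Definition wedge_subst (d : nat) (S : {set 'I_d}) (s i : 'I_d)
    (T : {set 'I_d}) : C :=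
  if (i \notin S :\ s) && (T == i |: (S :\ s))
  then (-1) ^+ #|[set x in S :\ s | (x < s)%N (+) (x < i)%N]|
  else 0.

Definition ext_mx (d : nat) (X : 'M[C]_d) : 'M[C]_(#|{: {set 'I_d}}|) :=
  \matrix_(t, u)
    \sum_(s in (enum_val u : {set 'I_d})) \sum_(i < d)
      X i s * wedge_subst (enum_val u) s i (enum_val t).

Definition ext_act (N : nat) (V : mxact N) : mxact N :=
  MxAct (fun A => ext_mx (V A)).

End Representations.

Arguments so_odd C n : clear implicits.
Arguments sp_even C n : clear implicits.
Arguments natural_act C N : clear implicits.

Definition ratfun : fieldType := {fraction {poly int}}.

Definition qvar : ratfun := tofrac ('X : {poly int}).

Definition is_nat_poly (f : ratfun) : Prop :=
  exists P : {poly int}, (forall i, 0 <= P`_i) /\ f = tofrac P.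

(* Main.v *)
(* Put K = k + n - i and L = lambda_j + n - j, with 1-based i and j.  The q-ballot
   recursion shows that, up to powers of q, the (i, j) entry is the value at L of
   T_(K-1) ... T_0 applied to the delta function at 0, with
   T_i = (1 + q^i D)(1 + q^(i+p) U), where U and D are the shifts of the half-line
   (for p = 0, T_0 is just 1 + U).  These operators commute; the T_i with i >= k,
   done first, only contribute a triangular change of rows, so the determinant
   becomes that of [(T_(k-1) ... T_0 delta_(n-i))(L_j)].  As 1 + xD and 1 + yU have
   nonnegative minors, its coefficients are nonnegative.

   For the q-dimensions, the (i, j) entry is, up to a factor of row i and one of
   column j, a polynomial of degree i - 1 in q^-L + q^(L+p+1), so the determinant is
   of Vandermonde type.  The products over the set of the L_j are traded for those
   over its complement in [0, n+k), which are the numbers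
   conj(compl lambda)_i + k - i; the constant is found from lambda = (k, ..., k).

   For the multiplicities, a representation V in which opposite root vectors act by
   adjoint matrices is completely reducible.  Taking traces of the Casimir operator
   on its simultaneous eigenspaces with the Cartan subalgebra gives
   [V : V(xi)] = sum over the sets S of positive roots of
   (-1)^|S| dim V_(xi + sum S).  In a tensor power of the spinor representation or
   of the exterior algebra, the dimension of a weight space is a product over the
   coordinates of numbers of walks on Z, and the denominator formula turns the sum
   into det[b(xi_i + rho_i - rho_j) - b(xi_i + rho_i + rho_j)].  By reflection at 0
   these entries count walks on the half-line, and are those of the determinant
   above at q = 1.  An arbitrary irreducible representation of highest weight
   Lambda_n is identified with the Clifford module through the submodule of their
   direct sum generated by the pair of highest weight vectors. *)
Require Import Defs.
From mathcomp Require Import boolp.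
From mathcomp Require Import all_boot all_order all_algebra.
From mathcomp Require Import reals.
From mathcomp Require Import perm complex mxtens.
From mathcomp Require Import zify ring.

Set Implicit Arguments.
Unset Strict Implicit.
Unset Printing Implicit Defensive.

Import Order.TTheory GRing.Theory Num.Theory.
Local Open Scope ring_scope.

(** * q-Catalan numbers *)

(** The alternating formula for [V : V(xi)] is reached without characters. Since [E, F] acts by a
    scalar on each weight space, the traces of E F telescope along root strings. For m_o(z) the
    multiplicity of the weight z in the Casimir eigenspace of eigenvalue o, this gives (o - c) times
    the sum over S of (-1)^|S| m_o(xi + sum S) = 0, where c is the eigenvalue on V(xi). The argument
    closes up because the exponents rho - sum S that survive in the Weyl denominator all have the
    norm of rho. So only o = c contributes, and there a maximality argument leaves the empty S.

    The identities in q hold over any field in which the [m], m > 0, are nonzero, so that they serve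
    both the variable q and q = 1. The Vandermonde evaluation also divides by q - 1; at q = 1 the
    determinant is therefore reached through the shift operators.

    These operators give the determinant only up to a power of q, so positivity also needs to know
    beforehand that the entries are polynomials. *)

Section QNumbers.
Variables (F : fieldType) (q : F).
Local Notation "[ m ]q" := (qint q m) (format "[ m ]q").

Lemma qint0 : [0]q = 0. Proof. by rewrite /qint big_ord0. Qed.

Lemma qintS m : [m.+1]q = 1 + q * [m]q.
Proof.
rewrite /qint big_ord_recl expr0 mulr_sumr; congr (_ + _).
by apply: eq_bigr => i _; rewrite exprS.
Qed.

Lemma qint1 : [1]q = 1. Proof. by rewrite qintS qint0 mulr0 addr0. Qed.

(** Trades powers of q for q-integers: together with [qintD] and [qintS] it makes identities between
    q-numbers polynomial in a few unknowns, so that [ring] decides them. *)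
Lemma qintX m : q ^+ m = 1 + (q - 1) * [m]q.
Proof.
elim: m => [|m IH]; first by rewrite qint0 mulr0 addr0.
by rewrite qintS exprS IH; ring.
Qed.

Lemma qintD a b : [a + b]q = [a]q + q ^+ a * [b]q.
Proof.
elim: a => [|a IH]; first by rewrite qint0 add0r mul1r.
by rewrite addSn !qintS IH exprS; ring.
Qed.

Lemma qfact0 : qfact q 0 = 1. Proof. by rewrite /qfact big_geq. Qed.

Lemma qfactS m : qfact q m.+1 = qfact q m * [m.+1]q.
Proof. by rewrite /qfact big_nat_recr. Qed.

Hypothesis qint_neq0 : forall m, [m.+1]q != 0.

Lemma qfact_neq0 m : qfact q m != 0.
Proof. by elim: m => [|m IH]; rewrite ?qfact0 ?oner_neq0 // qfactS mulf_neq0. Qed.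

(* [C_{K+L+p, K-L}(q)], the entry of the determinant in terms of
   K = k + n - i and the strictly decreasing L = lambda_j + n - j. *)
Definition catalan (p K L : nat) : F :=
  if (L <= K)%N then
    qfact q (K + K + p) * [(L + L + p).+1]q /
      (qfact q (K - L) * qfact q (K + L + p).+1)
  else 0.

Lemma qcat_catalan p K L :
  qcat q (K + L + p)%:Z (K%:Z - L%:Z) = catalan p K L.
Proof.
rewrite /catalan; case: leqP => h.
  rewrite subzn //= (_ : (K - L <= K + L + p)%N); last by lia.
  by congr (qfact q _ * qint q _ / _); lia.
have -> : K%:Z - L%:Z = Negz (L - K).-1 by lia.
by [].
Qed.

Lemma catalan_gt p K L : (K < L)%N -> catalan p K L = 0.
Proof. by rewrite /catalan ltnNge => /negbTE ->. Qed.

Lemma catalan_diag p K : catalan p K K = 1.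
Proof.
rewrite /catalan leqnn subnn qfact0 mul1r qfactS mulfV //.
by rewrite -qfactS qfact_neq0 // mulf_neq0 // qfact_neq0.
Qed.

Lemma div_scale2 (x y a b u v : F) : a != 0 -> b != 0 -> u != 0 -> v != 0 ->
  x * y / (u * v) = x * (y * a * b) / (u * a * (v * b)).
Proof. by move=> a0 b0 u0 v0; field; rewrite a0 b0 u0 v0. Qed.

Lemma div_scalel (x y a b u v : F) : a != 0 -> b != 0 -> u != 0 -> v != 0 ->
  x * y / (u * v) = x * (y * b * a) / (u * a * b * v).
Proof. by move=> a0 b0 u0 v0; field; rewrite a0 b0 u0 v0. Qed.

Lemma div_scaler (c x y a b u v : F) : a != 0 -> b != 0 -> u != 0 -> v != 0 ->
  c * (x * y / (u * v)) = x * (c * y * a * b) / (u * (v * a * b)).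
Proof. by move=> a0 b0 u0 v0; field; rewrite a0 b0 u0 v0. Qed.

(** The numerators of [catalan_recr] over a common denominator, with a = K - L and t + 1 = 2L + p.
    The summands on the right come from L, L - 1 and L + 1. *)
Lemma catalan_num_recr a t :
  [t.+2]q * [a + a + t.+2]q * [a + a + t.+3]q =
    (1 + q ^+ (a + a + t.+1)) * ([t.+2]q * [a.+1]q * [a + t.+3]q)
    + q ^+ a.+1 * [t]q * [a + t.+2]q * [a + t.+3]q
    + q ^+ (a + t.+1) * ([t.+4]q * [a.+1]q * [a]q).
Proof. by rewrite !(qintD, qintX, qintS); move: [a]q [t]q => A T; ring. Qed.

(** Over the common denominator [K - L + 1]! [K + L + p + 2]! this is [catalan_num_recr]. The case L
    = p = 0 obeys another rule, [catalan_recr00]. *)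
Lemma catalan_recr p K L : (p <= 1)%N -> (0 < L + p)%N ->
  catalan p K.+1 L = (1 + q ^+ (K + K + p)) * catalan p K L
    + (if L is L'.+1 then q ^+ (K - L') * catalan p K L' else 0)
    + q ^+ (K + L + p) * catalan p K L.+1.
Proof.
move=> p1 Lp0.
have [ltKL|leLK] := ltnP K L.
  rewrite (catalan_gt _ ltKL) (catalan_gt _ (leqW ltKL)) !mulr0 add0r addr0.
  case: L ltKL {Lp0} => // L ltKL.
  have [eKL|neKL] := eqVneq K L.
    by rewrite eKL subnn !catalan_diag mul1r.
  have ltKL' : (K < L)%N by lia.
  by rewrite !catalan_gt ?mulr0.
have [a ->] : exists a, K = (L + a)%N by exists (K - L)%N; lia.
have neq := qfact_neq0; have ineq := qint_neq0.
pose f := qfact q.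
have e1 : catalan p (L + a).+1 L = f (L + a + (L + a) + p)%N
   * ([(L + L + p).+1]q * [(L + a + (L + a) + p).+1]q * [(L + a + (L + a) + p).+2]q)
   / (f a.+1 * f (L + a + L + p).+2).
  rewrite /catalan leqW ?leq_addr // (_ : (_ - L)%N = a.+1); last by lia.
  rewrite (_ : (_.+1 + _.+1 + p)%N = (L + a + (L + a) + p).+2); last by lia.
  rewrite (qfactS (L + a + (L + a) + p).+1) (qfactS (L + a + (L + a) + p)) -/f.
  by congr (_ / _); rewrite -!mulrA; congr (_ * _); rewrite mulrA mulrC.
have e2 : catalan p (L + a) L = f (L + a + (L + a) + p)%N
   * ([(L + L + p).+1]q * [a.+1]q * [(L + a + L + p).+2]q)
   / (f a.+1 * f (L + a + L + p).+2).
  rewrite /catalan leq_addr (_ : (_ - L)%N = a); last by lia.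
  by rewrite /f (qfactS a) (qfactS (_).+1) -div_scale2.
have e3 : catalan p (L + a) L.+1 = f (L + a + (L + a) + p)%N
   * ([(L + L + p).+3]q * [a.+1]q * [a]q)
   / (f a.+1 * f (L + a + L + p).+2).
  rewrite /catalan; case: a {e1 e2 leLK} => [|a].
    by rewrite addn0 ltnn qint0 mulr0 mulr0 mul0r.
  rewrite addnS ltnS leq_addr (_ : (_ - L.+1)%N = a); last by lia.
  rewrite (_ : ((L + a).+1 + L.+1 + p).+1%N = ((L + a).+1 + L + p).+2); last by lia.
  rewrite (_ : (L.+1 + L.+1 + p).+1%N = (L + L + p).+3); last by lia.
  rewrite /f (qfactS a.+1) (qfactS a).
  by rewrite -div_scalel.
have e4 : (if L is L'.+1 then q ^+ (L + a - L') * catalan p (L + a) L' else 0)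
  = f (L + a + (L + a) + p)%N
   * (q ^+ a.+1 * [(L + L + p).-1]q * [(L + a + L + p).+1]q * [(L + a + L + p).+2]q)
   / (f a.+1 * f (L + a + L + p).+2).
  (* For L = 0 there is no left neighbour; then p = 1, and the formula still holds because its
     factor [2L + p - 1] is [0]. *)
  case: L Lp0 {leLK e1 e2 e3} => [|L] Lp0.
    have -> : p = 1%N by lia.
    by rewrite qint0 mulr0 !mul0r mulr0 mul0r.
  rewrite (_ : (_ - L)%N = a.+1); last by lia.
  rewrite /catalan (_ : (_ - L)%N = a.+1); last by lia.
  rewrite (_ : (L <= L.+1 + a)%N); last by lia.
  rewrite (_ : (L + L + p).+1%N = (L.+1 + L.+1 + p).-1); last by lia.
  rewrite (_ : (L.+1 + a + L + p).+1%N = (L.+1 + a + L.+1 + p)); last by lia.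
  rewrite /f (qfactS (_).+1) (qfactS (_ + _ + _ + _)).
  by rewrite -div_scaler.
rewrite e1 e2 e3 e4; set d := (f a.+1 * _)^-1; set x := f (_ + _ + p)%N.
have [t et] : exists t, (L + L + p)%N = t.+1 by exists (L + L + p).-1; lia.
have := catalan_num_recr a t.
rewrite (_ : (a + a + t.+2)%N = (L + a + (L + a) + p).+1); last by lia.
rewrite (_ : (a + a + t.+3)%N = (L + a + (L + a) + p).+2); last by lia.
rewrite (_ : (a + a + t.+1)%N = (L + a + (L + a) + p)%N); last by lia.
rewrite (_ : (a + t.+2)%N = (L + a + L + p).+1); last by lia.
rewrite (_ : (a + t.+3)%N = (L + a + L + p).+2); last by lia.
rewrite (_ : (a + t.+1)%N = (L + a + L + p)%N); last by lia.
by rewrite et succnK => ->; ring.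
Qed.
End QNumbers.

(** * Shift operators on the half-line *)

Section Shifts.
Variable F : fieldType.

Definition dirac (I : nat) : nat -> F := fun L => (L == I)%:R.

(** The boundary is encoded in the coefficient, since [0.-1] is 0. A coefficient depending on L
    times the value at a moved point is the shape treated by [nonneg_minors_step]. *)
Definition up_step (y : F) (f : nat -> F) : nat -> F :=
  fun L => f L + (if L is L'.+1 then y else 0) * f L.-1.

Definition down_step (x : F) (f : nat -> F) : nat -> F :=
  fun L => f L + x * f L.+1.

Definition hop (x y : F) (f : nat -> F) : nat -> F := down_step x (up_step y f).

(** On the half-line D U is the identity, so this order of the two factors gives the constant 1 + xy
    at every L, with no correction at L = 0. *)
Lemma hopE x y f L :
  hop x y f L = (1 + x * y) * f L + (if L is L'.+1 then y else 0) * f L.-1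
                + x * f L.+1.
Proof. by rewrite /hop /down_step /up_step /=; ring. Qed.

(** The commutator of the two hops is x y' - x' y times that of D and U. *)
Lemma hopC x y x' y' f : x * y' = x' * y ->
  hop x y (hop x' y' f) = hop x' y' (hop x y f).
Proof.
move=> e; apply/funext => L; rewrite !hopE /=.
by case: L => [|[|L]] /=; ring: e.
Qed.

(** For p = 0 the factor 1 + U of T_0 is kept outermost. Moving it past a hop costs a term at 0
    only, the one that appears in [catalan_recr00]. *)
Lemma up_hop x f L :
  up_step 1 (hop x x f) L =
    hop x x (up_step 1 f) L - (if L is 0 then x * up_step 1 f 0 else 0).
Proof.
rewrite [X in _ = X - _]hopE {1}/up_step !hopE /up_step.
by case: L => [|[|L]] /=; ring.
Qed.

Lemma up_step_sum n y (c : 'I_n -> F) (f : 'I_n -> nat -> F) :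
  up_step y (fun L => \sum_i c i * f i L) = fun L => \sum_i c i * up_step y (f i) L.
Proof.
apply/funext => L; rewrite /up_step mulr_sumr -big_split /=.
by apply: eq_bigr => i _; ring.
Qed.

Lemma hop_sum n x y (c : 'I_n -> F) (f : 'I_n -> nat -> F) :
  hop x y (fun L => \sum_i c i * f i L) = fun L => \sum_i c i * hop x y (f i) L.
Proof.
apply/funext => L; rewrite /hop up_step_sum /down_step mulr_sumr -big_split /=.
by apply: eq_bigr => i _; ring.
Qed.

Section Minors.
Variable P : F -> Prop.
Hypotheses (P0 : P 0) (P1 : P 1) (PD : forall a b, P a -> P b -> P (a + b))
  (PM : forall a b, P a -> P b -> P (a * b)).

(** [P] is an abstract nonnegativity, of which only the closure properties matter; it will be
    [is_nat_poly]. *)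
Definition nonneg_minors n (f : 'I_n -> nat -> F) :=
  forall L : 'I_n -> nat, (forall i j : 'I_n, (i < j)%N -> (L j < L i)%N) ->
    P (\det (\matrix_(i, j) f i (L j))).

(** Either the largest argument is at least n and its column is zero, or the arguments are n - 1,
    ..., 0 and the matrix is the identity. *)
Lemma nonneg_minors_dirac n : nonneg_minors (fun i : 'I_n => dirac (rev_ord i)).
Proof.
move=> L decL.
have gap m (i j : 'I_n) : j = (i + m)%N :> nat -> (L j + m <= L i)%N.
  elim: m j => [|m IH] j ej.
    by rewrite (_ : j = i) ?addn0 //; apply: val_inj; rewrite /= ej addn0.
  have lt : (i + m < n)%N by have := ltn_ord j; lia.
  have := IH (Ordinal lt) erefl; have := decL (Ordinal lt) j.
  by rewrite /= ej; move=> /(_ ltac:(lia)); lia.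
case: n => [|n'] in L decL gap *; first by rewrite det_mx00.
have [big|small] := leqP n'.+1 (L ord0).
  rewrite (expand_det_col _ ord0) big1 // => i _.
  rewrite mxE /dirac; case: eqP => [e|_]; last by rewrite mul0r.
  by move: (ltn_ord (rev_ord i)); rewrite -e ltnNge big.
rewrite (_ : \matrix_(i, j) _ = 1%:M) ?det1 //.
apply/matrixP => i j; rewrite !mxE /dirac.
rewrite (_ : L j = rev_ord j) ?(inj_eq val_inj) ?(inj_eq rev_ord_inj) 1?eq_sym //.
have := gap j ord0 j erefl; have := gap (n' - j)%N j ord_max.
have := ltn_ord j; rewrite /= => ltj /(_ ltac:(lia)); lia.
Qed.

Section Step.
Variables (c : nat -> F) (s : nat -> nat).
Hypotheses (Pc : forall L, P (c L))
  (s_lt : forall L L', (L' < L)%N -> [/\ s L' <= L, L' <= s L & s L' <= s L]%N).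

(** The determinant is additive in each column, so it is a sum over the sets J of columns kept at L,
    the others being moved to s L with the weight c L. By [s_lt] the new arguments still decrease
    weakly, and a repeated one gives two equal columns, hence 0. This replaces a count of
    nonintersecting paths. *)
Lemma nonneg_minors_step n (f : 'I_n -> nat -> F) : nonneg_minors f ->
  nonneg_minors (fun i L => f i L + c L * f i (s L)).
Proof.
move=> posf L decL.
have posw (M : 'I_n -> nat) : (forall i j : 'I_n, (i < j)%N -> (M j <= M i)%N) ->
    P (\det (\matrix_(i, j) f i (M j))).
  move=> decM.
  have [inj|] := boolP [forall i : 'I_n, forall j : 'I_n, (i < j)%N ==> (M i != M j)].
    apply: posf => i j ltij; rewrite ltn_neqAle decM // andbT eq_sym.
    by move/forallP/(_ i)/forallP/(_ j)/implyP: inj => /(_ ltij).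
  move/forallPn => [i /forallPn[j]].
  rewrite negb_imply negbK => /andP[ltij /eqP eM].
  rewrite -det_tr (@determinant_alternate _ _ _ i j) //.
    by apply/eqP => e; move: ltij; rewrite e ltnn.
  by move=> k; rewrite !mxE eM.
have -> : \det (\matrix_(i, j) (f i (L j) + c (L j) * f i (s (L j)))) =
   \sum_(J in powerset [set: 'I_n]) (\prod_(j in ~: J) c (L j)) *
     \det (\matrix_(i, j) f i (if j \in J then L j else s (L j))).
  rewrite -det_tr /determinant.
  under eq_bigr => sg _.
    under eq_bigr do rewrite !mxE.
    rewrite bigA_distr mulr_sumr.
    over.
  rewrite exchange_big /=; apply: eq_big => [J|J _]; first by rewrite powersetE subsetT.
  rewrite -[X in _ * X]det_tr /determinant mulr_sumr; apply: eq_bigr => sg _.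
  rewrite mulrCA; congr (_ * _).
  rewrite [X in X * _]big_mkcond -big_split /=; apply: eq_bigr => j _.
  by rewrite !mxE inE; case: ifP => //= _; rewrite mul1r.
elim/big_ind: _ => // J _; apply: PM; first by elim/big_ind: _.
apply: posw => i j ltij; have [h1 h2 h3] := s_lt (decL i j ltij).
by case: ifP; case: ifP => // _ _; apply: ltnW; apply: decL.
Qed.
End Step.

Lemma nonneg_minors_up n (f : 'I_n -> nat -> F) y : P y -> nonneg_minors f ->
  nonneg_minors (fun i => up_step y (f i)).
Proof.
move=> Py; apply: (@nonneg_minors_step (fun L => if L is L'.+1 then y else 0) predn).
  by case.
by move=> L L' lt; split; lia.
Qed.

Lemma nonneg_minors_down n (f : 'I_n -> nat -> F) x : P x -> nonneg_minors f ->
  nonneg_minors (fun i => down_step x (f i)).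
Proof.
move=> Px; apply: (@nonneg_minors_step (fun=> x) succn) => // L L' lt.
by split; lia.
Qed.

Lemma nonneg_minors_hop n (f : 'I_n -> nat -> F) x y : P x -> P y ->
  nonneg_minors f -> nonneg_minors (fun i => hop x y (f i)).
Proof. by move=> Px Py posf; apply/nonneg_minors_down/nonneg_minors_up. Qed.

End Minors.
End Shifts.

(** * The determinant in terms of the shift operators *)

Section Generation.
Variables (F : fieldType) (q : F).

(* The product of the T_i = (1 + q^i D)(1 + q^(i + p) U), 1 - p <= i < k, where
   U and D are the two shifts of the half-line. *)
Fixpoint hops (p k : nat) (f : nat -> F) : nat -> F :=
  if k is k'.+1 then
    if (k' + p == 0)%N then hops p k' f
    else hop (q ^+ k') (q ^+ (k' + p)) (hops p k' f)
  else f.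

Definition transfer (p k : nat) (f : nat -> F) : nat -> F :=
  if p is 0 then up_step 1 (hops p k f) else hops p k f.

Lemma hops_hopC p k i f :
  hops p k (hop (q ^+ i) (q ^+ (i + p)) f) = hop (q ^+ i) (q ^+ (i + p)) (hops p k f).
Proof.
elim: k => //= k ->; case: ifP => // _; apply: hopC.
by rewrite -!exprD; congr (_ ^+ _); lia.
Qed.

Lemma hops_sum n p k (c : 'I_n -> F) (f : 'I_n -> nat -> F) :
  hops p k (fun L => \sum_i c i * f i L) = fun L => \sum_i c i * hops p k (f i) L.
Proof. by elim: k => //= k ->; case: ifP => // _; rewrite hop_sum. Qed.

Lemma transfer_sum n p k (c : 'I_n -> F) (f : 'I_n -> nat -> F) :
  transfer p k (fun L => \sum_i c i * f i L) =
    fun L => \sum_i c i * transfer p k (f i) L.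
Proof. by case: p => [|p]; rewrite /transfer hops_sum // up_step_sum. Qed.

(** The vector T_(k+I-1) ... T_k delta_0. It is supported on [0, I] and its value at I is a power of
    q, so for I < n these vectors are obtained from delta_0, ..., delta_(n-1) by a triangular
    matrix. *)
Fixpoint start_comb (p k I : nat) : nat -> F :=
  if I is I'.+1 then hop (q ^+ (k + I')) (q ^+ (k + I' + p)) (start_comb p k I')
  else dirac F 0.

Lemma start_comb_gt p k I L : (I < L)%N -> start_comb p k I L = 0.
Proof.
elim: I L => [|I IH] [|L] //= ltIL; rewrite hopE /= !IH ?mulr0 ?addr0 //; lia.
Qed.

Lemma start_comb_diag p k I :
  start_comb p k I I = \prod_(i < I) q ^+ (k + i + p).
Proof.
elim: I => [|I IH]; first by rewrite big_ord0.
rewrite big_ord_recr /= hopE /= IH (@start_comb_gt _ _ _ I.+1) //.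
by rewrite (@start_comb_gt _ _ _ I.+2) //; ring.
Qed.

Lemma hops_start p k I : (0 < k)%N ->
  hops p (k + I) (dirac F 0) = hops p k (start_comb p k I).
Proof.
move=> k0; elim: I => [|I IH]; first by rewrite addn0.
(* As 0 < k, the factor that [hops] skips when p = 0 is not among the added ones. *)
by rewrite addnS /= hops_hopC -IH; case: ifP => //; lia.
Qed.

Lemma transfer_start p k I : (0 < k)%N ->
  transfer p (k + I) (dirac F 0) = transfer p k (start_comb p k I).
Proof. by move=> k0; rewrite /transfer hops_start. Qed.

Section Nonneg.
Variable P : F -> Prop.
Hypotheses (P0 : P 0) (P1 : P 1) (Pq : P q) (PD : forall a b, P a -> P b -> P (a + b))
  (PM : forall a b, P a -> P b -> P (a * b)).

Lemma nonneg_minors_transfer n p k (f : 'I_n -> nat -> F) :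
  nonneg_minors P f -> nonneg_minors P (fun i => transfer p k (f i)).
Proof.
have PX m : P (q ^+ m) by elim: m => // m IH; rewrite exprS; apply: PM.
move=> posf; have pos_hops: nonneg_minors P (fun i => hops p k (f i)).
  elim: k => //= k IH; case: (k + p == 0)%N => //.
  exact: nonneg_minors_hop.
by rewrite /transfer; case: p pos_hops => // pos_hops; apply: nonneg_minors_up.
Qed.
End Nonneg.

Local Notation "[ m ]q" := (qint q m) (format "[ m ]q").
Hypothesis qint_neq0 : forall m, [m.+1]q != 0.

(** The contribution of the left neighbour is replaced by - q^K times the value at 0, in agreement
    with the correction in [up_hop]. *)
Lemma catalan_recr00 K :
  catalan q 0 K.+1 0 = (1 + q ^+ (K + K)) * catalan q 0 K 0
    + q ^+ K * catalan q 0 K 1 - q ^+ K * catalan q 0 K 0.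
Proof.
have ineq := qint_neq0; have neq := qfact_neq0 qint_neq0.
have e K' : catalan q 0 K' 0 =
    qfact q (K' + K') / (qfact q K' * qfact q K'.+1).
  by rewrite /catalan subn0 !addn0 qint1 mulr1.
have e1 : catalan q 0 K 1 = qfact q (K + K) * ([3]q * [K]q * [K.+1]q) /
    (qfact q K * [K.+1]q * qfact q K.+1 * [K.+2]q).
  rewrite /catalan; case: K => [|K]; first by rewrite qint0 !(mulr0, mul0r).
  rewrite subn1 /= !addn0 !addn1 (qfactS q K.+2) (qfactS q K.+1) (qfactS q K).
  move: (ineq K) (ineq K.+1) (ineq K.+2) (neq K).
  move: [3]q [K.+1]q [K.+2]q [K.+3]q (qfact q K) (qfact q _) => a b c d f g b0 c0 d0 f0.
  by field; rewrite b0 c0 d0 f0.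
rewrite e1 !e addnS (qfactS q (K + K).+1) (qfactS q (K + K)) (qfactS q K.+1).
rewrite (qfactS q K).
have := ineq K; have := ineq K.+1; have := neq K.
rewrite !(qintD, qintX, qintS, qint0).
move: [K]q (qfact q K) (qfact q _) => a f g f0 b0 c0.
by field; rewrite f0 b0 c0.
Qed.

(** The binomial exponent grows by L + p from L to L + 1. This turns the coefficients q^(K - L') and
    q^(K + L + p) of [catalan_recr] into q^(K + p) and q^K, which no longer depend on L and are
    those of a hop. *)
Lemma transfer_catalan p K L : (p <= 1)%N -> (0 < K + p)%N ->
  transfer p K (dirac F 0) L = q ^+ 'C(L + p, 2) * catalan q p K L.
Proof.
have binS m : 'C(m.+1, 2) = ('C(m, 2) + m)%N by rewrite binS bin1 addnC.
move=> p1; elim: K L => [|K IH] L Kp0.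
  have -> /= : p = 1%N by lia.
  case: L => [|L]; last by rewrite catalan_gt ?mulr0.
  by rewrite catalan_diag // mulr1.
(* For p = 0 the passage from K = 0 to K = 1 adds no hop: the transfer by T_0 is the [up_step]
   alone. *)
have [K0|K0] := eqVneq (K + p)%N 0%N.
  have [-> ->] : K = 0%N /\ p = 0%N by lia.
  rewrite /transfer /= /up_step /dirac.
  case: L => [|[|L]].
  - rewrite catalan_recr00 catalan_diag // catalan_gt //= expr0; ring.
  - by rewrite catalan_diag //= !(mulr1, mul1r, add0r).
  by rewrite catalan_gt // !(mulr0, addr0).
have rec (f := transfer p K (dirac F 0)) : transfer p K.+1 (dirac F 0) L =
    hop (q ^+ K) (q ^+ (K + p)) f L
    - (if (L + p == 0)%N then q ^+ K * f 0%N else 0).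
  rewrite /f /transfer /= (negbTE K0); case: p p1 {IH Kp0 K0 f} => [|p] p1.
    by rewrite addn0 up_hop addn0; case: (L).
  by rewrite (_ : (L + p.+1 == 0)%N = false) ?subr0 //; lia.
rewrite {}rec hopE !IH //; try lia.
have [/eqP Lp0|Lp0] := boolP (L + p == 0)%N.
  have [-> ->] : L = 0%N /\ p = 0%N by lia.
  by rewrite catalan_recr00 !addn0 /= !expr0 exprD; ring.
rewrite catalan_recr //; last by rewrite lt0n.
rewrite addSn binS; case: L {Lp0} => [|L]; rewrite ?addSn ?binS /= !exprD; first by ring.
(* The exponent K - L is truncated and means what it should only for L <= K; otherwise all the
   values involved vanish. *)
have [leLK|ltKL] := leqP L K; last by rewrite !(catalan_gt _ _ ltKL) ?(catalan_gt _ _ (leqW ltKL)) ?(catalan_gt _ _ (leqW (leqW ltKL))); ring.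
have -> : q ^+ K = q ^+ (K - L) * q ^+ L by rewrite -exprD subnK.
rewrite !exprS exprD; move: (q ^+ (K - L)) (q ^+ L) (q ^+ p) => a b c.
by ring.
Qed.

Lemma MBC_catalan n k (lam : 'I_n -> nat) p :
  MBC q k lam p = \det (\matrix_(i < n, j < n)
    catalan q p (k + rev_ord i) (lam j + rev_ord j)).
Proof.
congr (\det _); apply/matrixP => i j; rewrite !mxE -qcat_catalan.
have revE (l : 'I_n) : rev_ord l = (n - l.+1)%N :> nat by [].
rewrite !revE; have := ltn_ord i; have := ltn_ord j => ? ?.
by congr (@qcat F q _ _); lia.
Qed.

Lemma MBC_transfer n k (lam : 'I_n -> nat) p : (p <= 1)%N -> (0 < k)%N ->
  (\prod_(j < n) q ^+ 'C(lam j + rev_ord j + p, 2)) * MBC q k lam p =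
  (\prod_(i < n) \prod_(i' < rev_ord i) q ^+ (k + i' + p)) *
  \det (\matrix_(i < n, j < n) transfer p k (dirac F (rev_ord i)) (lam j + rev_ord j)).
Proof.
move=> p1 k0; rewrite MBC_catalan.
pose w := \matrix_(i < n, j < n)
   transfer p (k + rev_ord i) (dirac F 0) (lam j + rev_ord j).
transitivity (\det w).
  rewrite (_ : w = (\matrix_(i < n, j < n)
    catalan q p (k + rev_ord i) (lam j + rev_ord j))
     *m diag_mx (\row_j q ^+ 'C(lam j + rev_ord j + p, 2))); last first.
    apply/matrixP => i j; rewrite mul_mx_diag !mxE [RHS]mulrC; apply: transfer_catalan; lia.
  by rewrite det_mulmx det_diag mulrC; congr (_ * _); apply: eq_bigr => j _; rewrite mxE.
pose c := \matrix_(i < n, i' < n) start_comb p k (rev_ord i) (rev_ord i').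
rewrite (_ : w = c *m
  \matrix_(i < n, j < n) transfer p k (dirac F (rev_ord i)) (lam j + rev_ord j)).
  rewrite det_mulmx -(det_tr c) det_trig; last first.
    apply/is_trig_mxP => i i' ltii'; rewrite !mxE start_comb_gt //=.
    by have := ltn_ord i'; lia.
  congr (_ * _); apply: eq_bigr => i _.
  by rewrite !mxE start_comb_diag.
apply/matrixP => i j; rewrite !mxE transfer_start //.
rewrite (_ : start_comb p k (rev_ord i) = fun L => \sum_(i' < n)
   start_comb p k (rev_ord i) (rev_ord i') * dirac F (rev_ord i') L).
  by rewrite transfer_sum; apply: eq_bigr => i' _; rewrite !mxE.
(* Starting combinations of index below n vanish from n on, so the n available delta functions
   suffice. *)
apply/funext => L; have [ltLn|leLn] := ltnP L n.
  rewrite (bigD1 (rev_ord (Ordinal ltLn))) // rev_ordK /dirac eqxx mulr1.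
  rewrite big1 /= ?addr0 // => i' ne; rewrite (_ : (L == _) = false) ?mulr0 //.
  by apply: contra_neqF ne => /eqP e; apply: rev_ord_inj; rewrite rev_ordK; apply: val_inj.
rewrite start_comb_gt; last by apply: leq_trans leLn.
rewrite big1 // => i' _; rewrite /dirac (_ : (L == _) = false) ?mulr0 //.
by apply/eqP => e; have := ltn_ord (rev_ord i'); rewrite -e ltnNge leLn.
Qed.

End Generation.

(** * Polynomials with nonnegative coefficients among the rational functions *)

Lemma qvarX m : qvar ^+ m = tofrac ('X^m : {poly int}).
Proof. by rewrite /qvar -rmorphXn. Qed.

Lemma qint_qvar m : qint qvar m = tofrac (\sum_(i < m) 'X^i : {poly int}).
Proof. by rewrite /qint rmorph_sum; apply: eq_bigr => i _; rewrite qvarX. Qed.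

Lemma qint_qvar_neq0 m : qint qvar m.+1 != 0.
Proof.
rewrite qint_qvar tofrac_eq0; apply/eqP => /(congr1 (fun p : {poly int} => p`_0)).
rewrite coef0 coef_sum big_ord_recl big1 ?addr0 ?coefXn //= => i _.
by rewrite coefXn.
Qed.

Lemma qvar_neq0 : qvar != 0.
Proof. by rewrite tofrac_eq0 polyX_eq0. Qed.

Lemma qvar_neq1 : qvar - 1 != 0.
Proof. by rewrite -(rmorph1 (@tofrac _)) -rmorphB tofrac_eq0 -polyC1 polyXsubC_eq0. Qed.

Lemma qint_rat_neq0 m : qint (1 : rat) m.+1 != 0.
Proof.
rewrite /qint (eq_bigr (fun=> 1)) => [|i _]; last by rewrite expr1n.
by rewrite sumr_const card_ord pnatr_eq0.
Qed.

Lemma is_nat_poly0 : is_nat_poly 0.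
Proof. by exists 0; split=> [i|]; rewrite ?coef0 ?rmorph0. Qed.

Lemma is_nat_poly1 : is_nat_poly 1.
Proof. by exists 1; split=> [i|]; rewrite ?coef1 ?rmorph1 ?ler0n. Qed.

Lemma is_nat_polyq : is_nat_poly qvar.
Proof. by exists 'X; split=> // i; rewrite coefX ler0n. Qed.

Lemma is_nat_polyD f g : is_nat_poly f -> is_nat_poly g -> is_nat_poly (f + g).
Proof.
move=> [P [P0 ->]] [Q [Q0 ->]]; exists (P + Q); split=> [i|]; last by rewrite rmorphD.
by rewrite coefD addr_ge0.
Qed.

Lemma is_nat_polyM f g : is_nat_poly f -> is_nat_poly g -> is_nat_poly (f * g).
Proof.
move=> [P [P0 ->]] [Q [Q0 ->]]; exists (P * Q); split=> [i|]; last by rewrite rmorphM.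
by rewrite coefM sumr_ge0 // => j _; rewrite mulr_ge0.
Qed.

Lemma is_nat_polyX m : is_nat_poly (qvar ^+ m).
Proof.
elim: m => [|m IH]; first exact: is_nat_poly1.
by rewrite exprS; apply: is_nat_polyM => //; apply: is_nat_polyq.
Qed.

(** Once the quotient by q^m is known to be a polynomial, dividing only shifts the coefficients. *)
Lemma is_nat_poly_mulqX m (P : {poly int}) :
  is_nat_poly (qvar ^+ m * tofrac P) -> is_nat_poly (tofrac P).
Proof.
move=> [Q [Q0]]; rewrite qvarX -rmorphM => /eqP; rewrite tofrac_eq => /eqP e.
exists P; split=> // i; have := Q0 (m + i)%N; rewrite -e coefXnM.
by rewrite ltnNge leq_addr /= addKn.
Qed.

(** The defining formula is a quotient of q-factorials, but the recursions have polynomial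
    coefficients. *)
Lemma catalan_poly p K L : (p <= 1)%N ->
  exists P : {poly int}, catalan qvar p K L = tofrac P.
Proof.
move=> p1; have ne := qint_qvar_neq0.
elim: K L => [|K IH] L.
  case: L => [|L]; first by exists 1; rewrite catalan_diag // rmorph1.
  by exists 0; rewrite catalan_gt // rmorph0.
have [P0 e0] := IH L; have [P1 e1] := IH L.+1.
have [/eqP Lp0|Lp0] := boolP (L + p == 0)%N.
  have [Le pe] : L = 0%N /\ p = 0%N by lia.
  exists ((1 + 'X^(K + K)) * P0 + 'X^K * P1 - 'X^K * P0).
  by rewrite !(rmorphD, rmorphN, rmorphM, rmorph1) /= -!qvarX -e0 -e1 pe Le catalan_recr00.
rewrite catalan_recr //; last by rewrite lt0n.
case: L {Lp0} e0 e1 => [|L] e0 e1.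
  exists ((1 + 'X^(K + K + p)) * P0 + 0 + 'X^(K + 0 + p) * P1).
  by rewrite !(rmorphD, rmorphM, rmorph1, rmorph0) /= -!qvarX -e0 -e1.
have [P2 e2] := IH L.
exists ((1 + 'X^(K + K + p)) * P0 + 'X^(K - L) * P2 + 'X^(K + L.+1 + p) * P1).
by rewrite !(rmorphD, rmorphM, rmorph1) /= -!qvarX -e0 -e1 -e2.
Qed.

Lemma nat_poly_MBC n k (lam : 'I_n -> nat) p : (p <= 1)%N -> (0 < k)%N ->
  part_in_rect k lam -> is_nat_poly (MBC qvar k lam p).
Proof.
move=> p1 k0 [lam_dec _].
have [P eP] : exists P : {poly int}, MBC qvar k lam p = tofrac P.
  pose A := \matrix_(i < n, j < n)
    sval (cid (catalan_poly (k + rev_ord i) (lam j + rev_ord j) p1)).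
  exists (\det A); rewrite MBC_catalan -det_map_mx; congr (\det _).
  by apply/matrixP => i j; rewrite !mxE; case: cid => P.
(* The exponent of the power of q that multiplies the determinant in [MBC_transfer]. *)
rewrite eP; pose e := (\sum_(j < n) 'C(lam j + rev_ord j + p, 2))%N.
apply: (@is_nat_poly_mulqX e).
rewrite -eP /e expr_sum (MBC_transfer qint_qvar_neq0) //.
have nnM := is_nat_polyM; have nn1 := is_nat_poly1.
apply: is_nat_polyM.
  elim/big_ind: _ => // i _; elim/big_ind: _ => // j _.
  exact: is_nat_polyX.
apply: (nonneg_minors_transfer is_nat_poly0 is_nat_poly1 is_nat_polyq is_nat_polyD
  is_nat_polyM) => [|i j ltij].
  exact: (nonneg_minors_dirac is_nat_poly0 is_nat_poly1).
have := lam_dec i j (ltnW ltij); have := ltn_ord j; rewrite /=; lia.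
Qed.

(** * Product formulas *)

Section ProductFormula.
Variables (F : fieldType) (q : F) (p : nat).
Local Notation "[ m ]q" := (qint q m) (format "[ m ]q").
Hypothesis p1 : (p <= 1)%N.
Hypothesis qint_neq0 : forall m, [m.+1]q != 0.
Hypothesis q_neq0 : q != 0.
Hypothesis q_neq1 : q - 1 != 0.

(** With truncated subtraction, (x - z) + (z - x) is |x - z|; the factor is symmetric. *)
Definition pair_factor (x z : nat) : F := [(x - z) + (z - x)]q * [(x + z + p).+1]q.

(** The contribution of the coroots eps_i, present in type C (p = 1) and absent in type D (p =
    0). *)
Definition single_factor (x : nat) : F := if p is 0 then 1 else [x.+1]q.

Lemma pair_factorC x z : pair_factor x z = pair_factor z x.
Proof. by rewrite /pair_factor addnC [(x + z)%N]addnC. Qed.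

Lemma pair_factor_neq0 x z : x != z -> pair_factor x z != 0.
Proof.
move=> ne; rewrite mulf_neq0 //.
by have -> : (x - z + (z - x) = ((x - z) + (z - x)).-1.+1)%N by lia.
Qed.

Lemma single_factor_neq0 x : single_factor x != 0.
Proof. by rewrite /single_factor; case: p => [|_]; rewrite ?oner_neq0. Qed.

(** For z in [0, N) other than x, |x - z| runs over 1, ..., x and 1, ..., N - 1 - x, while x + z + p
    + 1 runs over x + p + 1, ..., x + p + N without the value at z = x. The remaining quotient
    [x + p]! / [x]! is [single_factor x]. *)
Lemma prod_pair_factor N x : (x < N)%N ->
  (\prod_(z < N | z != x :> nat) pair_factor x z) * ([(x + x + p).+1]q * single_factor x) =
  qfact q (N.-1 - x) * qfact q (N + x + p).
Proof.
move=> ltxN; rewrite /pair_factor big_split /=.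
have qfactE m : qfact q m = \prod_(z < m) [z.+1]q.
  by rewrite /qfact big_add1 big_mkord.
have diff d : \prod_(z < (x + d).+1 | z != x :> nat) [(x - z) + (z - x)]q =
    qfact q x * qfact q d.
  elim: d => [|d IH].
    rewrite addn0 qfact0 mulr1 big_mkcond big_ord_recr /= eqxx mulr1 qfactE.
    rewrite [RHS](reindex_inj rev_ord_inj); apply: eq_bigr => z _ /=.
    have ltzx := ltn_ord z; rewrite neq_ltn ltzx /=.
    by congr (qint q _); lia.
  rewrite big_mkcond addnS big_ord_recr -big_mkcond /= IH qfactS.
  rewrite (_ : (_ != x)) ?mulrA; last by rewrite neq_ltn; lia.
  by congr (_ * qint q _); lia.
have sum M : (\prod_(z < M) [(x + z + p).+1]q) * qfact q (x + p) = qfact q (M + x + p).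
  elim: M => [|M IH]; first by rewrite big_ord0 mul1r add0n.
  by rewrite big_ord_recr /= mulrAC IH addSn addSn qfactS (addnC M x).
have := sum N; rewrite (bigD1 (Ordinal ltxN)) //=.
rewrite (eq_bigl (fun z : 'I_N => z != x :> nat)) //.
have -> : qfact q (x + p) = qfact q x * single_factor x.
  rewrite /single_factor; case: p p1 => [|[]] // _; first by rewrite addn0 mulr1.
  by rewrite addn1 qfactS.
move=> <-; have eN : N = (x + (N.-1 - x)).+1 by lia.
have := diff (N.-1 - x)%N; rewrite -eN => ->; move: (\prod_(i < N | _) _) (qfact q x) => a b; ring.
Qed.

Section Complement.
Variable N : nat.
Implicit Types S : {set 'I_N}.

Definition set_factor S : F :=
  (\prod_(x in S) \prod_(z in S | (z < x)%N) pair_factor x z).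

(** The column factor in [catalan_node]. By [prod_pair_factor] it is the inverse of
    [single_factor x] times the pair factors of x with all other points of [0, N). *)
Definition point_factor (x : nat) : F :=
  [(x + x + p).+1]q / (qfact q (N.-1 - x) * qfact q (N + x + p)).

(** Let V be [set_factor] and R the product over the pairs across S and its complement. The pair
    factors of the points of S with all other points multiply to V(S)^2 R, and V of the whole
    interval is V(S) V(~: S) R. So V(S) divided by the former is V(~: S) divided by a constant. *)
Lemma set_factor_compl : exists c, forall S,
  set_factor S * (\prod_(x in S) point_factor x) =
  c * (set_factor (~: S) * \prod_(x in ~: S) single_factor x).
Proof.
pose X x := \prod_(z < N | z != x :> nat) pair_factor x z.
pose cross S := \prod_(x in S) \prod_(z in ~: S) pair_factor x z.
pose h S := \prod_(x in S) single_factor x.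
have pairXC S : \prod_(x in S) \prod_(z in S | (x < z)%N) pair_factor x z = set_factor S.
  rewrite /set_factor (exchange_big_dep (mem S)) /=; last by move=> i j _ /andP[].
  apply: eq_bigr => z zS; apply: eq_big => [x|x _]; first by rewrite zS.
  exact: pair_factorC.
have prodX S : \prod_(x in S) X x = set_factor S * set_factor S * cross S.
  rewrite -{2}pairXC /cross -!big_split /=; apply: eq_bigr => x xS.
  rewrite /X (bigID (mem S)) /=; congr (_ * _); last first.
    apply: eq_bigl => z; rewrite inE; case: (z \in S) / boolP => //= zS; rewrite ?andbF // andbT.
    by apply: contraNneq zS => /val_inj->.
  rewrite (bigID (fun z : 'I_N => (z < x)%N)) /=; congr (_ * _).
    by apply: eq_bigl => z; rewrite andbC andbA; case: ltngtP; rewrite ?andbF ?andbT.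
  by apply: eq_bigl => z; rewrite andbC; case: ltngtP; rewrite ?andbF ?andbT.
have total S : set_factor setT = set_factor S * set_factor (~: S) * cross S.
  have splitz (P : pred 'I_N) (f : 'I_N -> F) :
      \prod_(z in setT | P z) f z =
      (\prod_(z in S | P z) f z) * (\prod_(z in ~: S | P z) f z).
    rewrite (bigID (mem S)) /=; congr (_ * _); apply: eq_bigl => z;
      by rewrite !inE andbC.
  have splitz0 (f : 'I_N -> F) :
      \prod_(z in [set: 'I_N]) f z = (\prod_(z in S) f z) * (\prod_(z in ~: S) f z).
    by rewrite (bigID (mem S)) /=; congr (_ * _); apply: eq_bigl => z; rewrite !inE.
  rewrite /set_factor splitz0; under eq_bigr do rewrite splitz.
  under [X in _ * X = _]eq_bigr do rewrite splitz.
  rewrite !big_split /=.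
  have -> : cross S = (\prod_(x in S) \prod_(z in ~: S | (z < x)%N) pair_factor x z) *
     \prod_(x in ~: S) \prod_(z in S | (z < x)%N) pair_factor x z.
    rewrite [X in _ * X](exchange_big_dep (mem S)) /=; last by move=> x z _ /andP[].
    rewrite -big_split /=; apply: eq_bigr => x xS.
    rewrite (bigID (fun z : 'I_N => (z < x)%N)) /=; congr (_ * _).
    apply: eq_big => [z|z _]; last exact: pair_factorC.
    rewrite !inE xS /= -leqNgt leq_eqVlt; case: ltngtP; rewrite ?orbF ?orbT //=.
    by move=> /val_inj <-; rewrite xS.
  by move: (\prod_(x in S) _) (\prod_(x in ~: S) _) => *; ring.
have X_neq0 S : \prod_(x in S) X x != 0.
  apply/prodf_neq0 => x _; apply/prodf_neq0 => z; rewrite eq_sym; exact: pair_factor_neq0.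
have h_neq0 S : h S != 0 by apply/prodf_neq0 => x _; apply: single_factor_neq0.
have point S : \prod_(x in S) point_factor x = (\prod_(x in S) X x * h S)^-1.
  rewrite /h -big_split -prodfV; apply: eq_bigr => x _ /=; rewrite /point_factor.
  rewrite -prod_pair_factor // -/(X x).
  have X0 : X x != 0.
    by apply/prodf_neq0 => z; rewrite eq_sym; apply: pair_factor_neq0.
  have h0 := single_factor_neq0 x; have i0 := qint_neq0 (x + x + p).
  by field; rewrite X0 h0 i0.
have set_neq0 S : set_factor S != 0.
  apply/prodf_neq0 => x _; apply/prodf_neq0 => z /andP[_ ltzx].
  by apply: pair_factor_neq0; rewrite neq_ltn ltzx orbT.
have cross_neq0 S : cross S != 0.
  apply/prodf_neq0 => x xS; apply/prodf_neq0 => z; rewrite inE => zS.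
  by apply: pair_factor_neq0; apply: contraNneq zS => /val_inj <-.
exists (set_factor setT * h setT)^-1 => S; rewrite point prodX (total S).
have -> : h setT = h S * h (~: S).
  rewrite /h (bigID (mem S)) /=; congr (_ * _); apply: eq_bigl => x;
    by rewrite !inE.
rewrite -/(h (~: S)).
move: (set_neq0 S) (set_neq0 (~: S)) (cross_neq0 S) (h_neq0 S) (h_neq0 (~: S)).
move: (set_factor S) (set_factor _) (cross S) (h S) (h _) => a b c d e a0 b0 c0 d0 e0.
by field; rewrite a0 b0 c0 d0 e0.
Qed.
End Complement.

End ProductFormula.

(** With 0-based indices, the conjugate part counts the l with lambda_l < k - i, and these are the
    last rows. If lambda_j < k - i the count is at least n - j, and M i exceeds lambda_j + n - 1 -
    j; otherwise it is at most n - 1 - j, and M i is smaller. *)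
Lemma conj_compl_setC n k (lam : 'I_n -> nat) (M := fun i : 'I_k =>
    (conj_part k (compl_part k lam) i + rev_ord i)%N) :
  part_in_rect k lam ->
  [/\ forall i j : 'I_k, (i < j)%N -> (M j < M i)%N,
     forall i, (M i < n + k)%N &
     forall i j, M i != (lam j + rev_ord j)%N].
Proof.
move=> [lam_dec lam_le].
have conjE (i : 'I_k) : conj_part k (compl_part k lam) i = #|[set l : 'I_n | (lam l < k - i)%N]|.
  rewrite /conj_part -(card_imset _ rev_ord_inj); apply: eq_card => l.
  rewrite inE -{1}(rev_ordK l) mem_imset; last exact: rev_ord_inj.
  by rewrite inE /compl_part rev_ordK; apply/idP/idP; lia.
split=> [i j ltij|i|i j].
- rewrite /M !conjE /=; have := ltn_ord j; have := ltn_ord i.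
  set a := #|_|; set b := #|_|; suff : (a <= b)%N by lia.
  by apply: subset_leq_card; apply/subsetP => l; rewrite !inE; lia.
- apply: leq_ltn_trans (leq_add (max_card _) (leqnn _)) _.
  by rewrite card_ord /=; have := ltn_ord i; lia.
have cardlt m : (m <= n)%N -> #|[set l : 'I_n | (l < m)%N]| = m.
  move=> lemn; rewrite cardsE -[RHS](card_ord m).
  have inj : injective (widen_ord lemn) by move=> a b /(congr1 val) /= e; apply: val_inj.
  rewrite -(card_imset _ inj).
  apply: eq_card => l; apply/idP/imsetP => [ltlm|[l' _ ->]]; last exact: (ltn_ord l').
  by exists (Ordinal ltlm) => //; apply: val_inj.
have cardge m : (m <= n)%N -> #|[set l : 'I_n | (m <= l)%N]| = (n - m)%N.
  move=> lemn; have e : ~: [set l : 'I_n | (l < m)%N] = [set l : 'I_n | (m <= l)%N].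
    by apply/setP => l; rewrite !inE -leqNgt.
  by rewrite -e; have := cardsC [set l : 'I_n | (l < m)%N]; rewrite cardlt // card_ord; lia.
rewrite /M conjE /=; have ltj := ltn_ord j; have lti := ltn_ord i.
set A := [set _ | _]; have [lt|ge] := ltnP (lam j) (k - i).
  have : (n - j <= #|A|)%N.
    rewrite -cardge; last exact: ltnW.
    apply: subset_leq_card; apply/subsetP => l; rewrite !inE => /lam_dec le.
    exact: leq_ltn_trans lt.
  move=> le; rewrite neq_ltn; apply/orP; right.
  by apply: leq_trans (leq_add le (leqnn _)); lia.
have : (#|A| <= n - j.+1)%N.
  rewrite -cardge //.
  apply: subset_leq_card; apply/subsetP => l; rewrite !inE => lt.
  by rewrite ltnNge; apply/negP => /lam_dec le; lia.
move=> le; rewrite neq_ltn; apply/orP; left.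
by apply: leq_ltn_trans (leq_add le (leqnn _)) _; lia.
Qed.

(** * Evaluation by a Vandermonde determinant *)

Section Evaluation.
Variables (F : fieldType) (q : F) (p : nat).
Local Notation "[ m ]q" := (qint q m) (format "[ m ]q").
Hypothesis p1 : (p <= 1)%N.
Hypothesis qint_neq0 : forall m, [m.+1]q != 0.
Hypothesis q_neq0 : q != 0.
Hypothesis q_neq1 : q - 1 != 0.

(** Invariant under the reflection L -> - L - p - 1, which is why a difference of nodes factors into
    [a - L] and [a + L + p + 1]. *)
Definition node (L : nat) : F := q ^- L + q ^+ (L + p).+1.

Lemma node_sub a L : (L <= a)%N ->
  node a - node L = (q - 1) ^+ 2 * q ^- a * ([a - L]q * [(a + L + p).+1]q).
Proof.
move=> leLa; have [d ->] : exists d, a = (L + d)%N by exists (a - L)%N; lia.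
have qm m : (q - 1) * [m]q = q ^+ m - 1 by rewrite qintX; ring.
rewrite expr2 addKn; transitivity (q ^- (L + d) * ((q - 1) * [d]q)
  * ((q - 1) * [(L + d + L + p).+1]q)); last by ring.
rewrite !qm /node -!addnS !exprD.
have : q ^+ L != 0 by rewrite expf_neq0.
have : q ^+ d != 0 by rewrite expf_neq0.
move: (q ^+ L) (q ^+ d) (q ^+ p.+1) => x y z y0 x0.
by field; rewrite x0 y0.
Qed.

Lemma prod_qint_down A i : (i <= A)%N ->
  (\prod_(m < i) [A - m]q) * qfact q (A - i) = qfact q A.
Proof.
elim: i => [|i IH] leiA; first by rewrite big_ord0 mul1r subn0.
rewrite big_ord_recr /= -mulrA -(IH (ltnW leiA)); congr (_ * _).
rewrite (_ : (A - i)%N = (A - i.+1).+1); last by lia.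
by rewrite qfactS mulrC.
Qed.

(** Put K = k + n - 1 - i, with i 0-based. Taking out [point_factor] leaves [n+k-1-L]! / [K-L]! and
    [n+k+L+p]! / [K+L+p+1]!, with i factors each; paired, they are node differences. The nodes
    involved are those of the L strictly between K and n + k, where the entry vanishes. *)
Lemma catalan_node n k (i : 'I_n) L : (L < n + k)%N ->
  catalan q p (k + rev_ord i) L =
    qfact q ((k + rev_ord i) + (k + rev_ord i) + p) *
    ((\prod_(m < i) (q ^+ (k + (n - m.+1)) / (q - 1) ^+ 2)) *
     (\prod_(m < i) (node (k + (n - m.+1)) - node L))) * point_factor q p (n + k) L.
Proof.
move=> ltL; rewrite -big_split /=; set K := (k + (n - i.+1))%N.
have lti := ltn_ord i.
have [leLK|ltKL] := leqP L K; last first.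
  have ltm : (n + k - L.+1 < i)%N by rewrite /K in ltKL; lia.
  rewrite catalan_gt // (bigD1 (Ordinal ltm)) //=.
  rewrite (_ : (k + (n - (n + k - L.+1).+1))%N = L); last by rewrite /K in ltKL; lia.
  by rewrite subrr !(mulr0, mul0r).
rewrite (eq_bigr (fun m : 'I_i => [n + k - L.+1 - m]q * [n + k + L + p - m]q)) => [|m _].
  have := @prod_qint_down (n + k - L.+1) i; have := @prod_qint_down (n + k + L + p) i.
  rewrite (_ : (n + k - L.+1 - i = K - L)%N); last by rewrite /K; lia.
  rewrite (_ : (n + k + L + p - i = (K + L + p).+1)%N); last by rewrite /K; lia.
  move=> /(_ ltac:(lia)) e1 /(_ ltac:(rewrite /K in leLK; lia)) e2.
  rewrite big_split /= /point_factor (_ : (n + k).-1 - L = n + k - L.+1)%N; last by lia.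
  rewrite -e1 -e2 /catalan leLK.
  have := qfact_neq0 qint_neq0 (K - L); have := qfact_neq0 qint_neq0 (K + L + p).+1.
  have : \prod_(m < i) [n + k - L.+1 - m]q != 0.
    apply/prodf_neq0 => m _; rewrite (_ : (_ - m)%N = (n + k - L.+1 - m).-1.+1) //.
    by have := ltn_ord m; rewrite /K in leLK; lia.
  have : \prod_(m < i) [n + k + L + p - m]q != 0.
    apply/prodf_neq0 => m _; rewrite (_ : (_ - m)%N = (n + k + L + p - m).-1.+1) //.
    by have := ltn_ord m; lia.
  move: (\prod_(m < i) _) (\prod_(m < i) _) (qfact q (K - L)) (qfact q (_).+1).
  by move=> a b c d a0 b0 c0 d0; field; rewrite a0 b0 c0 d0.
have ltm := ltn_ord m.
rewrite node_sub; last by rewrite /K in leLK; lia.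
rewrite (_ : (n + k - L.+1 - m = k + (n - m.+1) - L)%N); last by lia.
rewrite (_ : (n + k + L + p - m = (k + (n - m.+1) + L + p).+1)%N); last by lia.
have : q ^+ (k + (n - m.+1)) != 0 by rewrite expf_neq0.
move: (q ^+ (k + _)) [_ - L]q [_.+1]q => a b c a0.
by field; rewrite a0 q_neq1.
Qed.

(** The matrix is a coefficient matrix times a Vandermonde matrix times a diagonal one. The
    determinant of the first is never computed: what counts is that c does not depend on lambda. *)
Lemma MBC_node n k : exists c, forall lam : 'I_n -> nat,
  (forall j, lam j + rev_ord j < n + k)%N ->
  MBC q k lam p = c * ((\prod_(j < n) point_factor q p (n + k) (lam j + rev_ord j)) *
    \prod_(i < n) \prod_(j < n | (i < j)%N)
      (node (lam j + rev_ord j) - node (lam i + rev_ord i))).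
Proof.
pose P (i : 'I_n) : {poly F} := \prod_(m < i) ((node (k + (n - m.+1)))%:P - 'X).
pose a (i : 'I_n) := qfact q ((k + rev_ord i) + (k + rev_ord i) + p) *
    (\prod_(m < i) (q ^+ (k + (n - m.+1)) / (q - 1) ^+ 2)).
pose C := \matrix_(i < n, d < n) (a i * (P i)`_d).
exists (\det C) => lam ltlam; rewrite (MBC_catalan q).
pose x := \row_j node (lam j + rev_ord j).
transitivity (\det (C *m Vandermonde n x *m
  diag_mx (\row_j point_factor q p (n + k) (lam j + rev_ord j)))).
  congr (\det _); apply/matrixP => i j; rewrite mul_mx_diag !mxE catalan_node //.
  congr (_ * _); rewrite mulrA -/(a i).
  under [RHS]eq_bigr do rewrite !mxE -mulrA.
  rewrite -mulr_sumr; congr (_ * _).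
  rewrite -(@horner_coef_wide _ n (P i)).
    rewrite horner_prod; apply: eq_bigr => m _.
    by rewrite !hornerE.
  have sz m : size ((node (k + (n - m.+1)))%:P - 'X : {poly F}) = 2.
    by rewrite -opprB size_polyN size_XsubC.
  apply: leq_trans (ltn_ord i); rewrite size_prod => [|m _].
    by rewrite (eq_bigr (fun=> 2)) // sum_nat_const card_ord; lia.
  by rewrite -size_poly_eq0 sz.
rewrite !det_mulmx det_Vandermonde det_diag -mulrA [X in _ * X]mulrC.
congr (_ * (_ * _)); first by apply: eq_bigr => j _; rewrite mxE.
by apply: eq_bigr => i _; apply: eq_bigr => j _; rewrite /x !mxE.
Qed.


Lemma set_factor_imset N m (f : 'I_m -> 'I_N) :
  (forall i j : 'I_m, (i < j)%N -> (f j < f i)%N) ->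
  set_factor q p [set f i | i in 'I_m] =
    \prod_(i < m) \prod_(j < m | (i < j)%N) pair_factor q p (f i) (f j).
Proof.
move=> decf; have monof i j : (f j < f i)%N = (i < j)%N.
  case: (ltngtP i j) => [/decf-> //|/decf/ltnW|/val_inj->]; last by rewrite ltnn.
  by rewrite leqNgt => /negbTE.
have injf : injective f.
  move=> i j e; apply: val_inj; case: (ltngtP i j) => // /decf; by rewrite e ltnn.
rewrite /set_factor big_imset /=; last by move=> i j _ _; apply: injf.
apply: eq_bigr => i _; rewrite big_mkcondr big_imset /=; last by move=> ? ? _ _; apply: injf.
by rewrite -big_mkcondr /=; apply: eq_bigl => j; rewrite monof.
Qed.

Lemma MBC_conj n k : exists c, forall lam : 'I_n -> nat, part_in_rect k lam ->
  MBC q k lam p = c * (q ^+ part_norm (compl_part k lam) *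
    ((\prod_(i < k) \prod_(j < k | (i < j)%N)
       pair_factor q p (conj_part k (compl_part k lam) i + rev_ord i)
                       (conj_part k (compl_part k lam) j + rev_ord j)) *
     \prod_(i < k) single_factor q p (conj_part k (compl_part k lam) i + rev_ord i))).
Proof.
have [c1 MBCE] := MBC_node n k.
have [c2 complE] := set_factor_compl p1 qint_neq0 q_neq0 q_neq1 (n + k).
pose c3 := \prod_(i < n) \prod_(j < n | (i < j)%N) (- ((q - 1) ^+ 2 * q ^- (k + rev_ord i))).
exists (c1 * c2 * c3) => lam lamP; have [lam_dec lam_le] := lamP.
pose L (j : 'I_n) := (lam j + rev_ord j)%N.
have ltL j : (L j < n + k)%N by have := lam_le j; have := ltn_ord j; rewrite /L /=; lia.
have decL (i j : 'I_n) : (i < j)%N -> (L j < L i)%N.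
  by move=> ltij; have := lam_dec _ _ (ltnW ltij); have := ltn_ord j; rewrite /L /=; lia.
pose M (i : 'I_k) := (conj_part k (compl_part k lam) i + rev_ord i)%N.
have [decM ltM neqML] : [/\ forall i j : 'I_k, (i < j)%N -> (M j < M i)%N,
  forall i, (M i < n + k)%N & forall i j, M i != L j] := conj_compl_setC lamP.
pose f j := Ordinal (ltL j); pose g i := Ordinal (ltM i).
have eC : ~: [set f j | j in 'I_n] = [set g i | i in 'I_k].
  apply/esym/eqP; rewrite eqEcard; apply/andP; split.
    apply/subsetP => _ /imsetP[i _ ->]; rewrite inE; apply/imsetP => -[j _ /(congr1 val)/eqP] /=.
    by rewrite (negbTE (neqML i j)).
  have := cardsC [set f j | j in 'I_n]; rewrite !card_imset ?card_ord; first by lia.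
    move=> i j /(congr1 val) /= e; apply: val_inj; case: (ltngtP i j) => // /decM.
      by rewrite e ltnn.
    by rewrite e ltnn.
  move=> i j /(congr1 val) /= e; apply: val_inj; case: (ltngtP i j) => // /decL.
    by rewrite e ltnn.
  by rewrite e ltnn.
have := complE [set f j | j in 'I_n]; rewrite eC !set_factor_imset //.
rewrite !big_imset /=; first last.
- by move=> i j _ _ /(congr1 val) /= e; apply: val_inj; case: (ltngtP i j) => // /decL;
    rewrite e ltnn.
- by move=> i j _ _ /(congr1 val) /= e; apply: val_inj; case: (ltngtP i j) => // /decM;
    rewrite e ltnn.
rewrite -/M => eML; rewrite MBCE //.
have -> : \prod_(i < n) \prod_(j < n | (i < j)%N)
      (node (lam j + rev_ord j) - node (lam i + rev_ord i)) =
   c3 * (q ^+ part_norm (compl_part k lam) *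
   \prod_(i < n) \prod_(j < n | (i < j)%N) pair_factor q p (L i) (L j)).
  (* The exponent k - lambda_i is the variable part of q^(-L_i) in [node_sub]. In 1-based terms row
     i opens n - i pairs, and n - i is the weight of k - lambda_i in the norm of the complement. *)
  have -> : q ^+ part_norm (compl_part k lam) =
      \prod_(i < n) \prod_(j < n | (i < j)%N) q ^+ (k - lam i).
    rewrite /part_norm (reindex_inj rev_ord_inj) expr_sum; apply: eq_bigr => i _.
    rewrite -expr_sum /compl_part rev_ordK; congr (_ ^+ _).
    rewrite sum_nat_const; congr (_ * _)%N.
    rewrite -sum1_card -(big_geq_mkord _ _ xpredT (fun=> 1%N)) sum_nat_const_nat muln1.
    by [].
  rewrite -!big_split; apply: eq_bigr => i _; rewrite -!big_split.
  apply: eq_bigr => j ltij /=.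
  have ltLij := decL i j ltij.
  rewrite -(opprB (node _)) -/(L i) -/(L j) node_sub; last exact: ltnW.
  rewrite /pair_factor (_ : (L j - L i = 0)%N) ?addn0; last by lia.
  rewrite (_ : q ^- L i = q ^- (k + rev_ord i) * q ^+ (k - lam i)).
    by ring.
  have q0 m : q ^+ m != 0 by rewrite expf_neq0.
  apply: (mulIf (q0 (L i))); rewrite mulVf // -mulrA -exprD.
  rewrite (_ : (k - lam i + L i = k + rev_ord i)%N) ?mulVf //.
  by rewrite /L; have := lam_le i; lia.
transitivity (c1 * c3 * q ^+ part_norm (compl_part k lam) *
  (c2 * ((\prod_(i < k) \prod_(j < k | (i < j)%N) pair_factor q p (M i) (M j)) *
     \prod_(i < k) single_factor q p (M i)))); last by rewrite -/M; ring.
by rewrite -eML; ring.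
Qed.

End Evaluation.

(** * Comparison with the q-dimensions *)

Section QDimension.
Variables (F : fieldType) (q : F).
Local Notation "[ m ]q" := (qint q m) (format "[ m ]q").
Hypothesis qint_neq0 : forall m, [m.+1]q != 0.
Hypothesis q_neq0 : q != 0.
Hypothesis q_neq1 : q - 1 != 0.

Lemma MBC_rect n k p : MBC q k (fun _ : 'I_n => k) p = 1.
Proof.
rewrite (MBC_catalan q) -det_tr det_trig.
  by rewrite big1 // => i _; rewrite !mxE catalan_diag.
apply/is_trig_mxP => i j ltij; rewrite !mxE catalan_gt //=.
by have := ltn_ord j; lia.
Qed.

Lemma MBC_product n k (lam : 'I_n -> nat) p (M : 'I_k -> nat) :
  (p <= 1)%N -> part_in_rect k lam ->
  (forall i, M i = (conj_part k (compl_part k lam) i + rev_ord i)%N) ->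
  MBC q k lam p * ((\prod_(i < k) \prod_(j < k | (i < j)%N)
       pair_factor q p (rev_ord i) (rev_ord j)) *
     \prod_(i < k) single_factor q p (rev_ord i)) =
  q ^+ part_norm (compl_part k lam) *
    ((\prod_(i < k) \prod_(j < k | (i < j)%N) pair_factor q p (M i) (M j)) *
     \prod_(i < k) single_factor q p (M i)).
Proof.
move=> p1 lamP eM; have [c MBCE] := MBC_conj p1 qint_neq0 q_neq0 q_neq1 n k.
have rectP : part_in_rect k (fun _ : 'I_n => k) by [].
have c0 (i : 'I_k) : conj_part k (compl_part k (fun _ : 'I_n => k)) i = 0%N.
  by rewrite /conj_part /compl_part subnn; apply: eq_card0 => l; rewrite inE.
have n0 : part_norm (compl_part k (fun _ : 'I_n => k)) = 0%N.
  by rewrite /part_norm big1 // => i _; rewrite /compl_part subnn muln0.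
pose Phi (M' : 'I_k -> nat) :=
  (\prod_(i < k) \prod_(j < k | (i < j)%N) pair_factor q p (M' i) (M' j)) *
  \prod_(i < k) single_factor q p (M' i).
have phiE (lam' : 'I_n -> nat) : part_in_rect k lam' -> MBC q k lam' p = c *
   (q ^+ part_norm (compl_part k lam') *
     Phi (fun i => conj_part k (compl_part k lam') i + rev_ord i)%N) by exact: MBCE.
have := phiE _ rectP; rewrite MBC_rect n0 mul1r.
rewrite (_ : (fun i => _) = fun i : 'I_k => rev_ord i : nat); last first.
  by apply/funext => i; rewrite c0.
move=> e1; rewrite -/(Phi (fun i => rev_ord i)) -/(Phi M) (phiE _ lamP).
rewrite (_ : M = fun i => conj_part k (compl_part k lam) i + rev_ord i)%N; last first.
  by apply/funext.
by rewrite mulrAC -e1 mul1r.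
Qed.

Lemma prod_ord_pairs k (f : 'I_k * 'I_k -> F) :
  \prod_(ij <- ord_pairs k) f ij = \prod_(i < k) \prod_(j < k | (i < j)%N) f (i, j).
Proof.
by rewrite /ord_pairs big_filter big_enum_cond pair_big_dep; apply: eq_big => -[].
Qed.

Lemma pairing_eps k (mu : weight k) i : pairing mu (eps i) = mu 0 i.
Proof.
rewrite /pairing (bigD1 i) //= /eps mxE !eqxx mulr1 big1 ?addr0 // => j ne.
by rewrite mxE (negbTE ne) andbF mulr0.
Qed.

Lemma pairingD k (mu a b : weight k) : pairing mu (a + b) = pairing mu a + pairing mu b.
Proof. by rewrite /pairing -big_split; apply: eq_bigr => i _; rewrite mxE mulrDr. Qed.

Lemma pairingN k (mu a : weight k) : pairing mu (- a) = - pairing mu a.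
Proof. by rewrite /pairing -sumrN; apply: eq_bigr => i _; rewrite mxE mulrN. Qed.

Lemma floor_nat m : Num.floor (m%:R : rat) = m%:Z.
Proof. by rewrite pmulrn intrKfloor. Qed.

Lemma one_subX m : 1 - q ^+ m = (1 - q) * [m]q.
Proof. by rewrite qintX; ring. Qed.

Lemma divr_one_subX a b : (1 - q ^+ a) / (1 - q ^+ b) = [a]q / [b]q.
Proof.
have q1 : 1 - q != 0 by rewrite -oppr_eq0 opprB.
by rewrite !one_subX -mulf_div divff // mul1r.
Qed.

Lemma qdimC_prod k (M nu : 'I_k -> nat) : (forall i, M i = (nu i + rev_ord i)%N) ->
  (forall i j : 'I_k, (i < j)%N -> (M j < M i)%N) ->
  qdimC q (part_weight nu) =
  ((\prod_(i < k) \prod_(j < k | (i < j)%N) pair_factor q 1 (M i) (M j)) *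
     \prod_(i < k) single_factor q 1 (M i)) /
  ((\prod_(i < k) \prod_(j < k | (i < j)%N) pair_factor q 1 (rev_ord i) (rev_ord j)) *
     \prod_(i < k) single_factor q 1 (rev_ord i)).
Proof.
move=> eM decM; have enumE (f : weight k -> F) :
    \prod_(a <- [seq eps i | i <- enum 'I_k]) f a = \prod_(i < k) f (eps i).
  by rewrite big_map big_enum.
rewrite /qdimC /qdim /corootsC big_cat enumE /corootsD big_cat !big_map.
have rhoE i : rhoC k 0 i = (rev_ord i).+1%:R.
  by rewrite mxE; congr (_%:R); have := ltn_ord i; rewrite /=; lia.
have muE i : (part_weight nu + rhoC k) 0 i = (M i).+1%:R.
  by rewrite mxE rhoE mxE -natrD eM addnS.
rewrite invfM mulrACA; rewrite [X in X * _ = _]/=; congr (_ * _); last first.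
  rewrite -prodf_div; apply: eq_bigr => i _.
  by rewrite !pairing_eps muE rhoE !floor_nat -!exprnP divr_one_subX.
rewrite !prod_ord_pairs -big_split -prodf_div; apply: eq_bigr => i _.
rewrite -big_split -prodf_div; apply: eq_bigr => j ltij.
rewrite !pairingD !pairingN !pairing_eps !muE !rhoE.
have := decM i j ltij; have : (rev_ord j < rev_ord i)%N by have := ltn_ord j; rewrite /=; lia.
move: (M i) (M j) (rev_ord i : nat) (rev_ord j : nat) => a b c d ltdc ltba.
rewrite -!natrB ?ltnS 1?ltnW // -!natrD !floor_nat -!exprnP !divr_one_subX /pair_factor.
rewrite /= mulf_div; congr (qint _ _ * qint _ _ / (qint _ _ * qint _ _)); lia.
Qed.

(** The halves of omega_k cancel in the differences and add 1 to the sums, whence the pair factors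
    with p = 0 in the numerator. The denominator, built on rho alone, has no such shift;
    [prod_half_spin] accounts for the discrepancy. *)
Lemma qdimD_prod k (M nu : 'I_k -> nat) : (forall i, M i = (nu i + rev_ord i)%N) ->
  (forall i j : 'I_k, (i < j)%N -> (M j < M i)%N) ->
  qdimD q (part_weight nu + half_weight k) =
  (\prod_(i < k) \prod_(j < k | (i < j)%N) pair_factor q 0 (M i) (M j)) /
  (\prod_(i < k) \prod_(j < k | (i < j)%N)
     ([rev_ord i - rev_ord j]q * [rev_ord i + rev_ord j]q)).
Proof.
move=> eM decM; rewrite /qdimD /qdim /corootsD !big_cat !big_map.
have rhoE i : rhoD k 0 i = (rev_ord i)%:R by rewrite mxE.
have muE i : (part_weight nu + half_weight k + rhoD k) 0 i = (M i)%:R + 1 / 2%:R.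
  by rewrite mxE rhoE !mxE eM natrD addrAC.
rewrite !prod_ord_pairs [LHS]/= -big_split -prodf_div; apply: eq_bigr => i _.
rewrite -big_split -prodf_div; apply: eq_bigr => j ltij.
rewrite !pairingD !pairingN !pairing_eps !muE !rhoE.
have := decM i j ltij; have : (rev_ord j < rev_ord i)%N by have := ltn_ord j; rewrite /=; lia.
move: (M i) (M j) (rev_ord i : nat) (rev_ord j : nat) => a b c d ltdc ltba.
have -> : (a%:R + 1 / 2%:R - (b%:R + 1 / 2%:R) : rat) = (a - b)%N%:R.
  by rewrite natrB 1?ltnW //; ring.
have -> : (a%:R + 1 / 2%:R + (b%:R + 1 / 2%:R) : rat) = (a + b).+1%:R.
  by rewrite -addn1 !natrD; field.
rewrite -!natrB 1?ltnW // -!natrD !floor_nat -!exprnP !divr_one_subX /pair_factor.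
rewrite /= mulf_div; congr (qint _ _ * qint _ _ / (qint _ _ * qint _ _)); lia.
Qed.

Lemma MBC_qdimC n k (lam : 'I_n -> nat) : part_in_rect k lam ->
  MBC q k lam 1 = q ^+ part_norm (compl_part k lam) *
    qdimC q (part_weight (conj_part k (compl_part k lam))).
Proof.
move=> lamP; pose M (i : 'I_k) := (conj_part k (compl_part k lam) i + rev_ord i)%N.
have [decM _ _] := conj_compl_setC lamP.
rewrite (@qdimC_prod _ M) // mulrA -(@MBC_product n k lam 1 M) // mulfK //.
rewrite mulf_neq0 //; last first.
  by apply/prodf_neq0 => i _; apply: single_factor_neq0.
apply/prodf_neq0 => i _; apply/prodf_neq0 => j ltij; apply: pair_factor_neq0 => //.
by rewrite (inj_eq val_inj) (inj_eq rev_ord_inj) neq_ltn ltij.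
Qed.

(** The q-dimension of the half-spin representation V(omega_k). In rank k >= 2 the first row
    telescopes to [2k - 2] / [k - 1] = 1 + q^(k - 1), and the other rows are the case of rank k -
    1. *)
Lemma prod_half_spin k :
  \prod_(i < k) \prod_(j < k | (i < j)%N)
     ([rev_ord i + rev_ord j + 1]q / [rev_ord i + rev_ord j]q) =
  \prod_(1 <= a < k) (q ^+ a + 1).
Proof.
case: k => [|k]; first by rewrite big_ord0 big_geq.
elim: k => [|k IH].
  by rewrite big_ord_recl big_ord0 big_geq // big_mkcond big_ord_recl big_ord0 /= !mulr1.
rewrite big_ord_recl mulrC big_nat_recr //= -IH; congr (_ * _).
  apply: eq_bigr => i _; rewrite [LHS]big_mkcond big_ord_recl /= mul1r -big_mkcond.
  by apply: eq_bigl => j; rewrite /bump /= !add1n.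
rewrite big_mkcond big_ord_recl /= mul1r /bump /= subSS subn0.
have tele m : (m <= k.+1)%N -> \prod_(j < m) ([k.+1 + j + 1]q / [k.+1 + j]q) =
    [k.+1 + m]q / [k.+1]q.
  elim: m => [|m IHm] ltm; first by rewrite big_ord0 addn0 divff.
  rewrite big_ord_recr /= IHm 1?ltnW // addn1 addnS.
  have := qint_neq0 k; have : [k.+1 + m]q != 0 by rewrite addSn.
  move: [k.+1]q [k.+1 + m]q [_.+1]q => a b c b0 a0; by field; rewrite a0 b0.
transitivity ([k.+1 + k.+1]q / [k.+1]q).
  rewrite -tele // (reindex_inj rev_ord_inj); apply: eq_bigr => j _ /=.
  by rewrite add1n subSS; congr (qint _ _ / qint _ _); have := ltn_ord j; lia.
by rewrite qintD mulrDl divff // mulfK // addrC.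
Qed.

Lemma MBC_qdimD n k (lam : 'I_n -> nat) : part_in_rect k lam ->
  MBC q k lam 0 * \prod_(1 <= a < k) (q ^+ a + 1) =
    q ^+ part_norm (compl_part k lam) *
    qdimD q (part_weight (conj_part k (compl_part k lam)) + half_weight k).
Proof.
move=> lamP; pose M (i : 'I_k) := (conj_part k (compl_part k lam) i + rev_ord i)%N.
have [decM _ _] := conj_compl_setC lamP.
rewrite (@qdimD_prod _ M) // mulrA.
have := @MBC_product n k lam 0 M isT lamP (fun=> erefl).
rewrite ![\prod_(i < k) single_factor _ _ _]big1 // !mulr1 => <-.
rewrite -mulrA; congr (_ * _); rewrite -prod_half_spin.
rewrite -prodf_div /=; apply: eq_bigr => i _.
rewrite -prodf_div /=; apply: eq_bigr => j ltij.
have lt : (rev_ord j < rev_ord i)%N by have := ltn_ord j; rewrite /=; lia.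
rewrite /pair_factor (_ : (rev_ord j - rev_ord i = 0)%N) ?addn0; last by lia.
rewrite addn1 -mulf_div divff ?mul1r //.
by rewrite (_ : (_ - _)%N = (rev_ord i - rev_ord j).-1.+1) //; move: lt => /=; lia.
Qed.

End QDimension.

(** * The Weyl denominator formula *)

Lemma big_pairs_split (R : Type) (idx : R) (op : Monoid.com_law idx) n
    (f : 'I_n -> 'I_n -> R) :
  \big[op/idx]_(a < n) \big[op/idx]_(b < n) f a b =
  op (\big[op/idx]_(a < n) f a a)
     (\big[op/idx]_(a < n) \big[op/idx]_(b < n | (a < b)%N) op (f a b) (f b a)).
Proof.
have -> : \big[op/idx]_(a < n) \big[op/idx]_(b < n | (a < b)%N) op (f a b) (f b a) =
  op (\big[op/idx]_(a < n) \big[op/idx]_(b < n | (a < b)%N) f a b)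
  (\big[op/idx]_(a < n) \big[op/idx]_(b < n | (b < a)%N) f a b).
  rewrite [X in op _ X](exchange_big_dep xpredT) //= -big_split /=.
  by apply: eq_bigr => a _; rewrite -big_split.
rewrite -!big_split /=; apply: eq_bigr => a _.
rewrite (bigD1 a) //= (bigID (fun b : 'I_n => (a < b)%N)) /=; congr (op _ (op _ _)).
  by apply: eq_bigl => b; rewrite -(inj_eq val_inj) /=; case: ltngtP.
by apply: eq_bigl => b; rewrite -(inj_eq val_inj) /=; case: ltngtP.
Qed.

Lemma card_ord_gt n (a : 'I_n) : #|[pred b : 'I_n | (a < b)%N]| = rev_ord a.
Proof.
by rewrite -sum1_card -(big_geq_mkord _ _ xpredT (fun=> 1%N)) sum_nat_const_nat muln1.
Qed.

Section Denominator.
Variables (K : numFieldType) (n h : nat).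
Hypothesis h12 : (0 < h <= 2)%N.

(* Weights are stored doubled, so that half-integral ones have integer
   coordinates.  The n^2 positive roots of B_n (h = 1) and C_n (h = 2) are
   indexed by all pairs (a, b): eps_a - eps_b for a < b, eps_a + eps_b for
   a > b, and h eps_a for a = b. *)
Definition posroot (x : 'I_n * 'I_n) : 'rV[int]_n :=
  if x.1 == x.2 then h.*2%:Z *: delta_mx 0 x.1
  else 2 *: delta_mx 0 x.1 + (if (x.1 < x.2)%N then - 2 else 2) *: delta_mx 0 x.2.

(** Twice the half sum of the positive roots, in keeping with the doubling of weights. *)
Definition weyl_vector : 'rV[int]_n := \row_i ((rev_ord i).*2 + h)%N%:Z.

Lemma sum_posroot : \sum_x posroot x = weyl_vector *+ 2.
Proof.
rewrite -(pair_bigA _ (fun a b => posroot (a, b))) /= big_pairs_split -big_split /=.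
rewrite [RHS]row_sum_delta; apply: eq_bigr => a _.
rewrite (eq_bigr (fun=> 4 *: delta_mx 0 a)) => [|b ltab].
  rewrite sumr_const card_ord_gt /posroot eqxx -scaler_nat scalerA -scalerDl.
  by congr (_ *: _); rewrite !mxE; lia.
rewrite /posroot /= -!(inj_eq val_inj) /= ltab.
rewrite (ltn_eqF ltab) (gtn_eqF ltab) ltnNge (ltnW ltab) /=.
by apply/rowP => i; rewrite !mxE; ring.
Qed.

Definition rho_minus (S : {set 'I_n * 'I_n}) : 'rV[int]_n :=
  weyl_vector - \sum_(x in S) posroot x.

Definition wpow (y : 'I_n -> K) (u : 'rV[int]_n) : K := \prod_(i < n) y i ^ u 0 i.

Lemma wpowD y u v : (forall i, y i != 0) -> wpow y (u + v) = wpow y u * wpow y v.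
Proof.
move=> y0; rewrite /wpow -big_split; apply: eq_bigr => i _.
by rewrite mxE expfzDr.
Qed.

Lemma wpowN y u : (forall i, y i != 0) -> wpow y (- u) = (wpow y u)^-1.
Proof.
by move=> y0; rewrite /wpow -prodfV; apply: eq_bigr => i _; rewrite mxE invr_expz.
Qed.

Lemma wpow_sum y (I : finType) (A : {set I}) (u : I -> 'rV[int]_n) :
  (forall i, y i != 0) ->
  wpow y (\sum_(x in A) u x) = \prod_(x in A) wpow y (u x).
Proof.
move=> y0; apply: (big_morph (wpow y)) => [v w|]; first exact: wpowD.
by rewrite /wpow big1 // => i _; rewrite mxE expr0z.
Qed.

Lemma sum_sets_wpow y : (forall i, y i != 0) ->
  \sum_(S : {set 'I_n * 'I_n}) (-1) ^+ #|S| * wpow y (rho_minus S) =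
  wpow y weyl_vector * \prod_x (1 - (wpow y (posroot x))^-1).
Proof.
move=> y0; under [X in _ = _ * X]eq_bigr do rewrite addrC.
rewrite bigA_distr mulr_sumr.
apply: eq_bigr => S _.
rewrite /rho_minus wpowD // wpowN // wpow_sum // mulrCA; congr (_ * _).
rewrite -prodfV [RHS](bigID (mem S)) /= [X in _ = _ * X]big1; last by move=> x /negbTE->.
rewrite mulr1 [RHS](eq_bigr (fun x => - (wpow y (posroot x))^-1)); last by move=> x ->.
by rewrite prodrN.
Qed.

Lemma wpow_delta y c a : wpow y (c *: delta_mx 0 a) = y a ^ c.
Proof.
rewrite /wpow (bigD1 a) //= big1 => [|i ne]; rewrite !mxE ?eqxx ?mulr1 //.
by rewrite (negbTE ne) andbF mulr0 expr0z.
Qed.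

Definition symm (x : K) := x ^+ 2 + x ^- 2.

(** For a < b the two roots contribute y_a^2 (1 - y_b^2 y_a^-2) (1 - y_a^-2 y_b^-2), which is the
    difference of the [symm] values. The squares y_a^2 use up [weyl_vector] except for its summand
    h. *)
Lemma weyl_product y : (forall i, y i != 0) ->
  wpow y weyl_vector * \prod_x (1 - (wpow y (posroot x))^-1) =
  (\prod_i (y i ^+ h - y i ^- h)) *
  \prod_(a < n) \prod_(b < n | (a < b)%N) (symm (y a) - symm (y b)).
Proof.
move=> y0.
rewrite -(pair_bigA _ (fun a b => 1 - (wpow y (posroot (a, b)))^-1)) /= big_pairs_split.
have -> : wpow y weyl_vector = (\prod_a y a ^+ h) *
    \prod_(a < n) \prod_(b < n | (a < b)%N) y a ^+ 2.
  rewrite /wpow -big_split; apply: eq_bigr => a _ /=.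
  rewrite mxE -exprnP addnC exprD; congr (_ * _).
  by rewrite prodr_const -exprM mul2n card_ord_gt.
rewrite mulrACA; congr (_ * _); rewrite -big_split; apply: eq_bigr => a _ /=.
  rewrite /posroot /= eqxx wpow_delta -exprnP mulrBr mulr1; congr (_ - _).
  by rewrite -addnn exprD invfM mulrA mulfV ?mul1r // expf_neq0.
rewrite -big_split; apply: eq_bigr => b ltab /=.
rewrite /posroot /= -!(inj_eq val_inj) /= ltab.
rewrite (ltn_eqF ltab) (gtn_eqF ltab) ltnNge (ltnW ltab) /=.
rewrite !wpowD // !wpow_delta -!exprnP -invr_expz /symm.
have := y0 a; have := y0 b; move: (y a) (y b) => s t s0 t0.
rewrite -[t ^ 2]/(t ^+ 2) -![_ ^+ (1 + 1)]/(_ ^+ 2).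
by field; rewrite s0 t0.
Qed.

End Denominator.

Lemma det_rev (R : comPzRingType) n (A : 'M[R]_n) :
  \det (\matrix_(i, j) A (rev_ord i) (rev_ord j)) = \det A.
Proof.
pose s := perm (@rev_ord_inj n).
have -> : \matrix_(i, j) A (rev_ord i) (rev_ord j) = row_perm s (col_perm s A).
  by apply/matrixP => i j; rewrite !mxE !permE.
rewrite row_permE col_permE !det_mulmx !det_perm odd_permV mulrC -mulrA -signr_addb addbb.
by rewrite mulr1.
Qed.

Section DenominatorFormula.
Variables (K : numFieldType) (n h : nat).
Hypothesis h12 : (0 < h <= 2)%N.
Local Notation weyl_vector := (weyl_vector n h).
Local Notation rho_minus := (@rho_minus n h).
Local Notation signed_sum F := (\sum_(S : {set 'I_n * 'I_n}) (-1) ^+ #|S| * F S).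

(* sinh((2m + h)t) / sinh(h t) as a polynomial in 2 cosh(2t). *)
Fixpoint sinh_ratio (m : nat) : {poly K} * {poly K} :=
  if m is m'.+1 then
    let P := sinh_ratio m' in (P.2, 'X * P.2 - P.1)
  else (1, 'X + (h == 1)%:R%:P).

Lemma sinh_ratioE (y : K) m : y != 0 ->
  y ^+ (m.*2 + h) - y ^- (m.*2 + h) = (y ^+ h - y ^- h) * (sinh_ratio m).1.[symm y].
Proof.
move=> y0; have yX i : y ^+ i != 0 by rewrite expf_neq0.
suff [] : y ^+ (m.*2 + h) - y ^- (m.*2 + h) = (y ^+ h - y ^- h) * (sinh_ratio m).1.[symm y] /\
   y ^+ (m.+1.*2 + h) - y ^- (m.+1.*2 + h) = (y ^+ h - y ^- h) * (sinh_ratio m).2.[symm y].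
  by [].
elim: m => [|m [IH1 IH2]] /=.
  rewrite !hornerE; split; rewrite ?mulr1 // /symm.
  (* The two starting values: sinh(3t) / sinh(t) = 2 cosh(2t) + 1 and sinh(4t) / sinh(2t) = 2
     cosh(2t). *)
  have [->|->] : h = 1%N \/ h = 2%N by lia.
    by rewrite /= mulr1n; have := yX 1%N; move: (y) => z z0; field; rewrite ?z0.
  by rewrite /= mulr0n; field.
split=> //; rewrite !hornerE mulrBr mulrCA -IH1 -IH2 /symm.
rewrite !doubleS !addSn !exprS.
by have := yX (m.*2 + h)%N; move: (y ^+ _) => z z0; field; rewrite y0 z0.
Qed.

Lemma sinh_ratio_monic m : (sinh_ratio m).1 \is monic /\ size (sinh_ratio m).1 = m.+1.
Proof.
suff [] : [/\ (sinh_ratio m).1 \is monic, size (sinh_ratio m).1 = m.+1,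
  (sinh_ratio m).2 \is monic & size (sinh_ratio m).2 = m.+2] by [].
elim: m => [|m [m1 s1 m2 s2]] /=.
  split; rewrite ?monic1 ?size_poly1 //; last by rewrite size_XaddC.
  by rewrite monicE lead_coefDl ?lead_coefX // size_polyX size_polyC; case: (_ != _).
have sz : (size (- (sinh_ratio m).1)%R < size ('X * (sinh_ratio m).2)%R)%N.
  by rewrite size_polyN s1 mulrC size_mulX ?monic_neq0 // s2.
split=> //; last by rewrite size_polyDl // mulrC size_mulX ?monic_neq0 // s2.
by rewrite monicE lead_coefDl // mulrC lead_coefMX -monicE.
Qed.

(** Each row has the factor y_i^h - y_i^-h. After reversal of the indices the other factors are
    monic polynomials of degrees 0, ..., n - 1 in [symm], so a unitriangular change of columns leads
    to a Vandermonde determinant. *)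
Lemma det_wpow (y : 'I_n -> K) : (forall i, y i != 0) ->
  \det (\matrix_(i < n, j < n) (y i ^ weyl_vector 0 j - y i ^ (- weyl_vector 0 j))) =
  (\prod_i (y i ^+ h - y i ^- h)) *
  \prod_(a < n) \prod_(b < n | (a < b)%N) (symm (y a) - symm (y b)).
Proof.
move=> y0; rewrite -det_rev.
pose x := \row_i symm (y (rev_ord i)).
pose C := \matrix_(j < n, d < n) (sinh_ratio j).1`_d.
transitivity (\det (diag_mx (\row_i (y (rev_ord i) ^+ h - y (rev_ord i) ^- h)) *m
   (C *m Vandermonde n x)^T)).
  congr (\det _); apply/matrixP => i j; rewrite mul_diag_mx !mxE rev_ordK -exprnP.
  rewrite -invr_expz -exprnP sinh_ratioE //; congr (_ * _).
  rewrite (@horner_coef_wide _ n); last by rewrite (sinh_ratio_monic j).2.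
  by apply: eq_bigr => d _; rewrite !mxE.
rewrite det_mulmx det_diag det_tr det_mulmx det_Vandermonde; congr (_ * _).
  by rewrite [RHS](reindex_inj rev_ord_inj); apply: eq_bigr => i _; rewrite mxE.
rewrite det_trig; last first.
  apply/is_trig_mxP => i j ltij; rewrite mxE nth_default //.
  by rewrite (sinh_ratio_monic i).2.
rewrite big1 ?mul1r => [|i _]; last first.
  have [/monicP <- sz] := sinh_ratio_monic i.
  by rewrite mxE lead_coefE sz.
rewrite [RHS](reindex_inj rev_ord_inj) /=.
rewrite [LHS](exchange_big_dep xpredT) //=; apply: eq_bigr => i _.
rewrite [RHS](reindex_inj rev_ord_inj) /=; apply: eq_big => [j|j _].
  by have := ltn_ord i; have := ltn_ord j => /=; lia.
by rewrite !mxE.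
Qed.

Lemma denominator_wpow (y : 'I_n -> K) : (forall i, y i != 0) ->
  signed_sum (fun S => \prod_i y i ^ rho_minus S 0 i) =
  \det (\matrix_(i < n, j < n) (y i ^ weyl_vector 0 j - y i ^ (- weyl_vector 0 j))).
Proof.
by move=> y0; rewrite det_wpow // -weyl_product // -sum_sets_wpow.
Qed.

(** On the window [-B, B] the delta functions are combinations of the powers u -> y^u with y = 1,
    ..., 2B + 1, which are distinct and nonzero in characteristic 0. This serves to extract
    coefficients from Laurent polynomial identities. *)
Lemma interpolate_wpow B : exists c : int -> 'I_B.*2.+1 -> K,
  forall u : int, `|u| <= B%:Z -> forall k : int, `|k| <= B%:Z ->
  \sum_l c k l * (l.+1%:R : K) ^ u = (k == u)%:R.
Proof.
pose N := B.*2.+1; pose x : 'rV[K]_N := \row_l l.+1%:R.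
have Vunit : Vandermonde N x \in unitmx.
  rewrite unitmxE unitfE det_Vandermonde; apply/prodf_neq0 => i _.
  apply/prodf_neq0 => j ltij; rewrite !mxE subr_eq0 eqr_nat eqSS.
  by rewrite (inj_eq val_inj); apply: contraTneq ltij => ->; rewrite ltnn.
exists (fun k l => invmx (Vandermonde N x) l (inord (absz (k + B%:Z))) * l.+1%:R ^+ B).
move=> u uB k kB.
have := mulmxV Vunit; move/matrixP => /(_ (inord (absz (u + B%:Z))) (inord (absz (k + B%:Z)))).
rewrite !mxE -val_eqE /= !inordK; [|rewrite /N; lia|rewrite /N; lia].
rewrite (_ : (_ == _) = (k == u)); last by apply/eqP/eqP; lia.
move=> <-; apply: eq_bigr => l _; rewrite !mxE -mulrA [RHS]mulrC; congr (_ * _).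
rewrite inordK; last by rewrite /N; lia.
have l0 : l.+1%:R != 0 :> K by rewrite pnatr_eq0.
by rewrite exprnP -expfzDr // exprnP gez0_abs; [congr (_ ^ _); lia | lia].
Qed.

(** Both sides are linear in each [g i] and see only its values on a finite window. By interpolation
    it suffices to take y_i^u for [g i u], which is the Weyl denominator formula evaluated at y. *)
Lemma denominator_formula (g : 'I_n -> int -> K) :
  signed_sum (fun S => \prod_i g i (rho_minus S 0 i)) =
  \det (\matrix_(i < n, j < n) (g i (weyl_vector 0 j) - g i (- weyl_vector 0 j))).
Proof.
pose B := (\sum_(S : {set 'I_n * 'I_n}) \sum_i absz (rho_minus S 0%R i))%N.
have rho_le S i : `|rho_minus S 0 i| <= B%:Z.
  rewrite -abszE lez_nat /B (bigD1 S) //= (bigD1 i) //= -addnA; exact: leq_addr.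
have weyl_le i : `|weyl_vector 0 i| <= B%:Z.
  by have := rho_le set0 i; rewrite /rho_minus big_set0 subr0.
have [c cE] := interpolate_wpow B.
pose C i l := \sum_(k < B.*2.+1) g i (k%:Z - B%:Z) * c (k%:Z - B%:Z) l.
have gE i (u : int) : `|u| <= B%:Z -> g i u = \sum_l C i l * (l.+1%:R : K) ^ u.
  move=> uB; rewrite /C; under eq_bigr do rewrite mulr_suml.
  rewrite exchange_big /=.
  under eq_bigr => k _.
    under eq_bigr do rewrite -mulrA.
    rewrite -mulr_sumr cE //; last by have := ltn_ord k; lia.
    over.
  have ltk : (absz (u + B%:Z)%R < B.*2.+1)%N by lia.
  rewrite (bigD1 (Ordinal ltk)) //= (_ : (absz (u + B%:Z))%:Z - B%:Z = u); last by lia.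
  rewrite eqxx mulr1 big1 ?addr0 // => k; rewrite -val_eqE /= => ne.
  by rewrite (_ : (_ == u) = false) ?mulr0 //; apply/eqP; lia.
have y0 (f : {ffun 'I_n -> 'I_B.*2.+1}) i : (f i).+1%:R != 0 :> K by rewrite pnatr_eq0.
transitivity (\sum_(f : {ffun 'I_n -> 'I_B.*2.+1}) (\prod_i C i (f i)) *
    signed_sum (fun S => \prod_i (f i).+1%:R ^ rho_minus S 0 i)).
  under [RHS]eq_bigr do rewrite mulr_sumr.
  rewrite exchange_big; apply: eq_bigr => S _.
  under eq_bigr do rewrite gE //.
  rewrite bigA_distr_bigA mulr_sumr; apply: eq_bigr => f _.
  by rewrite mulrCA big_split.
under eq_bigr do rewrite denominator_wpow //.
rewrite /determinant; under eq_bigr do rewrite mulr_sumr.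
rewrite exchange_big; apply: eq_bigr => s _.
under [X in _ = _ * X]eq_bigr do rewrite mxE !gE ?normrN // -sumrB.
rewrite bigA_distr_bigA mulr_sumr; apply: eq_bigr => f _.
rewrite mulrCA; congr (_ * _); rewrite -big_split; apply: eq_bigr => i _ /=.
by rewrite mxE mulrBr.
Qed.

End DenominatorFormula.

(** * Multiplicities from the Casimir operator *)

Definition ipz n (u v : 'rV[int]_n) : int := \sum_i u 0 i * v 0 i.

Section Ipz.
Variable n : nat.
Implicit Types u v w : 'rV[int]_n.

Lemma ipzC u v : ipz u v = ipz v u.
Proof. by apply: eq_bigr => i _; rewrite mulrC. Qed.

Lemma ipzDl u v w : ipz (u + v) w = ipz u w + ipz v w.
Proof. by rewrite -big_split; apply: eq_bigr => i _; rewrite mxE mulrDl. Qed.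

Lemma ipzNl u w : ipz (- u) w = - ipz u w.
Proof. by rewrite -sumrN; apply: eq_bigr => i _; rewrite mxE mulNr. Qed.

Lemma ipzDr u v w : ipz w (u + v) = ipz w u + ipz w v.
Proof. by rewrite ipzC ipzDl !(ipzC _ w). Qed.

Lemma ipzNr u w : ipz w (- u) = - ipz w u.
Proof. by rewrite ipzC ipzNl ipzC. Qed.

Lemma ipz0r w : ipz w 0 = 0.
Proof. by rewrite /ipz big1 // => i _; rewrite mxE mulr0. Qed.

Lemma ipz_sumr (I : finType) (P : pred I) (f : I -> 'rV[int]_n) w :
  ipz w (\sum_(x | P x) f x) = \sum_(x | P x) ipz w (f x).
Proof. by apply: (big_morph (ipz w)) => [u v|]; rewrite ?ipzDr ?ipz0r. Qed.

Lemma ipz_ge0 u : 0 <= ipz u u.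
Proof. by apply: sumr_ge0 => i _; rewrite -expr2 sqr_ge0. Qed.

Lemma ipz_normD u v : ipz (u + v) (u + v) = ipz u u + ipz u v *+ 2 + ipz v v.
Proof. by rewrite !ipzDl !ipzDr (ipzC v u); ring. Qed.

Lemma ipz_delta u c a : ipz u (c *: delta_mx 0 a) = c * u 0 a.
Proof.
rewrite /ipz (bigD1 a) //= big1 ?addr0 => [|i ne]; rewrite !mxE ?eqxx ?mulr1 1?mulrC //.
by rewrite (negbTE ne) andbF mulr0 mul0r.
Qed.

Lemma ipz_weyl_posroot h x : (0 < h)%N -> 0 < ipz (weyl_vector n h) (posroot h x).
Proof.
case: x => a b h0; rewrite /posroot /=; case: eqVneq => [_|ne].
  by rewrite ipz_delta !mxE /= ; nia.
rewrite ipzDr !ipz_delta !mxE /=; have := ltn_ord a; have := ltn_ord b.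
case: (ltngtP a b) => [lt|lt|e]; [lia|lia|].
by move: ne; rewrite -(inj_eq val_inj) /= e eqxx.
Qed.
End Ipz.

Section WeylCasimir.
Variables (K : numFieldType) (n h : nat).
Hypothesis h12 : (0 < h <= 2)%N.
Local Notation weyl_vector := (weyl_vector n h).
Local Notation rho_minus := (@rho_minus n h).
Local Notation posroot := (@posroot n h).
Local Notation signed_sum F := (\sum_(S : {set 'I_n * 'I_n}) (-1) ^+ #|S| * F S).

(** A factor u^2 at the coordinate i0 is absorbed into [g i0]. In the determinant so obtained the
    term of the permutation s gains the square of the entry of rho at s(i0); the sum over i0 is the
    norm of rho, whatever s is. *)
Lemma signed_sum_norm_prod (g : 'I_n -> int -> K) :
  signed_sum (fun S => (ipz (rho_minus S) (rho_minus S))%:~R * \prod_i g i (rho_minus S 0 i)) =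
  (ipz weyl_vector weyl_vector)%:~R * signed_sum (fun S => \prod_i g i (rho_minus S 0 i)).
Proof.
rewrite denominator_formula //.
pose g2 i0 i (u : int) := (if i == i0 then (u ^+ 2)%:~R else 1) * g i u.
transitivity (\sum_i0 signed_sum (fun S => \prod_i g2 i0 i (rho_minus S 0 i))).
  rewrite exchange_big; apply: eq_bigr => S _; rewrite -mulr_sumr; congr (_ * _).
  rewrite /ipz rmorph_sum mulr_suml; apply: eq_bigr => i0 _.
  rewrite /g2 big_split /= -big_mkcond big_pred1_eq expr2.
  by [].
under eq_bigr do rewrite denominator_formula //.
rewrite /determinant exchange_big mulr_sumr; apply: eq_bigr => s _.
rewrite -mulr_sumr mulrCA; congr (_ * _).
rewrite /ipz rmorph_sum mulr_suml [RHS](reindex_inj (@perm_inj _ s)); apply: eq_bigr => i0 _.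
rewrite (bigD1 i0) //= [in RHS](bigD1 i0) //= !mxE /g2 eqxx sqrrN -mulrBr expr2 -mulrA.
congr (_ * (_ * _)); apply: eq_bigr => i ne.
by rewrite !mxE (negbTE ne) !mul1r.
Qed.

(** The terms of the Weyl denominator that do not cancel are the images of rho under the Weyl group,
    all of the same norm. The function f is expanded in products of delta functions of the
    coordinates to reduce to the preceding lemma. *)
Lemma signed_sum_norm (f : 'rV[int]_n -> K) :
  signed_sum (fun S => (ipz (rho_minus S) (rho_minus S))%:~R * f (rho_minus S)) =
  (ipz weyl_vector weyl_vector)%:~R * signed_sum (fun S => f (rho_minus S)).
Proof.
pose s := undup [seq rho_minus A | A : {set 'I_n * 'I_n}].
have fE S : f (rho_minus S) = \sum_(v <- s) f v * \prod_i (v 0 i == rho_minus S 0 i)%:R.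
  rewrite (bigD1_seq (rho_minus S)) ?undup_uniq ?mem_undup ?image_f //=.
  rewrite big1 ?mulr1 => [|i _]; last by rewrite eqxx.
  rewrite big1 ?addr0 // => v ne; have [i vi] : exists i, v 0 i != rho_minus S 0 i.
    apply/existsP; rewrite -negb_forall; apply: contra ne => /forallP e.
    by apply/eqP/rowP => i; apply/eqP.
  by rewrite (bigD1 i) //= (negbTE vi) mul0r mulr0.
have expand (a : 'rV[int]_n -> K) : signed_sum (fun S => a (rho_minus S) * f (rho_minus S)) =
    \sum_(v <- s) f v * signed_sum (fun S => a (rho_minus S) *
      \prod_i (v 0 i == rho_minus S 0 i)%:R).
  under eq_bigr do rewrite fE !mulr_sumr.
  rewrite exchange_big; apply: eq_bigr => v _; rewrite mulr_sumr; apply: eq_bigr => S _ /=.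
  by move: (\prod_i _) ((-1) ^+ _) (a _) => P1 P2 P3; ring.
rewrite (expand (fun u => (ipz u u)%:~R)).
under [X in _ * X]eq_bigr do rewrite -(mul1r (f _)).
rewrite (expand (fun=> 1)) mulr_sumr; apply: eq_bigr => v _.
rewrite (signed_sum_norm_prod (fun i u => (v 0 i == u)%:R)) mulrCA; congr (_ * (_ * _)).
by apply: eq_bigr => S _; rewrite mul1r.
Qed.

(** Adding or removing x pairs off the sets S; the two members of a pair carry the same value of f
    with opposite signs. *)
Lemma signed_sum_shift (f : 'rV[int]_n -> K) x (xi : 'rV[int]_n) :
  signed_sum (fun S => if x \in S then f (xi + \sum_(y in S) posroot y)
                       else f (xi + \sum_(y in S) posroot y + posroot x)) = 0.
Proof.
rewrite (bigID (fun S : {set 'I_n * 'I_n} => x \in S)) /=.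
rewrite (reindex_onto (fun S => x |: S) (fun S => S :\ x)) => [|S xS]; last exact: setD1K.
rewrite [X in X + _](eq_bigl (fun S : {set 'I_n * 'I_n} => x \notin S)); last first.
  move=> S; rewrite setU11 /=; apply/eqP/idP => [<-|xS]; first by rewrite setD11.
  exact: setU1K.
rewrite -big_split big1 //= => S xS; rewrite setU11 (negbTE xS) cardsU1 xS exprS.
by rewrite big_setU1 //= addrAC addrA; ring.
Qed.

(** Meant for traces on the weight space of z: of the identity for m, of the Casimir operator for
    mc, of E x F x for tau x. By cyclicity tau x (z + root x) is then the trace of F x E x on the
    space of z. *)
Lemma weyl_casimir (m mc : 'rV[int]_n -> K) (tau : 'I_n * 'I_n -> 'rV[int]_n -> K) xi :
  (forall x z, tau x z - tau x (z + posroot x) = (ipz z (posroot x))%:~R * m z) ->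
  (forall z, mc z = (ipz z z)%:~R * m z + \sum_x (tau x z + tau x (z + posroot x))) ->
  signed_sum (fun S => mc (xi + \sum_(x in S) posroot x)) =
  (ipz (xi + weyl_vector) (xi + weyl_vector) - ipz weyl_vector weyl_vector)%:~R *
  signed_sum (fun S => m (xi + \sum_(x in S) posroot x)).
Proof.
move=> tauE mcE; set xi' := xi + weyl_vector.
have zE (S : {set 'I_n * 'I_n}) : xi + \sum_(x in S) posroot x = xi' - rho_minus S.
  by rewrite /xi' /rho_minus opprB addrA addrAC addrK.
(* Expand the norm of xi' = z + [rho_minus S]. The mixed term is a sum over all x of pairings of z
   with a root, with sign minus for x in S; by the relation for tau it turns tau x z + tau x (z +
   root x) into twice one of the two, chosen so that [signed_sum_shift] applies. *)
have key (S : {set 'I_n * 'I_n}) : mc (xi + \sum_(x in S) posroot x) =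
   (ipz xi' xi')%:~R * m (xi + \sum_(x in S) posroot x)
   - (ipz (rho_minus S) (rho_minus S))%:~R * m (xi' - rho_minus S)
   + 2 * \sum_x (if x \in S then tau x (xi + \sum_(y in S) posroot y)
                 else tau x (xi + \sum_(y in S) posroot y + posroot x)).
  rewrite mcE -zE; set z := xi + _.
  have -> : xi' = z + rho_minus S by rewrite /z zE subrK.
  rewrite (ipz_normD z (rho_minus S)). rewrite !rmorphD /= mulr2n.
  have e2 : (ipz z (rho_minus S))%:~R * m z *+ 2 =
      \sum_x (if x \in S then - (tau x z - tau x (z + posroot x))
              else tau x z - tau x (z + posroot x)).
    have e : ipz z (rho_minus S) *+ 2 =
        \sum_x (if x \in S then - ipz z (posroot x) else ipz z (posroot x)).
      have e_rho : ipz z weyl_vector *+ 2 = \sum_x ipz z (posroot x).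
        by rewrite mulr2n -ipzDr -mulr2n -(sum_posroot n h12) ipz_sumr.
      rewrite /rho_minus ipzDr ipzNr mulrnDl mulNrn e_rho ipz_sumr.
      rewrite (bigID (mem S)) [RHS](bigID (mem S)) /=.
      rewrite [X in _ = X + _](eq_bigr (fun x => - ipz z (posroot x))); last by move=> x ->.
      rewrite [X in _ = _ + X](eq_bigr (fun x => ipz z (posroot x))); last first.
        by move=> x /negbTE ->.
      by rewrite sumrN; ring.
    rewrite -mulrnAl -(rmorphMn intr) e rmorph_sum mulr_suml; apply: eq_bigr => x _.
    by case: ifP => _; rewrite ?rmorphN tauE ?mulNr.
  rewrite (_ : \sum_x (tau x z + _) = (ipz z (rho_minus S))%:~R * m z *+ 2 +
     2 * \sum_x (if x \in S then tau x z else tau x (z + posroot x))); first by ring.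
  rewrite e2 mulr_sumr -big_split; apply: eq_bigr => x _ /=.
  by case: ifP => _; ring.
under eq_bigr do rewrite key mulrDr mulrBr.
rewrite big_split sumrB /=.
have e1 := signed_sum_norm (fun u => m (xi' - u)).
have e2 : \sum_(S : {set 'I_n * 'I_n}) (-1) ^+ #|S| * (2 * \sum_x
    (if x \in S then tau x (xi + \sum_(y in S) posroot y)
     else tau x (xi + \sum_(y in S) posroot y + posroot x))) = 0.
  under eq_bigr do rewrite mulrCA mulr_sumr.
  rewrite -mulr_sumr exchange_big big1 ?mulr0 // => x _.
  exact: signed_sum_shift.
rewrite e2 addr0 e1 rmorphB mulrBl; congr (_ - _).
  by rewrite mulr_sumr; apply: eq_bigr => S _; rewrite mulrCA.
by congr (_ * _); apply: eq_bigr => S _; rewrite zE.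
Qed.
End WeylCasimir.

(** * Multiplicities in a common eigenbasis of the Cartan subalgebra and the Casimir operator *)

Section CoordinateMultiplicity.
Variables (K : numFieldType) (n h N : nat).
Hypothesis h12 : (0 < h <= 2)%N.
Local Notation rho := (weyl_vector n h).
Local Notation root := (@posroot n h).
Variables (wt : 'I_N -> 'rV[int]_n) (om : 'I_N -> K) (E F : 'I_n * 'I_n -> 'M[K]_N).
Hypothesis E_wt : forall x s t, E x s t != 0 -> wt s = wt t + root x /\ om s = om t.
Hypothesis EF_comm : forall x,
  E x *m F x - F x *m E x = diag_mx (\row_t (ipz (wt t) (root x))%:~R).
Hypothesis casimir : diag_mx (\row_t om t) =
  diag_mx (\row_t (ipz (wt t) (wt t))%:~R) + \sum_x (E x *m F x + F x *m E x).
Variable xi : 'rV[int]_n.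
Hypothesis xi_dom : forall x, 0 <= ipz xi (root x).

Definition casimir_value (z : 'rV[int]_n) : K := (ipz (z + rho) (z + rho) - ipz rho rho)%:~R.

Definition hw_index : {set 'I_N} := [set t | (wt t == xi) && (om t == casimir_value xi)].

(** Since E x kills v, E F + F E acts on v through the commutator, a pairing with the root; the
    roots add up to twice rho. *)
Lemma casimir_hw (v : 'cV[K]_N) : (forall x, E x *m v = 0) ->
  forall t, v t 0 != 0 -> om t = casimir_value (wt t).
Proof.
move=> Ev t vt; have : (diag_mx (\row_t om t) *m v) t 0 = om t * v t 0.
  by rewrite mul_diag_mx !mxE.
rewrite casimir mulmxDl mulmx_suml.
under eq_bigr => x _.
  rewrite (_ : E x *m F x = diag_mx (\row_t (ipz (wt t) (root x))%:~R) + F x *m E x); last first.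
    by rewrite -EF_comm subrK.
  rewrite !mulmxDl -!mulmxA Ev !mulmx0 !addr0.
  over.
rewrite -mulmx_suml -raddf_sum /= !mul_diag_mx !mxE summxE => e.
apply: (mulIf vt); rewrite -e -mulrDl; congr (_ * _).
rewrite /casimir_value ipz_normD addrK rmorphD /=; congr (_ + _).
rewrite mulr2n -ipzDr -mulr2n -(sum_posroot n h12) ipz_sumr rmorph_sum.
by apply: eq_bigr => x _; rewrite mxE.
Qed.

(** Among such indices choose s whose weight pairs maximally with rho. Every E x kills the basis
    vector of s, as its image would involve a higher index of the same kind; so [casimir_hw] gives
    the eigenvalue at s, which exceeds that of xi. *)
Lemma no_higher_index t : om t = casimir_value xi ->
  0 <= ipz xi (wt t - xi) -> 0 < ipz rho (wt t - xi) -> False.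
Proof.
have h0 : (0 < h)%N by lia.
move=> omt pos1 pos2.
pose P t' := [&& om t' == casimir_value xi, 0 <= ipz xi (wt t' - xi) & 0 < ipz rho (wt t' - xi)].
have Pt : P t by rewrite /P omt eqxx pos1 pos2.
case: (Order.TotalTheory.arg_maxP (fun t' => ipz rho (wt t')) Pt) => s /and3P[/eqP oms s1 s2] smax.
have Es x : E x *m delta_mx s 0 = 0 :> 'cV_N.
  apply/colP => s'; rewrite -colE !mxE; apply/eqP; apply: contraT => /E_wt[wts oms'].
  have Ps' : P s'.
    rewrite /P oms' oms eqxx wts addrAC !(ipzDr (wt s - xi)) /= addr_ge0 //=.
    by rewrite ltr_wpDr // ltW // ipz_weyl_posroot.
  have := smax s' Ps'; rewrite wts ipzDr; have := ipz_weyl_posroot x h0; lia.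
have := casimir_hw Es (t := s); rewrite mxE !eqxx oner_neq0 => /(_ isT).
rewrite oms /casimir_value => /eqP; rewrite eqr_int; apply/negP.
rewrite (inj_eq (@addIr _ _)) lt_eqF //.
have -> : wt s + rho = (xi + rho) + (wt s - xi) by apply/rowP => i; rewrite !mxE; ring.
rewrite (ipz_normD (xi + rho)) -addrA ltrDl (ipzDl xi rho) mulr2n.
have := ipz_ge0 (wt s - xi); move: s1 s2.
by lia.
Qed.

Lemma E_hw_index t : t \in hw_index -> forall x, E x *m (delta_mx t 0 : 'cV_N) = 0.
Proof.
rewrite inE => /andP[/eqP wtt /eqP omt] x; apply/colP => s; rewrite -colE !mxE.
apply/eqP; apply: contraT => /E_wt[wts oms]; exfalso.
have h0 : (0 < h)%N by lia.
apply: (@no_higher_index s); rewrite ?oms // wts wtt addrAC subrr add0r //.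
exact: ipz_weyl_posroot.
Qed.

Lemma hw_support (v : 'cV[K]_N) : (forall t, v t 0 != 0 -> wt t = xi) ->
  (forall x, E x *m v = 0) -> forall t, v t 0 != 0 -> t \in hw_index.
Proof.
move=> vwt Ev t vt; rewrite inE vwt // eqxx -(vwt t vt).
by rewrite (casimir_hw Ev vt) eqxx.
Qed.

(** Basis vectors are weighted by a function of their Casimir eigenvalue o, which E preserves. The
    weight 1 / (o - c), set to 0 at o = c, lets [weyl_casimir] cancel all the eigenvalues other than
    c; for o = c, [no_higher_index] leaves the empty set only. *)
Lemma card_hw_index : (#|hw_index|%:R : K) =
  \sum_(S : {set 'I_n * 'I_n}) (-1) ^+ #|S| *
    #|[set t | wt t == xi + \sum_(x in S) root x]|%:R.
Proof.
have h0 : (0 < h)%N by lia.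
pose c := casimir_value xi.
pose phi (o : K) : K := if o == c then 0 else (o - c)^-1.
pose m (f : K -> K) z := \sum_(t | wt t == z) f (om t).
pose tau x z := \sum_(t | wt t == z) phi (om t) * (E x *m F x) t t.
(* Cyclicity of the trace, entry by entry: a nonzero E x t s forces equal eigenvalues at t and s and
   weights that differ by the root. *)
have tauD x z : tau x (z + root x) = \sum_(t | wt t == z) phi (om t) * (F x *m E x) t t.
  rewrite /tau big_mkcond [RHS]big_mkcond /=.
  transitivity (\sum_t \sum_s
      if wt t == z + root x then phi (om t) * (E x t s * F x s t) else 0).
    by apply: eq_bigr => t _; case: ifP => _; rewrite ?big1_eq // mxE mulr_sumr.
  rewrite exchange_big; apply: eq_bigr => s _ /=.
  transitivity (\sum_t
      if wt s == z then phi (om s) * (F x s t * E x t s) else 0); last first.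
    by case: ifP => _; rewrite ?big1_eq // mxE mulr_sumr.
  apply: eq_bigr => t _; have [->|/E_wt[-> ->]] := eqVneq (E x t s) 0.
    by rewrite mul0r !mulr0 !if_same.
  by rewrite (inj_eq (@addIr _ _)) (mulrC (E x t s)).
have tauE x z : tau x z - tau x (z + root x) = (ipz z (root x))%:~R * m phi z.
  rewrite tauD -sumrB /m mulr_sumr; apply: eq_bigr => t /eqP wtt.
  rewrite -mulrBr mulrC; congr (_ * _); have /matrixP/(_ t t) := EF_comm x.
  by rewrite !mxE eqxx mulr1n wtt.
have mcE z : m (fun o => phi o * o) z = (ipz z z)%:~R * m phi z
    + \sum_x (tau x z + tau x (z + root x)).
  have tauS x : tau x z + tau x (z + root x) =
     \sum_(t | wt t == z) phi (om t) * (E x *m F x + F x *m E x) t t.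
    by rewrite tauD -big_split; apply: eq_bigr => t _; rewrite [X in _ = _ * X]mxE mulrDr.
  under [X in _ + X]eq_bigr do rewrite tauS.
  rewrite exchange_big /m mulr_sumr -big_split; apply: eq_bigr => t /eqP wtt /=.
  rewrite -mulr_sumr [_%:~R * _]mulrC -mulrDr; congr (_ * _).
  have /matrixP/(_ t t) := casimir.
  by rewrite !mxE eqxx !mulr1n wtt summxE.
have key := weyl_casimir h12 xi tauE mcE.
rewrite -/(casimir_value xi) -/c in key.
pose far o : K := (o != c)%:R.
have e0 : \sum_(S : {set 'I_n * 'I_n}) (-1) ^+ #|S| *
    m far (xi + \sum_(x in S) root x) = 0.
  transitivity (\sum_(S : {set 'I_n * 'I_n}) (-1) ^+ #|S| *
     (m (fun o => phi o * o) (xi + \sum_(x in S) root x) -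
      c * m phi (xi + \sum_(x in S) root x))).
    apply: eq_bigr => S _; congr (_ * _); rewrite /m mulr_sumr -sumrB.
    apply: eq_bigr => t _; rewrite (mulrC c) -mulrBr /far /phi.
    case: eqVneq => [_|ne]; first by rewrite mul0r.
    by rewrite mulVf // subr_eq0.
  under eq_bigr do rewrite mulrBr mulrCA.
  by rewrite sumrB -mulr_sumr key subrr.
have cardE z : (#|[set t | wt t == z]|%:R : K) = m far z + m (fun o => (o == c)%:R) z.
  rewrite /m -big_split cardsE -sum1_card natr_sum; apply: eq_bigr => t _ /=.
  by rewrite /far; case: eqP; rewrite ?addr0 ?add0r.
under eq_bigr do rewrite cardE mulrDr.
rewrite big_split /= e0 add0r (bigD1 set0) //= cards0 mul1r big_set0 addr0.
rewrite [X in _ = _ + X]big1 => [|S neS].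
  rewrite addr0 /m /hw_index cardsE -sum1_card natr_sum.
  rewrite [RHS]big_mkcond [LHS]big_mkcond; apply: eq_bigr => t _ /=.
  by rewrite unfold_in; case: eqP => //= _; case: eqP.
rewrite /m big1 ?mulr0 // => t /eqP wtt; case: eqP => // omt; exfalso.
apply: (no_higher_index omt); rewrite wtt addrAC subrr add0r ipz_sumr.
  by apply: sumr_ge0.
have [y yS] := set0Pn _ neS.
rewrite (bigD1 y) //= ltr_wpDr ?ipz_weyl_posroot // sumr_ge0 // => x _.
by rewrite ltW // ipz_weyl_posroot.
Qed.

End CoordinateMultiplicity.

(** * Classical Lie algebras *)

Section ClassicalLie.
Variables (C : fieldType) (M : nat) (s : 'I_M -> C) (g : pred 'M[C]_M).
Hypothesis s_sq : forall i, s i * s i = 1.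
Hypothesis s_rev : forall i j, s (rev_ord i) * s (rev_ord j) = s i * s j.
Hypothesis gE : forall A : 'M[C]_M,
  (A \in g) <-> (forall i j, A i j = - (s i * s j * A (rev_ord j) (rev_ord i))).
Hypothesis two_neq0 : 2 != 0 :> C.

(** The adjoint for the bilinear form of g: an anti-automorphism whose (-1)-eigenspace is g, so that
    [skew_part] is twice the projection onto g. *)
Definition adj_transp (B : 'M[C]_M) : 'M[C]_M :=
  \matrix_(i, j) (s i * s j * B (rev_ord j) (rev_ord i)).

Lemma g_adj_transp A : A \in g <-> adj_transp A = - A.
Proof.
rewrite gE; split=> [e|/matrixP e i j].
  by apply/matrixP => i j; rewrite !mxE [in RHS]e opprK.
by have := e i j; rewrite !mxE => ->; rewrite opprK.
Qed.

Lemma adj_transpM A B : adj_transp (A *m B) = adj_transp B *m adj_transp A.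
Proof.
apply/matrixP => i j; rewrite !mxE mulr_sumr (reindex_inj rev_ord_inj).
apply: eq_bigr => k _; rewrite !mxE.
have := s_sq k; move: (A _ _) (B _ _) (s i) (s j) (s k) => a b x y z e.
by rewrite -[LHS]mulr1 -e; ring.
Qed.

Lemma adj_transpD A B : adj_transp (A + B) = adj_transp A + adj_transp B.
Proof. by apply/matrixP => i j; rewrite !mxE mulrDr. Qed.

Lemma adj_transpZ c A : adj_transp (c *: A) = c *: adj_transp A.
Proof. by apply/matrixP => i j; rewrite !mxE mulrCA. Qed.

Lemma adj_transpN A : adj_transp (- A) = - adj_transp A.
Proof. by rewrite -scaleN1r adj_transpZ scaleN1r. Qed.

Lemma adj_transpK A : adj_transp (adj_transp A) = A.
Proof.
apply/matrixP => i j; rewrite !mxE !rev_ordK [s (rev_ord j) * _]mulrC s_rev mulrA.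
by rewrite mulrACA !s_sq !mul1r.
Qed.

Lemma g_lin c A B : A \in g -> B \in g -> c *: A + B \in g.
Proof.
by move=> /g_adj_transp eA /g_adj_transp eB; apply/g_adj_transp; rewrite adj_transpD adj_transpZ eA eB scalerN opprD.
Qed.

Lemma g0 : 0 \in g.
Proof. by apply/g_adj_transp; rewrite -(scale0r 0) adj_transpZ !scale0r oppr0. Qed.

Lemma gZ c A : A \in g -> c *: A \in g.
Proof. by move=> gA; rewrite -[c *: A]addr0; apply: g_lin => //; apply: g0. Qed.

Lemma g_bracket A B : A \in g -> B \in g -> lie_bracket A B \in g.
Proof.
move=> /g_adj_transp eA /g_adj_transp eB; apply/g_adj_transp.
by rewrite /lie_bracket adj_transpD adj_transpN !adj_transpM eA eB !(mulNmx, mulmxN) !opprK opprD opprK addrC.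
Qed.

Definition skew_part (B : 'M[C]_M) : 'M[C]_M := B - adj_transp B.
Definition Xmx i j := skew_part (delta_mx i j).

Lemma skew_part_g B : skew_part B \in g.
Proof. by apply/g_adj_transp; rewrite /skew_part adj_transpD adj_transpN adj_transpK opprD opprK addrC. Qed.

Lemma adj_transp_delta i j :
  adj_transp (delta_mx i j) = (s i * s j) *: delta_mx (rev_ord j) (rev_ord i).
Proof.
apply/matrixP => a b; rewrite !mxE !(can2_eq (@rev_ordK M) (@rev_ordK M)) andbC.
case: andP => [[/eqP-> /eqP->]|_]; last by rewrite !mulr0.
by rewrite s_rev [s j * _]mulrC.
Qed.

Lemma Xmx_rev i j : Xmx (rev_ord j) (rev_ord i) = - (s i * s j) *: Xmx i j.
Proof.
rewrite /Xmx /skew_part !adj_transp_delta !rev_ordK [s (rev_ord j) * _]mulrC s_rev.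
rewrite scalerBr scalerA !mulNr (_ : s i * s j * (s i * s j) = 1); last first.
  by rewrite mulrACA !s_sq mul1r.
by rewrite !scaleN1r opprK scaleNr addrC.
Qed.

Lemma skew_partD A B : skew_part (A + B) = skew_part A + skew_part B.
Proof. by rewrite /skew_part adj_transpD opprD addrACA. Qed.

Lemma skew_partZ c A : skew_part (c *: A) = c *: skew_part A.
Proof. by rewrite /skew_part adj_transpZ scalerBr. Qed.

Lemma skew_part_sum A : skew_part A = \sum_i \sum_j A i j *: Xmx i j.
Proof.
rewrite {1}(matrix_sum_delta A).
rewrite (big_morph skew_part skew_partD (id1 := 0)); last by rewrite -(scale0r 0) skew_partZ !scale0r.
apply: eq_bigr => i _.
rewrite (big_morph skew_part skew_partD (id1 := 0)); last by rewrite -(scale0r 0) skew_partZ !scale0r.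
by apply: eq_bigr => j _; rewrite skew_partZ.
Qed.

Lemma g_sum A : A \in g -> A = 2^-1 *: \sum_i \sum_j A i j *: Xmx i j.
Proof.
move=> /g_adj_transp e; rewrite -skew_part_sum /skew_part e opprK -[A + A]mulr2n -scaler_nat.
by rewrite scalerA mulVf // scale1r.
Qed.

Lemma skew_part_bracket A B : A \in g -> lie_bracket A (skew_part B) = skew_part (lie_bracket A B).
Proof.
move=> /g_adj_transp e; rewrite /lie_bracket /skew_part adj_transpD adj_transpN !adj_transpM e.
rewrite !(mulNmx, mulmxN, mulmxBr, mulmxBl).
move: (A *m B) (B *m A) (A *m adj_transp B) (adj_transp B *m A) => a b c d.
by apply/matrixP => k l; rewrite !mxE; ring.
Qed.

(** [skew_part] commutes with the action of g, so the [Xmx i j] transform like matrix units. This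
    makes the contraction [casimir_op] commute with g. *)
Lemma Xmx_bracket A i j : A \in g ->
  lie_bracket A (Xmx i j) = \sum_k A k i *: Xmx k j - \sum_k A j k *: Xmx i k.
Proof.
move=> gA; rewrite skew_part_bracket // skew_part_sum.
have e k l : lie_bracket A (delta_mx i j) k l = A k i * (j == l)%:R - (k == i)%:R * A j l.
  rewrite !mxE (bigD1 i) //= big1 ?addr0 => [|k' ne]; last first.
    by rewrite !mxE (negbTE ne) mulr0.
  rewrite (bigD1 j) //= big1 ?addr0 => [|k' ne]; last first.
    by rewrite !mxE (negbTE ne) andbF mul0r.
  by rewrite !mxE !eqxx andbT eq_sym.
under eq_bigr do under eq_bigr do rewrite e scalerBl.
under eq_bigr do rewrite sumrB.
rewrite sumrB; congr (_ - _).
  apply: eq_bigr => k _; rewrite (bigD1 j) //= eqxx mulr1 big1 ?addr0 // => l ne.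
  by rewrite eq_sym (negbTE ne) mulr0 scale0r.
rewrite (bigD1 i) //= [X in _ + X]big1 ?addr0 => [|k ne].
  by apply: eq_bigr => l _; rewrite eqxx mul1r.
by rewrite big1 // => l _; rewrite (negbTE ne) mul0r scale0r.
Qed.

Section Representation.
Variable V : mxact C M.
Hypothesis Vrep : is_rep g V.

Lemma rep_lin c A B : A \in g -> B \in g -> V (c *: A + B) = c *: V A + V B.
Proof. exact: Vrep.1. Qed.

Lemma rep_bracket A B : A \in g -> B \in g ->
  V (lie_bracket A B) = V A *m V B - V B *m V A.
Proof. exact: Vrep.2. Qed.

Lemma rep0 : V 0 = 0.
Proof.
have := rep_lin 1 g0 g0; rewrite !scale1r addr0 => /eqP.
by rewrite -subr_eq0 opprD addrA subrr add0r oppr_eq0 => /eqP.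
Qed.

Lemma repZ c A : A \in g -> V (c *: A) = c *: V A.
Proof. by move=> gA; rewrite -[c *: A]addr0 rep_lin ?rep0 ?addr0 //; apply: g0. Qed.

(** A representation is linear on g only, so the induction has to carry membership in g along. *)
Lemma rep_sum (I : Type) (r : seq I) (P : pred I) (c : I -> C) (A : I -> 'M_M) :
  (forall i, A i \in g) ->
  V (\sum_(i <- r | P i) c i *: A i) = \sum_(i <- r | P i) c i *: V (A i) /\
  \sum_(i <- r | P i) c i *: A i \in g.
Proof.
move=> gA; elim: r => [|i r [IH1 IH2]]; first by rewrite !big_nil rep0; split=> //; apply: g0.
by rewrite !big_cons; case: (P i); rewrite ?rep_lin ?IH1 //; split=> //; apply: g_lin.
Qed.

Lemma Xmx_g i j : Xmx i j \in g. Proof. exact: skew_part_g. Qed.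

Lemma rep_Xmx_bracket A i j : A \in g ->
  V A *m V (Xmx i j) - V (Xmx i j) *m V A =
  \sum_k A k i *: V (Xmx k j) - \sum_k A j k *: V (Xmx i k).
Proof.
move=> gA; rewrite -rep_bracket ?Xmx_g // Xmx_bracket //.
have [e1 m1] := rep_sum (index_enum 'I_M) xpredT (fun k => A k i) (fun k => Xmx_g k j).
have [e2 m2] := rep_sum (index_enum 'I_M) xpredT (fun k => A j k) (fun k => Xmx_g i k).
by rewrite addrC -scaleN1r rep_lin // e1 e2 scaleN1r addrC.
Qed.

Definition casimir_op : 'M[C]_(act_dim V) :=
  \sum_i \sum_j V (Xmx i j) *m V (Xmx j i).

Lemma casimir_op_comm A : A \in g -> V A *m casimir_op = casimir_op *m V A.
Proof.
move=> gA; apply/eqP; rewrite -subr_eq0; apply/eqP.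
pose br B := V A *m B - B *m V A.
have brM B1 B2 : br (B1 *m B2) = br B1 *m B2 + B1 *m br B2.
  by rewrite /br mulmxBl mulmxBr !mulmxA addrA subrK.
have brS (I : finType) (B : I -> 'M_(act_dim V)) : br (\sum_i B i) = \sum_i br (B i).
  by rewrite /br mulmx_sumr mulmx_suml -sumrB.
rewrite -/(br _) /casimir_op brS; under eq_bigr do rewrite brS.
under eq_bigr do under eq_bigr do rewrite brM /br !rep_Xmx_bracket //.
pose Y i j := V (Xmx i j).
transitivity (\sum_i \sum_j \sum_k (
   (A k i *: (Y k j *m Y j i) - A j k *: (Y i k *m Y j i)) +
   (A k j *: (Y i j *m Y k i) - A i k *: (Y i j *m Y j k)))).
  apply: eq_bigr => i _; apply: eq_bigr => j _.
  rewrite mulmxBl mulmxBr !mulmx_suml !mulmx_sumr -!sumrB -big_split.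
  by apply: eq_bigr => k _; rewrite -!scalemxAl -!scalemxAr.
have r1 : \sum_i \sum_j \sum_k A k i *: (Y k j *m Y j i) =
          \sum_i \sum_j \sum_k A i k *: (Y i j *m Y j k).
  rewrite exchange_big [RHS]exchange_big; apply: eq_bigr => j _.
  by rewrite exchange_big.
have r2 : \sum_i \sum_j \sum_k A j k *: (Y i k *m Y j i) =
          \sum_i \sum_j \sum_k A k j *: (Y i j *m Y k i).
  by apply: eq_bigr => i _; rewrite exchange_big.
under eq_bigr do under eq_bigr do rewrite big_split !sumrB.
under eq_bigr do rewrite big_split !sumrB.
by rewrite big_split !sumrB r1 r2 /= addrC addrA subrK subrr.
Qed.

End Representation.
End ClassicalLie.

(** * Root vectors and their commutation relations *)

Section RootIndices.
Variables (n m : nat) (jd : 'I_n -> 'I_(n + m)).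
Local Notation l := (lshift m).

(* The Cartan weight of the i-th coordinate vector. *)
Definition coord_weight (i : 'I_(n + m)) : 'rV[int]_n :=
  \row_c ((i == l c)%:R - (i == rev_ord (l c))%:R).

Definition root_row (x : 'I_n * 'I_n) : 'I_(n + m) := l x.1.
Definition root_col (x : 'I_n * 'I_n) : 'I_(n + m) :=
  if x.1 == x.2 then jd x.1 else if (x.1 < x.2)%N then l x.2 else rev_ord (l x.2).

(** For the long roots of sp_(2n) the position of the root vector is fixed by the symmetry (i, j) ->
    (rev j, rev i), so [Xmx] is twice a matrix unit there. *)
Definition root_mult (C : fieldType) (x : 'I_n * 'I_n) : C :=
  if root_col x == rev_ord (root_row x) then 2 else 1.
End RootIndices.

(* What so_(2n+1) and sp_(2n) have in common.  The root vectors are the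
   [Xmx s i j]; that of the root with index x sits in row [root_row x] and column
   [root_col x], where jd a is the column for the root h eps_a. *)
Record root_datum (C : numFieldType) (n m h : nat) (g : pred 'M[C]_(n + m)) := RootDatum {
  rd_sign : 'I_(n + m) -> C;
  rd_col : 'I_n -> 'I_(n + m);
  rd_h : (0 < h <= 2)%N;
  rd_sq : forall i, rd_sign i * rd_sign i = 1;
  rd_rev : forall i j, rd_sign (rev_ord i) * rd_sign (rev_ord j) = rd_sign i * rd_sign j;
  rd_mem : forall A : 'M[C]_(n + m), (A \in g) <->
    (forall i j, A i j = - (rd_sign i * rd_sign j * A (rev_ord j) (rev_ord i)));
  rd_lt : forall a b : 'I_n, (lshift m a < rev_ord (lshift m b))%N;
  rd_col_gt : forall a, (lshift m a < rd_col a)%N;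
  rd_root : forall a, h.*2%:Z *: delta_mx 0 a =
    2 *: (coord_weight (lshift m a) - coord_weight (rd_col a));
  rd_opp : forall x, root_col rd_col x = rev_ord (root_row m x) ->
    rd_sign (root_row m x) * rd_sign (root_col rd_col x) = -1;
  rd_coord : forall i : 'I_(n + m),
    (exists c, i = lshift m c \/ i = rev_ord (lshift m c)) \/
    (rev_ord i = i /\ forall c : 'I_n, i != lshift m c);
  rd_upper : forall i j : 'I_(n + m), (i < j)%N -> Xmx rd_sign i j = 0 \/
    exists x c, Xmx rd_sign i j = c *: Xmx rd_sign (root_row m x) (root_col rd_col x);
  rd_sum : forall (W : lmodType C) (f : 'I_(n + m) -> 'I_(n + m) -> W),
    (forall i j, f (rev_ord j) (rev_ord i) = f i j) ->
    (forall i j, Xmx rd_sign i j = 0 -> f i j = 0) ->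
    2 *: \sum_i \sum_j f i j = 4 *: (\sum_a f (lshift m a) (lshift m a)) +
      \sum_x (4 / root_mult rd_col C x) *:
        (f (root_row m x) (root_col rd_col x) + f (root_col rd_col x) (root_row m x))
}.

Section RootData.
Variables (C : numFieldType) (n m h : nat) (g : pred 'M[C]_(n + m)) (D : root_datum h g).
Let s := rd_sign D.
Local Notation X := (Xmx s).
Local Notation l := (lshift m).
Local Notation jd := (rd_col D).
Local Notation coord_weight := (@coord_weight n m).
Local Notation root_row := (@root_row n m).
Local Notation root_col := (root_col jd).
Local Notation root_mult := (root_mult jd C).
Let s_sq i : s i * s i = 1 := rd_sq D i.
Let s_rev i j : s (rev_ord i) * s (rev_ord j) = s i * s j := rd_rev D i j.
Let gE := rd_mem D.

Lemma l_neq_rev (a b : 'I_n) : l a != rev_ord (l b).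
Proof. by apply/eqP => e; have := rd_lt D a b; rewrite e ltnn. Qed.

Lemma coord_weight_l a : coord_weight (l a) = delta_mx 0 a.
Proof.
apply/rowP => c; rewrite !mxE (negbTE (l_neq_rev _ _)) subr0 eqxx /= (inj_eq (@lshift_inj _ _)).
by rewrite eq_sym.
Qed.

Lemma coord_weight_rev i : coord_weight (rev_ord i) = - coord_weight i.
Proof.
apply/rowP => c; rewrite !mxE opprB (inj_eq rev_ord_inj).
by rewrite (can2_eq (@rev_ordK _) (@rev_ordK _)).
Qed.

Lemma posroot_coord x :
  posroot h x = 2 *: (coord_weight (root_row x) - coord_weight (root_col x)).
Proof.
rewrite /posroot /root_row /root_col; case: eqP => _; first exact: (rd_root D).
by case: ifP => _; rewrite ?coord_weight_rev !coord_weight_l ?opprK scalerDr ?scalerN ?scaleNr.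
Qed.

Lemma root_row_lt_col x : (root_row x < root_col x)%N.
Proof.
rewrite /root_row /root_col; case: eqP => _; first exact: rd_col_gt.
by case: ifP => // _; apply: (rd_lt D).
Qed.

Lemma Xmx_diag i : X i i = \sum_c (coord_weight i 0 c)%:~R *: X (l c) (l c).
Proof.
have Xl c : X (l c) (l c) = \sum_c' (coord_weight (l c) 0 c')%:~R *: X (l c') (l c').
  rewrite coord_weight_l (bigD1 c) //= mxE !eqxx scale1r big1 ?addr0 // => c' ne.
  by rewrite mxE (negbTE ne) andbF scale0r.
case: (rd_coord D i) => [[c [->|->]]|[ri ne]]; first exact: Xl.
  rewrite Xmx_rev // s_sq scaleN1r [in LHS]Xl -sumrN; apply: eq_bigr => c' _.
  have -> : coord_weight (rev_ord (l c)) 0 c' = - coord_weight (l c) 0 c'.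
    by rewrite coord_weight_rev mxE.
  by rewrite mulrNz scaleNr.
have -> : coord_weight i = 0.
  apply/rowP => c; rewrite !mxE (negbTE (ne c)) -(inj_eq rev_ord_inj) rev_ordK ri.
  by rewrite (negbTE (ne c)).
rewrite big1 => [|c _]; last by rewrite mxE scale0r.
by rewrite /Xmx /skew_part adj_transp_delta // ri s_sq scale1r subrr.
Qed.

Lemma Xmx_opp_bracket x : lie_bracket (X (root_row x) (root_col x)) (X (root_col x) (root_row x)) =
  root_mult x *: (X (root_row x) (root_row x) - X (root_col x) (root_col x)).
Proof.
rewrite (Xmx_bracket s_sq gE); last exact: (Xmx_g s_sq s_rev gE).
rewrite /root_mult; move: (root_row_lt_col x); set i := root_row x; set j := root_col x => ltij.
have neij : i != j by apply: contraTneq ltij => ->; rewrite ltnn.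
have XE a b : X i j a b = ((a == i) && (b == j))%:R
   - s i * s j * ((a == rev_ord j) && (b == rev_ord i))%:R.
  by rewrite /Xmx /skew_part adj_transp_delta // !mxE.
have -> : \sum_k X i j k j *: X k i = X i i +
    (if j == rev_ord i then - (s i * s j) *: X (rev_ord j) i else 0).
  under eq_bigr do rewrite XE scalerBl eqxx andbT.
  rewrite sumrB; congr (_ + _).
    by rewrite (bigD1 i) //= eqxx scale1r big1 ?addr0 // => k /negbTE->; rewrite scale0r.
  rewrite (bigD1 (rev_ord j)) //= eqxx big1 ?addr0 => [|k /negbTE->]; last first.
    by rewrite mulr0 scale0r.
  by case: eqP => _; rewrite ?mulr1 ?mulr0 ?scale0r ?oppr0 // scaleNr.
have -> : \sum_k X i j i k *: X j k = X j j +
    (if j == rev_ord i then - (s i * s j) *: X j (rev_ord i) else 0).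
  under eq_bigr do rewrite XE scalerBl eqxx /=.
  rewrite sumrB; congr (_ + _).
    by rewrite (bigD1 j) //= eqxx scale1r big1 ?addr0 // => k /negbTE->; rewrite scale0r.
  rewrite (bigD1 (rev_ord i)) //= eqxx andbT big1 ?addr0 => [|k /negbTE->]; last first.
    by rewrite andbF mulr0 scale0r.
  have -> : (i == rev_ord j) = (j == rev_ord i).
    by rewrite eq_sym (can2_eq (@rev_ordK _) (@rev_ordK _)).
  by case: eqP => _; rewrite ?mulr1 ?mulr0 ?scale0r ?oppr0 // scaleNr.
case: eqP => [e|_]; last by rewrite !addr0 scale1r.
have sij : s i * s j = -1 by exact: rd_opp e.
have rj : rev_ord j = i by rewrite e rev_ordK.
by rewrite sij opprK !scale1r -e rj scaler_nat mulrnBl !mulr2n.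
Qed.

Section Action.
Variables (V : mxact C (n + m)).
Hypothesis Vrep : is_rep g V.
Local Notation d := (act_dim V).
(* [P] diagonalises the Cartan subalgebra and the Casimir operator. *)
Variables (P P' : 'M[C]_d) (wt : 'I_d -> 'rV[int]_n) (om : 'I_d -> C).
Hypothesis PP' : P *m P' = 1%:M.
Hypothesis wtP : forall c, P *m V (X (l c) (l c)) = diag_mx (\row_t ((wt t 0 c)%:~R / 2)) *m P.
Hypothesis omP : P *m (2 *: casimir_op s V) = diag_mx (\row_t om t) *m P.

Let P'P : P' *m P = 1%:M.
Proof. by apply: mulmx1C. Qed.

(** The scalars of E and F are fitted to doubled weights: [E x, F x] acts by the pairing with
    [posroot h x], and twice [casimir_op] is the norm of the weight plus the sum of the E F + F
    E. *)
Let E x := P *m (2 *: V (X (root_row x) (root_col x))) *m P'.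
Let F x := P *m ((2 / root_mult x) *: V (X (root_col x) (root_row x))) *m P'.

Let conjM A B : P *m A *m P' *m (P *m B *m P') = P *m (A *m B) *m P'.
Proof. by rewrite !mulmxA -(mulmxA _ P' P) P'P mulmx1. Qed.

Let X_g i j : X i j \in g := Xmx_g s_sq s_rev gE i j.

Lemma conj_cartan_sum (c : 'I_n -> C) (A : 'M_(n + m)) :
  A = \sum_b c b *: X (l b) (l b) ->
  P *m V A = diag_mx (\row_t \sum_b c b * ((wt t 0 b)%:~R / 2)) *m P.
Proof.
move=> ->; have [-> _] := rep_sum gE Vrep (index_enum 'I_n) xpredT c (fun b => X_g (l b) (l b)).
rewrite mulmx_sumr; under eq_bigr do rewrite -scalemxAr wtP scalemxAl.
rewrite -mulmx_suml; congr (_ *m _); apply/matrixP => t t'.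
rewrite summxE !mxE; under eq_bigr do rewrite !mxE.
case: eqP => _; rewrite ?mulr1n //.
by rewrite !mulr0n big1 // => b _; rewrite mulr0.
Qed.

Lemma diag_conj (A : 'M_d) (w : 'I_d -> C) : P *m A = diag_mx (\row_t w t) *m P ->
  P *m A *m P' = diag_mx (\row_t w t).
Proof. by move=> ->; rewrite -mulmxA PP' mulmx1. Qed.

Lemma Xmx_cartanE c i j : X (l c) (l c) i j = ((i == j)%:R * (coord_weight i 0 c)%:~R).
Proof.
rewrite /Xmx /skew_part (adj_transp_delta s_rev) s_sq scale1r !mxE.
rewrite rmorphB /= !rmorph_nat mulrBr -!natrM !mulnb; congr (_%:R - _%:R); congr nat_of_bool.
  by case: (eqVneq i j) => [->|ne] /=; rewrite ?andbb //; apply: contraNF ne => /andP[/eqP-> /eqP->].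
by case: (eqVneq i j) => [->|ne] /=; rewrite ?andbb //; apply: contraNF ne => /andP[/eqP-> /eqP->].
Qed.

Lemma conj_Xmx_wt i j t t' : (P *m V (X i j) *m P') t t' != 0 ->
  wt t = wt t' + 2 *: (coord_weight i - coord_weight j).
Proof.
move=> Y0; apply/rowP => c; set Y := P *m _ *m _ in Y0.
have key : diag_mx (\row_t ((wt t 0 c)%:~R / 2 : C)) *m Y - Y *m diag_mx (\row_t ((wt t 0 c)%:~R / 2)) =
   ((coord_weight i 0 c)%:~R - (coord_weight j 0 c)%:~R) *: Y.
  have S1 : \sum_k X (l c) (l c) k i *: V (X k j) = (coord_weight i 0 c)%:~R *: V (X i j).
    rewrite (bigD1 i) //= Xmx_cartanE eqxx mul1r big1 ?addr0 // => k ne.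
    by rewrite Xmx_cartanE (negbTE ne) mul0r scale0r.
  have S2 : \sum_k X (l c) (l c) j k *: V (X i k) = (coord_weight j 0 c)%:~R *: V (X i j).
    rewrite (bigD1 j) //= Xmx_cartanE eqxx mul1r big1 ?addr0 // => k ne.
    by rewrite Xmx_cartanE eq_sym (negbTE ne) mul0r scale0r.
  have := rep_Xmx_bracket s_sq s_rev gE Vrep i j (X_g (l c) (l c)).
  rewrite S1 S2 -scalerBl => e.
  rewrite -(diag_conj (wtP c)) !conjM -mulmxBl -mulmxBr e.
  by rewrite -scalemxAr -scalemxAl.
have e0 := congr1 (fun A : 'M_d => A t t') key.
have [a ea] : exists a : C, a = (coord_weight i 0 c)%:~R - (coord_weight j 0 c)%:~R.
  by eexists.
rewrite -ea in e0; clear key; clearbody Y; rewrite mul_diag_mx mul_mx_diag !mxE in e0.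
have /(mulIf Y0) e : ((wt t 0 c)%:~R / 2 - (wt t' 0 c)%:~R / 2) * Y t t' = a * Y t t'.
  by rewrite mulrBl -e0 [Y t t' * _]mulrC.
move: (coord_weight i) (coord_weight j) ea => u v ea; rewrite !mxE.
apply/eqP; rewrite -(eqr_int C) !rmorphD /= !rmorphM /= rmorphB /= -ea -e.
by apply/eqP; field.
Qed.

Lemma conj_om i j t t' : (P *m V (X i j) *m P') t t' != 0 -> om t = om t'.
Proof.
move=> Y0; set Y := P *m _ *m _ in Y0.
have key : diag_mx (\row_t om t) *m Y = Y *m diag_mx (\row_t om t).
  rewrite -(diag_conj omP) !conjM; congr (P *m _ *m P').
  by rewrite -scalemxAl -scalemxAr (casimir_op_comm s_sq s_rev gE Vrep (X_g i j)).
have := congr1 (fun A : 'M_d => A t t') key.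
clearbody Y; rewrite mul_diag_mx mul_mx_diag !mxE [RHS]mulrC; exact: (mulIf Y0).
Qed.

Lemma E_conj_wt x t t' : E x t t' != 0 -> wt t = wt t' + posroot h x /\ om t = om t'.
Proof.
rewrite /E -scalemxAr -scalemxAl mxE mulf_eq0 negb_or => /andP[_ Y0].
by rewrite posroot_coord; split; [apply: conj_Xmx_wt | apply: conj_om Y0].
Qed.

Lemma mulmx_scale2 (a b : C) (A B : 'M_d) : (a *: A) *m (b *: B) = (a * b) *: (A *m B).
Proof. by rewrite -scalemxAl -scalemxAr scalerA. Qed.

Lemma root_mult_neq0 x : root_mult x != 0.
Proof. by rewrite /root_mult; case: ifP; rewrite ?oner_neq0 // pnatr_eq0. Qed.

Lemma EF_conj_comm x :
  E x *m F x - F x *m E x = diag_mx (\row_t (ipz (wt t) (posroot h x))%:~R).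
Proof.
rewrite /E /F !conjM -mulmxBl -mulmxBr !mulmx_scale2 [_ * 2]mulrC -scalerBr.
rewrite -(rep_bracket Vrep (X_g _ _) (X_g _ _)) Xmx_opp_bracket.
rewrite (repZ gE Vrep); last first.
  by rewrite -(scale1r (X (root_row x) _)) -scaleN1r; apply: (g_lin gE) => //;
   apply: (gZ gE).
rewrite scalerA -mulrA divfK ?root_mult_neq0 //.
rewrite -scalemxAr -scalemxAl (@diag_conj _ _ (conj_cartan_sum (c := fun c =>
  (coord_weight (root_row x) 0 c)%:~R - (coord_weight (root_col x) 0 c)%:~R) _)); last first.
  rewrite [X (root_row x) _]Xmx_diag [X (root_col x) _]Xmx_diag -sumrB.
  by apply: eq_bigr => b _; rewrite scalerBl.
apply/matrixP => t t'; rewrite !mxE; case: eqP => _; rewrite ?mulr0 //= !mulr1n.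
rewrite posroot_coord /ipz rmorph_sum mulr_sumr; apply: eq_bigr => b _.
by rewrite !mxE /= !rmorphM /= rmorphB /=; field.
Qed.

Lemma casimir_conj : diag_mx (\row_t om t) =
  diag_mx (\row_t (ipz (wt t) (wt t))%:~R) + \sum_x (E x *m F x + F x *m E x).
Proof.
rewrite -(diag_conj omP) /casimir_op.
pose f i j := V (X i j) *m V (X j i).
have fs i j : f (rev_ord j) (rev_ord i) = f i j.
  rewrite /f !(Xmx_rev s_sq s_rev) !(repZ gE Vrep) // -scalemxAl -scalemxAr scalerA.
  by rewrite mulrNN [s j * s i]mulrC mulrACA !s_sq mulr1 scale1r.
have f0 i j : X i j = 0 -> f i j = 0 by rewrite /f => ->; rewrite (rep0 gE Vrep) mul0mx.
rewrite (rd_sum fs f0) mulmxDr mulmxDl; congr (_ + _).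
  rewrite -scalemxAr -scalemxAl mulmx_sumr mulmx_suml.
  under eq_bigr do rewrite /f -conjM (diag_conj (wtP _)) mul_diag_mx.
  apply/matrixP => t t'; rewrite !mxE summxE; under eq_bigr do rewrite !mxE.
  case: eqP => [->|_]; rewrite ?mulr0n ?mulr1n.
    by rewrite /ipz rmorph_sum mulr_sumr; apply: eq_bigr => c _; rewrite rmorphM /=; field.
  by rewrite big1 ?mulr0 // => c _; rewrite mulr0.
rewrite mulmx_sumr mulmx_suml; apply: eq_bigr => x _.
rewrite /E /F !conjM -mulmxDl -mulmxDr !mulmx_scale2 [_ * 2]mulrC mulrA -natrM.
by rewrite -scalerDr.
Qed.

End Action.
End RootData.

(** * The submodule generated by a highest weight vector *)

Section CyclicSubmodule.
Variables (C : numFieldType) (n m h : nat) (g : pred 'M[C]_(n + m)) (D : root_datum h g).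
Let s := rd_sign D.
Local Notation X := (Xmx s).
Let s_sq i : s i * s i = 1 := rd_sq D i.
Let s_rev i j : s (rev_ord i) * s (rev_ord j) = s i * s j := rd_rev D i j.
Let gE := rd_mem D.
Let X_g i j : X i j \in g := Xmx_g s_sq s_rev gE i j.
Let two_neq0 : 2 != 0 :> C. Proof. by rewrite pnatr_eq0. Qed.

Variable V : mxact C (n + m).
Hypothesis Vrep : is_rep g V.
Local Notation d := (act_dim V).

Lemma rep_X_sum A : A \in g -> V A = 2^-1 *: \sum_i \sum_j A i j *: V (X i j).
Proof.
move=> gA; rewrite {1}(g_sum gE two_neq0 gA).
have inner i := rep_sum gE Vrep (index_enum 'I_(n + m)) xpredT (fun j => A i j) (fun j => X_g i j).
have outer := rep_sum gE Vrep (index_enum 'I_(n + m)) xpredT (fun=> 1) (fun i => (inner i).2).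
under eq_bigr do rewrite -[\sum_j _](scale1r).
rewrite (repZ gE Vrep) ?outer.2 // outer.1; congr (_ *: _).
by apply: eq_bigr => i _; rewrite scale1r (inner i).1.
Qed.

Lemma stable_X (U : {vspace 'cV[C]_d}) :
  (forall i j v, v \in U -> V (X i j) *m v \in U) -> stable_sub g U.
Proof.
move=> UX A v gA vU; rewrite (rep_X_sum gA) -scalemxAl memvZ // mulmx_suml.
apply: memv_suml => i _; rewrite mulmx_suml; apply: memv_suml => j _.
by rewrite -scalemxAl memvZ // UX.
Qed.

Lemma Xmx_strictly_upper (i j : 'I_(n + m)) : (i < j)%N -> strictly_upper (X i j).
Proof.
move=> ltij a b leba; rewrite /Xmx /skew_part (adj_transp_delta s_rev) !mxE.
case: (boolP ((a == i) && _)) => [/andP[/eqP ea /eqP eb]|_].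
  by move: leba; rewrite ea eb leqNgt ltij.
case: (boolP ((a == rev_ord j) && _)) => [/andP[/eqP ea /eqP eb]|_].
  have ltj := ltn_ord j; have lti := ltn_ord i.
  by move: leba; rewrite ea eb /=; lia.
by rewrite mulr0 subrr.
Qed.

Lemma Xmx_is_diag i : is_diag_mx (X i i).
Proof.
apply/is_diag_mxP => a b neab; rewrite /Xmx /skew_part (adj_transp_delta s_rev) !mxE.
case: (boolP ((a == i) && _)) => [/andP[/eqP ea /eqP eb]|_].
  by move: neab; rewrite ea eb eqxx.
case: (boolP ((a == rev_ord i) && _)) => [/andP[/eqP ea /eqP eb]|_].
  by move: neab; rewrite ea eb eqxx.
by rewrite mulr0 subrr.
Qed.

Let mulv (A : 'M[C]_d) : 'End('cV[C]_d) := linfun (mulmx A).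

Let mulvE A v : mulv A v = A *m v. Proof. exact: lfunE. Qed.

(** Iterating from the line of v gives the span of the products of at most k lowering operators
    applied to v; this filtration stands in for the Poincare-Birkhoff-Witt theorem. *)
Let step (Z : {vspace 'cV[C]_d}) : {vspace 'cV[C]_d} :=
  (Z + \sum_(p : 'I_(n + m) * 'I_(n + m) | (p.2 < p.1)%N) (mulv (V (X p.1 p.2)) @: Z))%VS.

Variable v : 'cV[C]_d.
Hypothesis v_up : forall i j : 'I_(n + m), (i < j)%N -> V (X i j) *m v = 0.
Hypothesis v_diag : forall i, V (X i i) *m v \in <[v]>%VS.

Let M k := iter k step <[v]>%VS.

Let M_sub k : (M k <= M k.+1)%VS. Proof. exact: addvSl. Qed.

Let M_low k (i j : 'I_(n + m)) z : (j < i)%N -> z \in M k -> V (X i j) *m z \in M k.+1.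
Proof.
move=> ltji zM; rewrite -mulvE; apply: (subvP (addvSr _ _)).
by apply: (subvP (@sumv_sup _ _ _ (i, j) _ _ _ _ (subvv _))) => //; apply: memv_img.
Qed.

(** Move X i j past a lowering operator. The commutator is again in g: its lowering part leads from
    M k to M k.+1, the rest falls under the induction hypothesis. *)
Let M_up k (i j : 'I_(n + m)) z : (i <= j)%N -> z \in M k -> V (X i j) *m z \in M k.
Proof.
elim: k i j z => [|k IH] i j z leij.
  move=> /vlineP[c ->]; rewrite -scalemxAr memvZ //.
  move: leij; rewrite leq_eqVlt => /predU1P[/val_inj -> //|ltij].
  by rewrite v_up // mem0v.
move=> /memv_addP[z1 z1M [z2 /memv_sumP[w wM ->] ->]].
rewrite mulmxDr memvD //; first exact: (subvP (M_sub k) _ (IH _ _ _ leij z1M)).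
rewrite mulmx_sumr; apply: memv_suml => -[a b] /= ltba.
have /memv_imgP[u uM ->] := wM (a, b) ltba; rewrite mulvE /= mulmxA.
have -> : V (X i j) *m V (X a b) =
    V (X a b) *m V (X i j) + V (lie_bracket (X i j) (X a b)).
  by rewrite (rep_bracket Vrep) ?X_g // addrC subrK.
rewrite mulmxDl memvD //.
  by rewrite -mulmxA M_low // IH.
rewrite rep_X_sum; last by apply: (g_bracket s_sq gE).
rewrite -scalemxAl memvZ // mulmx_suml; apply: memv_suml => p _.
rewrite mulmx_suml; apply: memv_suml => r _; rewrite -scalemxAl memvZ //.
case: (leqP p r) => [le|lt]; last exact: M_low.
exact: (subvP (M_sub k) _ (IH _ _ _ le uM)).
Qed.

(** Dimension forces two consecutive terms of the filtration to agree. The induction principle,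
    which involves lowering operators only, is what the uses need: orthogonality in [hwv_unique],
    leading terms in [graph]. *)
Lemma cyclic_submodule : exists W : {vspace 'cV[C]_d},
  [/\ v \in W, stable_sub g W &
   forall Q : 'cV[C]_d -> Prop, Q v -> (forall c x y, Q x -> Q y -> Q (c *: x + y)) ->
     (forall (i j : 'I_(n + m)) x, (j < i)%N -> Q x -> Q (V (X i j) *m x)) -> forall x, x \in W -> Q x].
Proof.
have [k Mk] : exists k, M k.+1 = M k.
  have : forall k, (exists2 k', (k' < k)%N & M k'.+1 = M k') \/ (k <= \dim (M k))%N.
    elim=> [|k [[k' lt e]|le]]; [by right|by left; exists k' => //; apply: ltnW|].
    have [e|ne] := eqVneq (M k.+1) (M k); first by left; exists k.
    right; apply: leq_ltn_trans le _; rewrite ltn_neqAle dimvS ?M_sub // andbT.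
    by apply: contra_neq ne => e; apply/esym/eqP; rewrite eqEdim M_sub e leqnn.
  move=> /(_ (\dim {:'cV[C]_d}).+1)[[k _ e]|]; first by exists k.
  by rewrite ltnNge dimvS // subvf.
have vM k' : v \in M k'.
  by elim: k' => [|k' IH]; [apply: memv_line | apply: (subvP (M_sub k') _ IH)].
exists (M k); split=> //.
  apply: stable_X => i j z zM; case: (leqP i j) => [le|lt]; first exact: M_up.
  by rewrite -Mk; apply: M_low.
move=> Q Qv Qlin Qlow.
have Q0 : Q 0 by have := Qlin (-1) v v Qv Qv; rewrite scaleN1r addNr.
have QD x y : Q x -> Q y -> Q (x + y) by rewrite -{2}[x]scale1r; apply: Qlin.
elim: (k) => [|k' IH] x.
  by move=> /vlineP[c ->]; rewrite -[_ *: _]addr0; apply: Qlin.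
move=> /memv_addP[z1 /IH Qz1 [z2 /memv_sumP[w wM ->] ->]]; apply: (QD) => //.
elim/big_ind: _ => [||[a b] /= ltba]; [exact: Q0 | exact: QD |].
by have /memv_imgP[u /IH Qu ->] := wM (a, b) ltba; rewrite mulvE; apply: Qlow.
Qed.

End CyclicSubmodule.

(** * Star representations *)

Section Adjoint.
Variable C : numClosedFieldType.

Definition adjm m n (A : 'M[C]_(m, n)) : 'M[C]_(n, m) := map_mx Num.conj A^T.

Lemma adjmM m n p (A : 'M[C]_(m, n)) (B : 'M[C]_(n, p)) : adjm (A *m B) = adjm B *m adjm A.
Proof. by rewrite /adjm trmx_mul map_mxM. Qed.

Lemma adjmD m n (A B : 'M[C]_(m, n)) : adjm (A + B) = adjm A + adjm B.
Proof. by apply/matrixP => i j; rewrite !mxE rmorphD. Qed.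

Lemma adjmZ m n c (A : 'M[C]_(m, n)) : adjm (c *: A) = c^* *: adjm A.
Proof. by apply/matrixP => i j; rewrite !mxE rmorphM. Qed.

Lemma adjm_sum m n (I : Type) (r : seq I) (P : pred I) (A : I -> 'M[C]_(m, n)) :
  adjm (\sum_(i <- r | P i) A i) = \sum_(i <- r | P i) adjm (A i).
Proof.
apply: (big_morph (@adjm m n)); first exact: adjmD.
by apply/matrixP => i j; rewrite !mxE rmorph0.
Qed.

Definition dot n (u v : 'cV[C]_n) : C := (adjm u *m v) 0 0.

Lemma dotDr n (u v w : 'cV[C]_n) : dot u (v + w) = dot u v + dot u w.
Proof. by rewrite /dot mulmxDr mxE. Qed.

Lemma dotZr n c (u v : 'cV[C]_n) : dot u (c *: v) = c * dot u v.
Proof. by rewrite /dot -scalemxAr mxE. Qed.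

Lemma dotDl n (u v w : 'cV[C]_n) : dot (u + v) w = dot u w + dot v w.
Proof. by rewrite /dot adjmD mulmxDl mxE. Qed.

Lemma dotZl n c (u v : 'cV[C]_n) : dot (c *: u) v = c^* * dot u v.
Proof. by rewrite /dot adjmZ -scalemxAl mxE. Qed.

Lemma dot_adj n (A : 'M[C]_n) (u v : 'cV[C]_n) : dot (A *m u) v = dot u (adjm A *m v).
Proof. by rewrite /dot adjmM mulmxA. Qed.

Lemma dot_eq0 n (u : 'cV[C]_n) : dot u u = 0 -> u = 0.
Proof.
rewrite /dot mxE => /eqP; rewrite psumr_eq0 => [|i _]; last first.
  by rewrite !mxE mulrC -normCK exprn_ge0.
move=> /allP e; apply/colP => i; have := e i (mem_index_enum i).
by rewrite !mxE mulrC -normCK sqrf_eq0 normr_eq0 => /eqP.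
Qed.

Section Perp.
Variables (n : nat) (W : {vspace 'cV[C]_n}).

Definition perp : {vspace 'cV[C]_n} :=
  lker (linfun (mulmx (\matrix_(i < \dim W) adjm (vbasis W)`_i))).

Lemma perpP v : reflect (forall w, w \in W -> dot w v = 0) (v \in perp).
Proof.
have rowE i : ((\matrix_(i < \dim W) adjm (vbasis W)`_i) *m v) i 0 = dot (vbasis W)`_i v.
  by rewrite /dot !mxE; apply: eq_bigr => j _; rewrite !mxE.
rewrite memv_ker lfunE /=; apply: (iffP eqP) => [/colP e w wW|e].
  rewrite (coord_vbasis wW) /dot adjm_sum mulmx_suml summxE big1 // => i _.
  by rewrite adjmZ -scalemxAl mxE -/(dot _ _) -rowE e mxE mulr0.
apply/colP => i; rewrite rowE [RHS]mxE; apply/e/vbasis_mem/mem_nth.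
by rewrite size_tuple.
Qed.

Lemma cap_perp : (W :&: perp = 0)%VS.
Proof.
apply/eqP; rewrite -subv0; apply/subvP => v; rewrite memv_cap memv0 => /andP[vW /perpP].
by move=> /(_ v vW)/dot_eq0 ->.
Qed.

(** [perp] is the kernel of dim W linear forms, so it cuts U in codimension at most dim W. *)
Lemma add_perp (U : {vspace 'cV[C]_n}) : (W <= U)%VS -> (W + U :&: perp = U)%VS.
Proof.
move=> WU; apply/eqP; rewrite eqEdim; apply/andP; split.
  by rewrite subv_add WU capvSl.
rewrite dimv_disjoint_sum; last first.
  by apply/eqP; rewrite -subv0 -cap_perp capvS // capvSr.
rewrite /perp; set f := linfun _; rewrite -(limg_ker_dim f U) addnC leq_add2r.
by apply: leq_trans (dimvS (subvf _)) _; rewrite dimvf /dim /= muln1.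
Qed.
End Perp.
End Adjoint.

(** * Complete reducibility and highest weight vectors *)

Section StarRepresentation.
Variables (C : numClosedFieldType) (n m h : nat) (g : pred 'M[C]_(n + m)) (D : root_datum h g).
Let s := rd_sign D.
Local Notation X := (Xmx s).
Local Notation l := (lshift m).
Let s_sq i : s i * s i = 1 := rd_sq D i.
Let s_rev i j : s (rev_ord i) * s (rev_ord j) = s i * s j := rd_rev D i j.
Let gE := rd_mem D.
Let X_g i j : X i j \in g := Xmx_g s_sq s_rev gE i j.

Variable V : mxact C (n + m).
Hypothesis Vrep : is_rep g V.
Local Notation d := (act_dim V).
Hypothesis Vstar : forall i j, adjm (V (X i j)) = V (X j i).

Lemma stable_perp W : stable_sub g W -> stable_sub g (perp W : {vspace 'cV[C]_d}).
Proof.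
move=> stW; apply: (stable_X (D := D) Vrep) => i j v /perpP vW; apply/perpP => w wW.
by rewrite -Vstar -dot_adj vW // stW.
Qed.

Lemma exists_irreducible (U : {vspace 'cV[C]_d}) : stable_sub g U -> U <> 0%VS ->
  exists2 W, irreducible_sub g W & (W <= U)%VS.
Proof.
have [k] := ubnP (\dim U); elim: k U => // k IH U ltk stU U0.
have [irr|/existsNP[W]] := pselect (forall W : {vspace 'cV[C]_d},
    stable_sub g W -> (W <= U)%VS -> W = 0%VS \/ W = U); first by exists U.
move=> /not_implyP[stW] /not_implyP[WU] /not_orP[W0 neW].
have [|//|//|Z irrZ ZW] := IH W _ _ _; last by exists Z => //; apply: subv_trans ZW WU.
rewrite -ltnS; apply: leq_trans ltk; rewrite ltnS ltn_neqAle dimvS // andbT.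
by apply/eqP => e; apply: neW; apply/eqP; rewrite eqEdim WU e leqnn.
Qed.

Lemma complete_reducibility (U : {vspace 'cV[C]_d}) : stable_sub g U ->
  exists r (W : 'I_r -> {vspace 'cV[C]_d}),
    [/\ forall i, irreducible_sub g (W i), (\sum_i W i)%VS = U & directv (\sum_i W i)].
Proof.
have [k] := ubnP (\dim U); elim: k U => // k IH U ltk stU.
have [->|U0] := pselect (U = 0%VS).
  exists 0, (fun=> 0%VS); split=> [[]//||]; first by rewrite big_ord0.
  by rewrite directvE /= !big_ord0 dimv0.
have [W0 irrW W0U] := exists_irreducible stU U0; have [stW nzW _] := irrW.
pose U' := (U :&: perp W0)%VS.
have stU' : stable_sub g U'.
  move=> A v gA /memv_capP[vU vW]; apply/memv_capP; split; first exact: stU.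
  exact: (stable_perp stW).
have UE := add_perp W0U.
have disj : (W0 :&: U' = 0)%VS.
  by apply/eqP; rewrite -subv0 -(cap_perp W0) capvS // capvSr.
have dimE : \dim U = (\dim W0 + \dim U')%N by rewrite -UE dimv_disjoint_sum.
have dimW0 : (0 < \dim W0)%N by rewrite lt0n dimv_eq0; apply/eqP.
have [|r [W [irr WU' dW]]] := IH U' _ stU'; first by lia.
exists r.+1, (fun i => oapp W W0 (unlift ord0 i)).
have oE : oapp W W0 (unlift ord0 ord0) = W0 by rewrite unlift_none.
have lE i : oapp W W0 (unlift ord0 (lift ord0 i)) = W i by rewrite liftK.
have sumE : (\sum_i oapp W W0 (unlift ord0 i))%VS = U.
  by rewrite big_ord_recl oE; under eq_bigr do rewrite lE; rewrite WU'.
split=> // [i|]; first by case: unliftP => [j _|_] /=.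
move: dW; rewrite !directvE /= WU' sumE big_ord_recl oE => /eqP dW.
by apply/eqP; rewrite dimE dW; congr (_ + _)%N; apply: eq_bigr => i _; rewrite lE.
Qed.

Section HighestWeight.
Variables (wt0 : 'I_d -> 'rV[int]_n) (xi : 'rV[int]_n) (mu : weight n).
Hypothesis V_wt : forall c, V (X (l c) (l c)) = diag_mx (\row_t ((wt0 t 0 c)%:~R / 2)).
Hypothesis xi_dom : forall x, 0 <= ipz xi (posroot h x).
Hypothesis mu_xi : forall c, mu 0 c = (xi 0 c)%:~R / 2.

Lemma g_diag_sum A : A \in g -> is_diag_mx A -> A = \sum_c A (l c) (l c) *: X (l c) (l c).
Proof.
move=> gA /is_diag_mxP dA; apply/matrixP => i j; rewrite summxE.
under eq_bigr do rewrite mxE Xmx_cartanE.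
have [<-|ne] := eqVneq i j; last first.
  by rewrite dA // big1 // => c _; rewrite mul0r mulr0.
under eq_bigr do rewrite mul1r mxE.
have rev_entry k : A (rev_ord k) (rev_ord k) = - A k k.
  have /gE/(_ k k) := gA; rewrite s_sq mul1r => ->; by rewrite opprK.
case: (rd_coord D i) => [[c [->|->]]|[ri ne]].
- rewrite (bigD1 c) //= eqxx (negbTE (l_neq_rev D _ _)) subr0 mulr1 big1 ?addr0 // => c' ne.
  rewrite (inj_eq (@lshift_inj _ _)) eq_sym (negbTE ne) (negbTE (l_neq_rev D _ _)).
  by rewrite subrr mulr0.
- rewrite rev_entry (bigD1 c) //= eqxx eq_sym (negbTE (l_neq_rev D _ _)) sub0r mulrN1z mulrN1.
  rewrite big1 ?addr0 // => c' ne.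
  rewrite (inj_eq rev_ord_inj) (inj_eq (@lshift_inj _ _)) [c == _]eq_sym (negbTE ne).
  by rewrite eq_sym (negbTE (l_neq_rev D _ _)) subrr mulr0.
have -> : A i i = 0.
  have e := rev_entry i; rewrite ri in e.
  have /eqP : A i i *+ 2 = 0 by rewrite mulr2n {2}e subrr.
  by rewrite mulrn_eq0 => /eqP.
rewrite big1 // => c _; rewrite (negbTE (ne c)) -(inj_eq rev_ord_inj) rev_ordK ri.
by rewrite (negbTE (ne c)) subrr mulr0.
Qed.

Lemma hwvP (v : 'cV[C]_d) : v != 0 -> highest_weight_vector g mu v <->
  (forall x, V (X (root_row m x) (root_col (rd_col D) x)) *m v = 0) /\
  (forall c, V (X (l c) (l c)) *m v = ((xi 0 c)%:~R / 2) *: v).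
Proof.
have muE c : ratr (mu 0 c) = (xi 0 c)%:~R / 2 :> C.
  by rewrite mu_xi fmorph_div /= ratr_int rmorph_nat.
move=> v0; split=> [[_ up dg]|[up dg]].
  split=> [x|c].
    by apply: up => //; apply: (Xmx_strictly_upper D); apply: root_row_lt_col.
  rewrite (dg _ (X_g _ _) (Xmx_is_diag D _)); congr (_ *: _).
  under eq_bigr do rewrite muE Xmx_cartanE eqxx mul1r (coord_weight_l D) mxE eqxx /=.
  rewrite (bigD1 c) //= eqxx mulr1 big1 ?addr0 // => c' ne.
  by rewrite eq_sym (negbTE ne) mulr0.
split=> // [A gA upA|H gH dH].
  rewrite (rep_X_sum D Vrep gA) -scalemxAl mulmx_suml big1 ?scaler0 // => i _.
  rewrite mulmx_suml big1 // => j _; rewrite -scalemxAl.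
  have [le|lt] := leqP j i; first by rewrite upA // scale0r.
  case: (rd_upper D lt) => [->|[x [c ->]]]; first by rewrite (rep0 gE Vrep) mul0mx scaler0.
  by rewrite (repZ gE Vrep) // -scalemxAl up !scaler0.
rewrite {1}(g_diag_sum gH dH).
have [-> _] := rep_sum gE Vrep (index_enum 'I_n) xpredT (fun c => H (l c) (l c))
  (fun c => X_g (l c) (l c)).
rewrite mulmx_suml scaler_suml; apply: eq_bigr => c _.
by rewrite -scalemxAl dg scalerA muE mulrC.
Qed.

Lemma casimir_op_hermitian : adjm (casimir_op s V) = casimir_op s V.
Proof.
rewrite /casimir_op adjm_sum; apply: eq_bigr => i _; rewrite adjm_sum.
by apply: eq_bigr => j _; rewrite adjmM !Vstar.
Qed.

(** The Casimir operator is hermitian, hence diagonalizable, and commutes with the Cartan matrices,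
    which are diagonal already. The change of basis may reorder the weights but keeps the dimensions
    of their spaces. *)
Lemma codiagonalization : exists (P P' : 'M[C]_d) (wt : 'I_d -> 'rV[int]_n) (om : 'I_d -> C),
  [/\ P *m P' = 1%:M,
     forall c, P *m V (X (l c) (l c)) = diag_mx (\row_t ((wt t 0 c)%:~R / 2)) *m P,
     P *m (2 *: casimir_op s V) = diag_mx (\row_t om t) *m P &
     forall z, #|[set t | wt t == z]| = #|[set t | wt0 t == z]|].
Proof.
pose As := (2 *: casimir_op s V) :: [seq V (X (l c) (l c)) | c <- enum 'I_n].
have [P Punit /andP[/= om_diag /allP wt_diag]] : codiagonalizable As.
  apply/codiagonalizableP; split.
    have comm c : comm_mx (2 *: casimir_op s V) (V (X (l c) (l c))).
      rewrite /comm_mx -scalemxAl -scalemxAr; congr (_ *: _).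
      by rewrite (casimir_op_comm s_sq s_rev gE Vrep).
    move=> A B; rewrite !inE => /predU1P[->|/mapP[c _ ->]] /predU1P[->|/mapP[c' _ ->]].
    - by [].
    - exact: comm.
    - exact/esym/comm.
    by rewrite /comm_mx !V_wt diag_mxC.
  move=> A; rewrite inE => /predU1P[->|/mapP[c _ ->]]; last by rewrite V_wt; apply: diagonalizable_diag.
  have nrm : (2 *: casimir_op s V) \is normalmx.
    have e : adjm (2 *: casimir_op s V) = 2 *: casimir_op s V.
      by rewrite adjmZ casimir_op_hermitian conjC_nat.
    by apply/normalmxP; move: e; rewrite /adjm => ->.
  exists (spectralmx (2 *: casimir_op s V)); first exact: spectral_unit.
  apply/diagonalizable_forPex; exists (spectral_diag (2 *: casimir_op s V)).
  apply/(simmxP (spectral_unit _)).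
  have /orthomx_spectralP e := nrm; rewrite [X in _ *m X = _]e.
  by rewrite !mulmxA mulmxV ?mul1mx // spectral_unit.
have {om_diag} [om omP] : exists om : 'I_d -> C,
    P *m (2 *: casimir_op s V) = diag_mx (\row_t om t) *m P.
  have /diagonalizable_forPex[dg /(simmxP Punit) e] := om_diag.
  exists (fun t => dg 0 t); rewrite e; congr (diag_mx _ *m _).
  by apply/rowP => t; rewrite mxE.
have dgP c : exists dg : 'rV[C]_d, P *m V (X (l c) (l c)) = diag_mx dg *m P.
  have /= := wt_diag (V (X (l c) (l c))) (map_f _ (mem_enum _ c)).
  by move=> /diagonalizable_forPex[dg /(simmxP Punit) e]; exists dg.
have [dg dgE] := choice dgP.
have PVE c t t' : P t t' * ((wt0 t' 0 c)%:~R / 2) = dg c 0 t * P t t'.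
  have /matrixP/(_ t t') := dgE c.
  by rewrite V_wt mul_mx_diag mul_diag_mx !mxE.
have nz t : exists t', P t t' != 0.
  apply: contrapT => /forallNP z.
  have := mulmxV Punit; move/matrixP/(_ t t).
  rewrite !mxE eqxx big1 => [/eqP|t' _]; first by rewrite eq_sym oner_eq0.
  by have /negP := z t'; rewrite negbK => /eqP ->; rewrite mul0r.
(* The weight attached to row t of P is that of any old index in its support. *)
have [tau tauP] := choice nz.
exists P, (invmx P), (fun t => wt0 (tau t)), om; split=> [|c||z] //.
- exact: mulmxV.
- rewrite dgE; congr (diag_mx _ *m _); apply/rowP => t; rewrite mxE.
  by apply: (mulIf (tauP t)); rewrite -PVE mulrC.
have wtE t t' : P t t' != 0 -> wt0 (tau t) = wt0 t'.
  move=> Pt; apply/rowP => c; apply/eqP; rewrite -(eqr_int C); apply/eqP.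
  have two0 : (2 : C)^-1 != 0 by rewrite invr_eq0 pnatr_eq0.
  apply: (mulIf two0); transitivity (dg c 0 t).
    by apply: (mulIf (tauP t)); rewrite -PVE mulrC.
  by apply: (mulIf Pt); rewrite -PVE mulrC.
(* P intertwines the projections onto the weight z in the two bases, and the trace of such a
   projection is the count. *)
pose ind (w : 'I_d -> 'rV[int]_n) : 'M[C]_d := diag_mx (\row_t (w t == z)%:R).
have tr_ind w : \tr (ind w) = #|[set t | w t == z]|%:R.
  rewrite mxtrace_diag; under eq_bigr do rewrite mxE.
  rewrite -sum1dep_card natr_sum [RHS]big_mkcond.
  by apply: eq_bigr => t _; case: (w t == z).
have : ind (fun t => wt0 (tau t)) *m P = P *m ind wt0.
  apply/matrixP => t t'; rewrite mul_mx_diag mul_diag_mx !mxE.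
  have [->|Pt] := eqVneq (P t t') 0; first by rewrite mul0r mulr0.
  by rewrite (wtE _ _ Pt) mulrC.
move=> /(congr1 (fun A => A *m invmx P)); rewrite -mulmxA mulmxV // mulmx1 => /(congr1 mxtrace).
rewrite mxtrace_mulC mulmxA mulVmx // mul1mx !tr_ind => /eqP.
by rewrite eqr_nat => /eqP.
Qed.

(* The highest weight vectors of weight mu, with 0. *)
Lemma hw_space : exists T : {vspace 'cV[C]_d},
  (forall v, v != 0 -> (v \in T <-> highest_weight_vector g mu v)) /\
  ((\dim T)%:R : C) = \sum_(S : {set 'I_n * 'I_n}) (-1) ^+ #|S| *
    #|[set t | wt0 t == xi + \sum_(x in S) posroot h x]|%:R.
Proof.
have [P [P' [wt [om [PP' wtP omP cardE]]]]] := codiagonalization.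
have P'P : P' *m P = 1%:M by exact: mulmx1C.
pose E x := P *m (2 *: V (X (root_row m x) (root_col (rd_col D) x))) *m P'.
pose F x := P *m ((2 / root_mult (rd_col D) C x) *:
  V (X (root_col (rd_col D) x) (root_row m x))) *m P'.
have h12 := rd_h D.
have Ewt x t t' : E x t t' != 0 -> wt t = wt t' + posroot h x /\ om t = om t'.
  exact: (E_conj_wt Vrep PP' wtP omP).
have comm x : E x *m F x - F x *m E x = diag_mx (\row_t (ipz (wt t) (posroot h x))%:~R).
  exact: (EF_conj_comm Vrep PP' wtP).
have cas : diag_mx (\row_t om t) =
  diag_mx (\row_t (ipz (wt t) (wt t))%:~R) + \sum_x (E x *m F x + F x *m E x).
  exact: (casimir_conj Vrep PP' wtP omP).
pose idx := hw_index h wt om xi.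
have two0 : 2 != 0 :> C by rewrite pnatr_eq0.
have VE x v : V (X (root_row m x) (root_col (rd_col D) x)) *m v = 2^-1 *: (P' *m (E x *m (P *m v))).
  rewrite /E -!mulmxA (mulmxA P' P) P'P mul1mx (mulmxA P' P) P'P mul1mx.
  by rewrite -scalemxAl scalerA mulVf // scale1r.
(* The columns of the inverse of P with index in [idx] form a basis of the space sought. *)
pose f (i : 'I_#|idx|) : 'cV[C]_d := P' *m delta_mx (enum_val i) 0.
pose fX := [tuple f i | i < #|idx|].
have nthX (i : 'I_#|idx|) : fX`_i = f i by rewrite -tnth_nth tnth_mktuple.
have freeX : free fX.
  apply/freeP => k e i; have := congr1 (fun u : 'cV[C]_d => (P *m u) (enum_val i) 0) e.
  rewrite mulmx0 mulmx_sumr summxE (bigD1 i) //= big1 ?addr0 => [|j ne].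
    by rewrite nthX /f -scalemxAr mulmxA PP' mul1mx !mxE !eqxx mulr1.
  rewrite nthX /f -scalemxAr mulmxA PP' mul1mx !mxE (inj_eq enum_val_inj).
  by rewrite [i == j]eq_sym (negbTE ne) mulr0.
exists <<fX>>%VS; split; last first.
  rewrite (eqnP freeX) size_tuple (card_hw_index h12 Ewt comm cas xi_dom).
  by apply: eq_bigr => S _; rewrite cardE.
move=> v v0; rewrite hwvP //; split=> [vX|[up dg]].
  have [up dg] : (forall i x, V (X (root_row m x) (root_col (rd_col D) x)) *m f i = 0) /\
      (forall i c, V (X (l c) (l c)) *m f i = ((xi 0 c)%:~R / 2) *: f i).
    split=> i => [x|c].
      rewrite VE /f (mulmxA P P') PP' mul1mx.
      by rewrite (E_hw_index h12 Ewt comm cas xi_dom) ?mulmx0 ?scaler0 // enum_valP.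
    have := enum_valP i; rewrite inE => /andP[/eqP wti _].
    apply: (can_inj (mulKmx (mulmx1_unit PP').1)).
    have PPf : P *m f i = delta_mx (enum_val i) 0 by rewrite /f mulmxA PP' mul1mx.
    rewrite mulmxA wtP -mulmxA PPf -scalemxAr PPf.
    apply/colP => t; rewrite mul_diag_mx !mxE.
    by case: (eqVneq t (enum_val i)) => [->|_]; rewrite ?mulr0 // wti.
  split=> [x|c].
    have : (<<fX>> <= lker (linfun (mulmx (V (X (root_row m x) (root_col (rd_col D) x))))))%VS.
      apply/span_subvP => u /tnthP[i ->]; rewrite tnth_mktuple memv_ker lfunE /=.
      by rewrite up.
    by move=> /subvP/(_ v vX); rewrite memv_ker lfunE /= => /eqP.
  have : (<<fX>> <= lker (linfun (mulmx (V (X (l c) (l c)) - ((xi 0 c)%:~R / 2)%:M))))%VS.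
    apply/span_subvP => u /tnthP[i ->]; rewrite tnth_mktuple memv_ker lfunE /=.
    by rewrite mulmxBl mul_scalar_mx dg subrr.
  move=> /subvP/(_ v vX); rewrite memv_ker lfunE /= mulmxBl mul_scalar_mx subr_eq0.
  by move=> /eqP.
have Psupp t : (P *m v) t 0 != 0 -> t \in idx.
  apply: (hw_support h12 comm cas) => [t' vt'|x]; last first.
    rewrite /E -!mulmxA (mulmxA P' P) P'P mul1mx -scalemxAl up.
    by rewrite scaler0 mulmx0.
  apply/rowP => c; apply/eqP; rewrite -(eqr_int C); apply/eqP.
  have two1 : (2 : C)^-1 != 0 by rewrite invr_eq0.
  apply: (mulIf two1); apply: (mulIf vt').
  have := congr1 (fun A => (P *m A) t' 0) (dg c).
  by rewrite /= -scalemxAr mulmxA wtP -mulmxA mul_diag_mx [LHS]mxE [RHS]mxE mxE.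
have -> : v = \sum_i (P *m v) (enum_val i) 0 *: f i.
  rewrite -[LHS]mul1mx -P'P -mulmxA; under eq_bigr do rewrite scalemxAr.
  rewrite -mulmx_sumr; congr (_ *m _); apply/colP => t; rewrite summxE.
  have entry (i : 'I_#|idx|) : ((P *m v) (enum_val i) 0 *: (delta_mx (enum_val i) 0 : 'cV[C]_d)) t 0 =
      (P *m v) (enum_val i) 0 * (t == enum_val i)%:R.
    by rewrite [LHS]mxE [X in _ * X]mxE andbT.
  rewrite (eq_bigr _ (fun i _ => entry i)).
  have [tI|tnI] := boolP (t \in idx).
    have [i0 ei0] : exists i0 : 'I_#|idx|, enum_val i0 = t.
      by exists (enum_rank_in tI t); rewrite enum_rankK_in.
    rewrite (bigD1 i0) //= ei0 eqxx mulr1.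
    rewrite big1 ?addr0 // => i ne; case: eqP => [e|_]; last by rewrite mulr0.
    by case/eqP: ne; apply: enum_val_inj; rewrite ei0.
  rewrite big1 => [|i _]; last first.
    case: eqP => [e|_]; last by rewrite mulr0.
    by move: tnI; rewrite e enum_valP.
  by apply/eqP; apply: contraR tnI => /Psupp.
apply: memv_suml => i _; apply: memvZ; rewrite -nthX.
by apply: memv_span; apply: mem_nth; rewrite size_tuple.
Qed.

(** Let z be the part of w orthogonal to v. By irreducibility z lies in the submodule generated by
    v. That submodule is orthogonal to z: v is, and a lowering operator moves across the product to
    a raising operator, which kills z. So z is orthogonal to itself. *)
Lemma hwv_unique (U : {vspace 'cV[C]_d}) v w : irreducible_sub g U ->
  v \in U -> w \in U -> highest_weight_vector g mu v -> highest_weight_vector g mu w ->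
  w \in <[v]>%VS.
Proof.
move=> [stU _ irrU] vU wU hv hw.
have [v0 _ _] := hv; have [w0 _ _] := hw.
have [T [TP _]] := hw_space.
pose c := dot v w / dot v v; pose z := w - c *: v.
have vv0 : dot v v != 0 by apply: contra_neq v0; apply: dot_eq0.
have vz : dot v z = 0 by rewrite /z dotDr -scaleNr dotZr mulNr /c divfK // subrr.
have zT : z \in T by rewrite memvB ?memvZ //; [exact/(TP w w0) | exact/(TP v v0)].
have [z0|zn0] := eqVneq z 0.
  by move/eqP: z0; rewrite subr_eq0 => /eqP ->; rewrite memvZ // memv_line.
have [upz _] := (hwvP zn0).1 ((TP z zn0).1 zT).
have [_ up dg] := hv.
have [W [vW stW Wind]] : exists W : {vspace 'cV[C]_d},
  [/\ v \in W, stable_sub g W &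
   forall Q : 'cV[C]_d -> Prop, Q v -> (forall c x y, Q x -> Q y -> Q (c *: x + y)) ->
     (forall (i j : 'I_(n + m)) x, (j < i)%N -> Q x -> Q (V (X i j) *m x)) ->
     forall x, x \in W -> Q x].
  apply: (cyclic_submodule Vrep) => [i j ltij|i].
    by apply: up => //; apply: (Xmx_strictly_upper D).
  by rewrite (dg _ (X_g _ _) (Xmx_is_diag D _)) memvZ // memv_line.
have zW : z \in W.
  have [//|U'0|e] := irrU (U :&: W)%VS _ (capvSl _ _).
  - by move=> A x gA /memv_capP[xU xW]; apply/memv_capP; split; [apply: stU | apply: stW].
  - by case/eqP: v0; apply/eqP; rewrite -memv0 -U'0 memv_cap vU vW.
  have : z \in (U :&: W)%VS by rewrite e memvB // memvZ.
  by move=> /memv_capP[].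
have hz := (TP z zn0).1 zT; have [_ upz' _] := hz.
have dot_lin c' x y : dot x z = 0 -> dot y z = 0 -> dot (c' *: x + y) z = 0.
  by move=> e1 e2; rewrite dotDl dotZl e1 e2 mulr0 addr0.
have dot_low (i j : 'I_(n + m)) x : (j < i)%N -> dot x z = 0 -> dot (V (X i j) *m x) z = 0.
  move=> ltji _; rewrite dot_adj Vstar upz' ?X_g //; first by rewrite /dot mulmx0 mxE.
  exact: (Xmx_strictly_upper D).
have /dot_eq0 z0 := Wind (fun x => dot x z = 0) vz dot_lin dot_low z zW.
by rewrite z0 eqxx in zn0.
Qed.

(** The space T of highest weight vectors is the direct sum of its intersections with the
    irreducible summands; such an intersection is a line for the copies of V(mu) and zero for the
    others. *)
Lemma star_multiplicity : exists2 r : nat, has_multiplicity g mu V r &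
  (r%:R : C) = \sum_(S : {set 'I_n * 'I_n}) (-1) ^+ #|S| *
    #|[set t | wt0 t == xi + \sum_(x in S) posroot h x]|%:R.
Proof.
have [T [TP dimT]] := hw_space.
have [r [U [irr sumU dU]]] := @complete_reducibility fullv (fun A v _ _ => memvf _).
pose P := [set i | `[< is_hw_irrep_sub g mu (U i) >]].
exists #|P|; first by exists r, U, P; split=> // i; rewrite inE; split=> /asboolP.
rewrite -dimT; congr (_%:R).
have subT w i : w \in U i -> w != 0 -> w \in T -> i \in P.
  move=> wU w0 wT; rewrite inE; apply/asboolP; split; first exact: irr.
  by exists w => //; apply/TP.
have projT (w : 'I_r -> 'cV[C]_d) : (forall i, w i \in U i) ->
    \sum_i w i \in T -> forall i, w i \in T.
  move=> wU swT i; have stU j : stable_sub g (U j) by have [] := irr j.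
  have [up dg] : (forall x, V (X (root_row m x) (root_col (rd_col D) x)) *m \sum_i w i = 0) /\
    (forall c, V (X (l c) (l c)) *m \sum_i w i = ((xi 0 c)%:~R / 2) *: \sum_i w i).
    have [->|sw0] := eqVneq (\sum_i w i) 0.
      by split=> *; rewrite mulmx0 ?scaler0.
    by apply/(hwvP sw0)/(TP _ sw0).
  have indep (f : 'I_r -> 'cV[C]_d) : (forall j, f j \in U j) -> \sum_j f j = 0 -> f i = 0.
    by move=> fU f0; apply: (elimT directv_sum_independent dU f (fun j _ => fU j) f0).
  have [->|wi0] := eqVneq (w i) 0; first exact: mem0v.
  apply/(TP _ wi0)/(hwvP wi0); split=> [x|c].
    apply: (indep (fun j => V (X (root_row m x) (root_col (rd_col D) x)) *m w j)) => [j|].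
      by apply: stU.
    by rewrite -mulmx_sumr.
  apply/eqP; rewrite -subr_eq0; apply/eqP.
  apply: (indep (fun j => V (X (l c) (l c)) *m w j - ((xi 0 c)%:~R / 2) *: w j)) => [j|].
    by rewrite memvB ?memvZ //; apply: stU.
  by rewrite sumrB -mulmx_sumr -scaler_sumr dg subrr.
have -> : T = (\sum_i (U i :&: T))%VS.
  apply/eqP; rewrite eqEsubv; apply/andP; split; last first.
    by apply/subv_sumP => i _; apply: capvSr.
  apply/subvP => v vT; have : v \in (\sum_i U i)%VS by rewrite sumU memvf.
  move=> /memv_sumP[w wU ev]; rewrite ev; apply: memv_sumr => i _.
  rewrite memv_cap wU //=; apply: (projT w) => [j|]; first exact: wU.
  by rewrite -ev.
have dcap : directv (\sum_i (U i :&: T)).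
  apply/directv_sum_independent => us usU us0 i _.
  apply: (elimT directv_sum_independent dU us _ us0) => // j _.
  by have /memv_capP[] := usU j isT.
rewrite (directvP dcap) /=.
rewrite -sum1_card big_mkcond; apply: eq_bigr => i _.
case: ifP => [iP|niP].
  move: iP; rewrite inE => /asboolP[irri [v vU hv]]; have [v0 _ _] := hv.
  have -> : (U i :&: T)%VS = <[v]>%VS; last by rewrite dim_vline v0.
  apply/eqP; rewrite eqEsubv; apply/andP; split.
    apply/subvP => w /memv_capP[wU wT].
    have [->|w0] := eqVneq w 0; first exact: mem0v.
    by apply: (hwv_unique irri) => //; apply/(TP _ w0).
  by rewrite -memvE memv_cap vU; apply/(TP _ v0).
apply/esym/eqP; rewrite dimv_eq0 -subv0; apply/subvP => w /memv_capP[wU wT].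
rewrite memv0; apply: contraFT niP => w0; exact: (subT w).
Qed.

End HighestWeight.

End StarRepresentation.

(** * Tensor powers *)

Section Transfer.
Variables (C : numFieldType) (n m : nat) (g : pred 'M[C]_(n + m)) (V W : mxact C (n + m)).
Variables (B : 'M[C]_(act_dim W, act_dim V)) (B' : 'M[C]_(act_dim V, act_dim W)).
Hypotheses (BB' : B *m B' = 1%:M) (B'B : B' *m B = 1%:M).
Hypothesis BV : forall A, A \in g -> B *m V A = W A *m B.

Let B'W A : A \in g -> B' *m W A = V A *m B'.
Proof.
move=> gA; rewrite -[LHS]mulmx1 -BB' !mulmxA -(mulmxA B') -BV //.
by rewrite !mulmxA B'B mul1mx.
Qed.

Let fB : 'Hom('cV[C]_(act_dim V), 'cV[C]_(act_dim W)) := linfun (mulmx B).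
Let fB' : 'Hom('cV[C]_(act_dim W), 'cV[C]_(act_dim V)) := linfun (mulmx B').

Let fBE v : fB v = B *m v. Proof. exact: lfunE. Qed.
Let fB'E v : fB' v = B' *m v. Proof. exact: lfunE. Qed.

Let fBK (U : {vspace _}) : (fB' @: (fB @: U) = U)%VS.
Proof.
apply/vspaceP => v; apply/memv_imgP/idP => [[w /memv_imgP[u uU ->] ->]|vU].
  by rewrite fB'E fBE mulmxA B'B mul1mx.
exists (fB v); first exact: memv_img.
by rewrite fB'E fBE mulmxA B'B mul1mx.
Qed.

Let fB'K (U : {vspace _}) : (fB @: (fB' @: U) = U)%VS.
Proof.
apply/vspaceP => v; apply/memv_imgP/idP => [[w /memv_imgP[u uU ->] ->]|vU].
  by rewrite fB'E fBE mulmxA BB' mul1mx.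
exists (fB' v); first exact: memv_img.
by rewrite fB'E fBE mulmxA BB' mul1mx.
Qed.

Let stable_fB U : stable_sub g U -> stable_sub g (fB @: U)%VS.
Proof.
move=> stU A v gA /memv_imgP[u uU ->]; rewrite fBE mulmxA -BV // -mulmxA -fBE.
by apply: memv_img; apply: stU.
Qed.

Let stable_fB' U : stable_sub g U -> stable_sub g (fB' @: U)%VS.
Proof.
move=> stU A v gA /memv_imgP[u uU ->]; rewrite fB'E mulmxA -B'W // -mulmxA -fB'E.
by apply: memv_img; apply: stU.
Qed.

Let irr_fB' U : irreducible_sub g U -> irreducible_sub g (fB' @: U)%VS.
Proof.
move=> [stU U0 irrU]; split; first exact: stable_fB'.
  by move=> e; apply: U0; rewrite -(fB'K U) e limg0.
move=> Z stZ ZU; have ZU' : (fB @: Z <= U)%VS by rewrite -(fB'K U); apply: limgS.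
have [e|e] := irrU _ (stable_fB stZ) ZU'.
  by left; rewrite -(fBK Z) e limg0.
by right; rewrite -(fBK Z) e.
Qed.

Let hwv_fB mu v : highest_weight_vector g mu v -> highest_weight_vector g mu (fB v).
Proof.
move=> [v0 up dg]; split=> [|A gA uA|H gH dH].
- apply: contra_neq v0 => e; rewrite -[v]mul1mx -B'B -mulmxA -fBE e mulmx0.
  by [].
- by rewrite fBE mulmxA -BV // -mulmxA up // mulmx0.
by rewrite fBE mulmxA -BV // -mulmxA dg // -scalemxAr.
Qed.

Let hwv_fB' mu v : highest_weight_vector g mu v -> highest_weight_vector g mu (fB' v).
Proof.
move=> [v0 up dg]; split=> [|A gA uA|H gH dH].
- apply: contra_neq v0 => e; rewrite -[v]mul1mx -BB' -mulmxA -fB'E e mulmx0.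
  by [].
- by rewrite fB'E mulmxA -B'W // -mulmxA up // mulmx0.
by rewrite fB'E mulmxA -B'W // -mulmxA dg // -scalemxAr.
Qed.

Lemma multiplicity_transfer mu r : has_multiplicity g mu W r -> has_multiplicity g mu V r.
Proof.
move=> [k [U [P [irr [sumU dU] PE cardP]]]].
have inj : (fullv :&: lker fB' = 0)%VS.
  apply/eqP; rewrite -subv0; apply/subvP => v /memv_capP[_]; rewrite memv_ker fB'E => /eqP e.
  by rewrite memv0 -[v]mul1mx -BB' -mulmxA e mulmx0.
have dimE (Z : {vspace 'cV[C]_(act_dim W)}) : \dim (fB' @: Z) = \dim Z.
  by apply: limg_dim_eq; apply/eqP; rewrite -subv0 -inj capvS // subvf.
have sumE : (\sum_i fB' @: U i)%VS = fullv.
  rewrite -limg_sum sumU; apply/eqP; rewrite eqEsubv subvf; apply/subvP => v _.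
  by rewrite -[v]mul1mx -B'B -mulmxA -fB'E memv_img // memvf.
exists k, (fun i => (fB' @: U i)%VS), P; split=> //.
- by move=> i; apply: irr_fB'.
- split=> //; move: dU; rewrite !directvE /= sumE sumU => /eqP dU.
  rewrite (eq_bigr (fun i => \dim (U i))); last by move=> i _; apply: dimE.
  by rewrite -dU -(dimE fullv); apply/eqP; congr (\dim _); rewrite -sumU limg_sum sumE.
move=> i; rewrite PE; split=> -[_ [v vU hv]]; split.
- exact: irr_fB'.
- by exists (fB' v); [apply: memv_img | apply: hwv_fB'].
- exact: irr.
exists (fB v); last exact: hwv_fB.
by rewrite -(fB'K (U i)); apply: memv_img.
Qed.
End Transfer.

Section TensorAlgebra.
Variable C : numClosedFieldType.

Lemma tensmxDl m n p q (A A' : 'M[C]_(m, n)) (B : 'M[C]_(p, q)) :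
  (A + A') *t B = A *t B + A' *t B.
Proof. by apply/matrixP => i j; rewrite !mxE mulrDl. Qed.

Lemma tensmxDr m n p q (A : 'M[C]_(m, n)) (B B' : 'M[C]_(p, q)) :
  A *t (B + B') = A *t B + A *t B'.
Proof. by apply/matrixP => i j; rewrite !mxE mulrDr. Qed.

Lemma tensmxZl m n p q c (A : 'M[C]_(m, n)) (B : 'M[C]_(p, q)) :
  (c *: A) *t B = c *: (A *t B).
Proof. by apply/matrixP => i j; rewrite !mxE mulrA. Qed.

Lemma tensmxZr m n p q c (A : 'M[C]_(m, n)) (B : 'M[C]_(p, q)) :
  A *t (c *: B) = c *: (A *t B).
Proof. by apply/matrixP => i j; rewrite !mxE mulrCA. Qed.

Lemma adjm_tens m n p q (A : 'M[C]_(m, n)) (B : 'M[C]_(p, q)) :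
  adjm (A *t B) = adjm A *t adjm B.
Proof. by apply/matrixP => i j; rewrite !mxE rmorphM. Qed.

Lemma adjm1 m : adjm (1%:M : 'M[C]_m) = 1%:M.
Proof. by apply/matrixP => i j; rewrite !mxE rmorph_nat eq_sym. Qed.

Lemma diag_tens m n (u : 'rV[C]_m) (v : 'rV[C]_n) :
  diag_mx u *t 1%:M + 1%:M *t diag_mx v =
  diag_mx (\row_t (u 0 (mxtens_unindex t).1 + v 0 (mxtens_unindex t).2)).
Proof.
apply/matrixP => i j; case: (mxtens_indexP i) (mxtens_indexP j) => i1 i2 [j1 j2].
have idx : (mxtens_index (i1, i2) == mxtens_index (j1, j2)) = (i1 == j1) && (i2 == j2).
  by rewrite (can_eq (@mxtens_indexK _ _)) xpair_eqE.
rewrite mxE !tensmxE [in RHS]mxE !idx [in RHS]mxE mxtens_indexK /= !mxE.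
by case: eqP => _; case: eqP => _; rewrite ?(mulr1n, mulr0n) /= ?(mulr1, mul1r, mulr0, mul0r, addr0).
Qed.

Lemma tens1 m n : (1%:M : 'M[C]_m) *t (1%:M : 'M[C]_n) = 1%:M.
Proof.
apply/matrixP => i j; case: (mxtens_indexP i) (mxtens_indexP j) => i1 i2 [j1 j2].
rewrite tensmxE !mxE (can_eq (@mxtens_indexK _ _)) xpair_eqE.
by case: eqP => _; case: eqP => _; rewrite /= ?(mulr1, mulr0, mul0r).
Qed.

Variables (N : nat) (g : pred 'M[C]_N).

Lemma tens_rep (V W : mxact C N) : is_rep g V -> is_rep g W -> is_rep g (tens_act V W).
Proof.
move=> [linV brV] [linW brW]; split=> [a A B gA gB|A B gA gB] /=.
  rewrite linV // linW // tensmxDl tensmxDr tensmxZl tensmxZr scalerDr.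
  by rewrite addrACA.
rewrite brV // brW // /lie_bracket !(mulmxDl, mulmxDr) !tensmx_mul !(mul1mx, mulmx1).
rewrite tensmxDl tensmxDr -!scaleN1r tensmxZl tensmxZr !scaleN1r.
move: (_ *t _) (_ *t _) (_ *t _) (_ *t _) => a b c e.
move: (_ *t _) (_ *t _) => x y.
by apply/matrixP => i j; rewrite !mxE; ring.
Qed.

Lemma triv_rep : is_rep g (triv_act C N).
Proof.
split=> [a A B _ _|A B _ _] /=; first by rewrite scaler0 addr0.
by rewrite /lie_bracket mulmx0 subrr.
Qed.

Section Intertwiner.
Variables (V W : mxact C N) (B : 'M[C]_(act_dim W, act_dim V)).
Variables (B' : 'M[C]_(act_dim V, act_dim W)).
Hypotheses (BB' : B *m B' = 1%:M) (B'B : B' *m B = 1%:M).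
Hypothesis BV : forall A, A \in g -> B *m V A = W A *m B.

Lemma tens_pow_intertwiner k : exists (Bk : 'M[C]_(act_dim (tens_pow W k), act_dim (tens_pow V k)))
  (Bk' : 'M[C]_(act_dim (tens_pow V k), act_dim (tens_pow W k))),
  [/\ Bk *m Bk' = 1%:M, Bk' *m Bk = 1%:M &
   forall A, A \in g -> Bk *m tens_pow V k A = tens_pow W k A *m Bk].
Proof.
elim: k => [|k [Bk [Bk' [e1 e2 e3]]]].
  by exists 1%:M, 1%:M; split=> [||A _] /=; rewrite ?mulmx1 ?mulmx0 ?mul0mx.
exists (B *t Bk), (B' *t Bk'); split=> [||A gA] /=.
- by rewrite tensmx_mul BB' e1 tens1.
- by rewrite tensmx_mul B'B e2 tens1.
by rewrite mulmxDr mulmxDl !tensmx_mul BV // e3 // !(mulmx1, mul1mx).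
Qed.
End Intertwiner.
End TensorAlgebra.

Fixpoint walks (E : finType) (w : E -> int) (k : nat) (u : int) : nat :=
  if k is k'.+1 then (\sum_(e : E) walks w k' (u - w e))%N else (u == 0).

Section StarWeights.
Variables (C : numClosedFieldType) (n m h : nat) (g : pred 'M[C]_(n + m)).
Variable D : root_datum h g.
Local Notation X := (Xmx (rd_sign D)).
Local Notation l := (lshift m).

Definition star_weights (V : mxact C (n + m)) (wt : 'I_(act_dim V) -> 'rV[int]_n) :=
  [/\ is_rep g V, forall i j, adjm (V (X i j)) = V (X j i) &
   forall c, V (X (l c) (l c)) = diag_mx (\row_t ((wt t 0 c)%:~R / 2))].

Lemma tens_star_weights (V W : mxact C (n + m)) wtV wtW :
  star_weights wtV -> star_weights wtW ->
  star_weights (V := tens_act V W)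
    (fun t => wtV (mxtens_unindex t).1 + wtW (mxtens_unindex t).2).
Proof.
move=> [repV starV dgV] [repW starW dgW]; split=> [|i j|c] /=.
- exact: tens_rep.
- by rewrite adjmD !adjm_tens !adjm1 starV starW.
rewrite dgV dgW diag_tens; congr diag_mx; apply/rowP => t.
by rewrite !mxE rmorphD mulrDl.
Qed.

Lemma triv_star_weights : star_weights (V := triv_act C (n + m)) (fun _ => 0).
Proof.
split=> [|i j|c] /=; first exact: triv_rep.
  by apply/matrixP => x y; rewrite !mxE conjC0.
by apply/matrixP => x y; rewrite !mxE mul0r mul0rn.
Qed.

Lemma card_tens_weight (a b : nat) (wtV : 'I_a -> 'rV[int]_n) (wtW : 'I_b -> 'rV[int]_n) z :
  #|[set t : 'I_(a * b) | wtV (mxtens_unindex t).1 + wtW (mxtens_unindex t).2 == z]| =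
  (\sum_(t : 'I_a) #|[set u | wtW u == (z - wtV t)%R]|)%N.
Proof.
rewrite -sum1_card (eq_bigl (fun t : 'I_(a * b) =>
  wtV (mxtens_unindex t).1 + wtW (mxtens_unindex t).2 == z)); last by move=> t; rewrite inE.
rewrite (reindex (@mxtens_index a b)); last first.
  by exists (@mxtens_unindex a b) => x _; [apply: mxtens_indexK | apply: mxtens_unindexK].
rewrite (eq_bigl (fun p : 'I_a * 'I_b => wtV p.1 + wtW p.2 == z)); last first.
  by move=> p; rewrite mxtens_indexK.
rewrite -(pair_big_dep xpredT (fun i j => wtV i + wtW j == z) (fun _ _ => 1%N)).
apply: eq_bigr => t _; rewrite /= sum1_card; apply: eq_card => u.
by rewrite !inE unfold_in /= [RHS]eq_sym subr_eq eq_sym addrC.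
Qed.

(** By [phi] the coordinates of a weight of V range independently over the steps, hence so do those
    of a sum of k weights. *)
Lemma tens_pow_star_weights (E : finType) (w : E -> int) (V : mxact C (n + m)) wt
    (phi : 'I_(act_dim V) -> {ffun 'I_n -> E}) k :
  star_weights wt -> bijective phi -> (forall t i, wt t 0 i = w (phi t i)) ->
  exists wtk, star_weights (V := tens_pow V k) wtk /\
    forall z, #|[set t | wtk t == z]| = (\prod_i walks w k (z 0%R i))%N.
Proof.
move=> swV bij wtE; elim: k => [|k [wtk [swk cardk]]].
  exists (fun _ => 0); split; first exact: triv_star_weights.
  move=> z; have [->|z0] := eqVneq z 0.
    rewrite big1; last by move=> i _ /=; rewrite mxE eqxx.
    by rewrite cardsE -[RHS](card_ord 1); apply: eq_card => t; rewrite unfold_in.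
  have [i zi] : exists i, z 0 i != 0.
    apply/existsP; apply: contra_neqT z0 => /existsPn e; apply/rowP => i.
    by rewrite mxE; apply/eqP; rewrite -[_ == _]negbK e.
  rewrite (bigD1 i) //= (negbTE zi) mul0n cardsE; apply: eq_card0 => t.
  by rewrite unfold_in.
eexists; split; first exact: (tens_star_weights swV swk).
move=> z; rewrite card_tens_weight.
rewrite (eq_bigr (fun t => (\prod_i walks w k (z 0%R i - w (phi t i))%R)%N)); last first.
  by move=> t _; rewrite cardk; apply: eq_bigr => i _; rewrite !mxE wtE.
rewrite bigA_distr_bigA /=; case: bij => psi phiK psiK.
rewrite (reindex psi) /=; last by exists phi => x _; [apply: psiK | apply: phiK].
by apply: eq_bigr => f _; rewrite psiK.
Qed.
End StarWeights.

(** * Root data of so_(2n+1) and sp_(2n) *)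

Section FormAlgebra.
Variables (C : numFieldType) (M : nat) (s : 'I_M -> C).
Hypothesis s_sq : forall i, s i * s i = 1.
Hypothesis s_rev : forall i j, s (rev_ord i) * s (rev_ord j) = s i * s j.

Lemma form_algebraE (A : 'M[C]_M) :
  A \in form_algebra (\matrix_(i, j) if j == rev_ord i then s i else 0) <->
  (forall i j, A i j = - (s i * s j * A (rev_ord j) (rev_ord i))).
Proof.
have eqE i j : (A^T *m (\matrix_(i, j) if j == rev_ord i then s i else 0) +
    (\matrix_(i, j) if j == rev_ord i then s i else 0) *m A) i j =
    A (rev_ord j) i * s (rev_ord j) + s i * A (rev_ord i) j.
  rewrite !mxE (bigD1 (rev_ord j)) //= !mxE rev_ordK eqxx big1 ?addr0 => [|k ne]; last first.
    rewrite !mxE; have -> : (j == rev_ord k) = false.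
      by apply: contraNF ne => /eqP->; rewrite rev_ordK.
    by rewrite mulr0.
  rewrite (bigD1 (rev_ord i)) //= !mxE eqxx big1 ?addr0 => [|k ne] //.
  by rewrite !mxE (negbTE ne) mul0r.
split=> [/eqP e i j|e].
  have := congr1 (fun B : 'M[C]_M => B (rev_ord i) j) e; rewrite eqE !mxE rev_ordK => e'.
  have {e'} : s (rev_ord i) * A i j = - (A (rev_ord j) (rev_ord i) * s (rev_ord j)).
    by apply/eqP; rewrite -addr_eq0 addrC e'.
  move/(congr1 ( *%R (s (rev_ord i)))); rewrite mulrA s_sq mul1r => ->.
  by rewrite -s_rev; ring.
apply/eqP/matrixP => i j; rewrite eqE mxE [A (rev_ord i) j]e rev_ordK.
have -> : s (rev_ord i) * s j = s i * s (rev_ord j) by rewrite -[LHS]s_rev rev_ordK.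
by rewrite mulrN !mulrA s_sq mul1r mulrC subrr.
Qed.
End FormAlgebra.

Section RootSum.
Variables (C : numFieldType) (n m : nat) (W : lmodType C).
Variables (f : 'I_(n + m) -> 'I_(n + m) -> W).
Local Notation l := (lshift m).
Local Notation r a := (rev_ord (lshift m a)).

Lemma sum_pairs_diag (P Q : 'I_n * 'I_n -> W) :
  \sum_x (if x.1 == x.2 then Q x else P x) =
  \sum_a Q (a, a) + \sum_(a < n) \sum_(b < n | (a < b)%N) (P (a, b) + P (b, a)).
Proof.
rewrite (eq_bigr (fun x => if x.1 == x.2 then Q (x.1, x.2) else P (x.1, x.2))) => [|[]] //.
rewrite -(pair_bigA _ (fun a b => if a == b then Q (a, b) else P (a, b))) /= big_pairs_split /=.
congr (_ + _); first by apply: eq_bigr => a _; rewrite eqxx.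
apply: eq_bigr => a _; apply: eq_bigr => b lt.
by rewrite -!(inj_eq val_inj) (ltn_eqF lt) (gtn_eqF lt).
Qed.

Hypothesis fE : forall i j, f (rev_ord j) (rev_ord i) = f i j.

(** By [fE] each root vector off the antidiagonal occurs twice in the full sum, those at the places
    (a, rev a) only once; this is the origin of the coefficients 4 and 2. *)
Lemma sum_root_pairs jd :
  2 *: (\sum_a \sum_b (f (l a) (l b) + f (l a) (r b) + f (r a) (l b) + f (r a) (r b))) =
  4 *: (\sum_a f (l a) (l a)) + (2 *: (\sum_a (f (l a) (r a) + f (r a) (l a))) +
  \sum_(a < n) \sum_(b < n | (a < b)%N)
    (4 *: (f (root_row m (a, b)) (root_col jd (a, b)) + f (root_col jd (a, b)) (root_row m (a, b))) +
     4 *: (f (root_row m (b, a)) (root_col jd (b, a)) + f (root_col jd (b, a)) (root_row m (b, a))))).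
Proof.
have four x : 4 *: x = 2 *: x + 2 *: x :> W by rewrite -scalerDl -natrD.
rewrite big_pairs_split scalerDr addrA; congr (_ + _).
  rewrite !scaler_sumr -big_split; apply: eq_bigr => a _ /=.
  rewrite fE; move: (f (l a) (l a)) (f (l a) (r a)) (f (r a) (l a)) => p q t.
  by rewrite four !scalerDr [LHS](AC (1*1*1*1) (1*4*(2*3))).
rewrite scaler_sumr; apply: eq_bigr => a _.
rewrite scaler_sumr; apply: eq_bigr => b lt.
rewrite /root_row /root_col /= -!(inj_eq val_inj) /= lt (ltn_eqF lt) (gtn_eqF lt).
rewrite ltnNge (ltnW lt) /= !fE.
have e : f (l b) (r a) = f (l a) (r b) by rewrite -fE rev_ordK.
have e' : f (r b) (l a) = f (r a) (l b) by rewrite -fE rev_ordK.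
rewrite e e'; move: (f _ _) (f _ _) (f _ _) (f _ _) => p q t u.
rewrite !four !scalerDr.
by rewrite [LHS](AC (4*4) ((1*4)*(8*5)*((2*3)*(6*7)))).
Qed.
End RootSum.

Section SumOrd.
Variables (W : nmodType) (n : nat).

Lemma sum_ord_even (f : 'I_(n + n) -> W) :
  \sum_i f i = \sum_a (f (lshift n a) + f (rev_ord (lshift n a))).
Proof.
rewrite big_split_ord big_split /=; congr (_ + _).
rewrite (reindex_inj rev_ord_inj); apply: eq_bigr => a _; congr (f _).
by apply: val_inj => /=; have := ltn_ord a; lia.
Qed.

Definition middle : 'I_(n + n.+1) := rshift n ord0.

Lemma sum_ord_odd (f : 'I_(n + n.+1) -> W) :
  \sum_i f i = \sum_a (f (lshift n.+1 a) + f (rev_ord (lshift n.+1 a))) + f middle.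
Proof.
rewrite big_split_ord big_split /= big_ord_recl -addrA; congr (_ + _).
rewrite addrC; congr (_ + _).
rewrite (reindex_inj rev_ord_inj); apply: eq_bigr => a _; congr (f _).
by apply: val_inj => /=; rewrite /bump /=; have := ltn_ord a; lia.
Qed.

End SumOrd.

Section OrdCases.
Variable n : nat.

Lemma rev_middle : rev_ord (middle n) = middle n.
Proof. by apply: val_inj => /=; lia. Qed.

Lemma ord_even_cases (i : 'I_(n + n)) :
  exists c, i = lshift n c \/ i = rev_ord (lshift n c).
Proof.
have [lt|ge] := ltnP i n; first by exists (Ordinal lt); left; apply: val_inj.
have lt : (n + n - i.+1 < n)%N by have := ltn_ord i; lia.
by exists (Ordinal lt); right; apply: val_inj => /=; have := ltn_ord i; lia.
Qed.

Lemma ord_odd_cases (i : 'I_(n + n.+1)) :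
  (exists c, i = lshift n.+1 c \/ i = rev_ord (lshift n.+1 c)) \/ i = middle n.
Proof.
case: (ltngtP i n) => [lt|gt|e]; last by right; apply: val_inj; rewrite /= e addn0.
  by left; exists (Ordinal lt); left; apply: val_inj.
have lt : (n + n.+1 - i.+1 < n)%N by have := ltn_ord i; lia.
by left; exists (Ordinal lt); right; apply: val_inj => /=; have := ltn_ord i; lia.
Qed.
End OrdCases.

Section RootData.
Variables (C : numFieldType) (n : nat).

Section Upper.
Variables (m : nat) (s : 'I_(n + m) -> C) (jd : 'I_n -> 'I_(n + m)).
Hypothesis s_sq : forall i, s i * s i = 1.
Hypothesis s_rev : forall i j, s (rev_ord i) * s (rev_ord j) = s i * s j.

Definition root_multiple (i j : 'I_(n + m)) := Xmx s i j = 0 \/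
  exists x c, Xmx s i j = c *: Xmx s (root_row m x) (root_col jd x).

Lemma root_multiple_rev i j : root_multiple i j -> root_multiple (rev_ord j) (rev_ord i).
Proof.
rewrite /root_multiple (Xmx_rev s_sq s_rev) => -[->|[x [c ->]]]; first by left; rewrite scaler0.
by right; exists x, (- (s i * s j) * c); rewrite scalerA.
Qed.

Lemma root_multiple_row x : root_multiple (root_row m x) (root_col jd x).
Proof. by right; exists x, 1; rewrite scale1r. Qed.

Lemma root_multiple_ll (a b : 'I_n) : (a < b)%N -> root_multiple (lshift m a) (lshift m b).
Proof.
move=> lt; have := root_multiple_row (a, b).
by rewrite /root_row /root_col /= -(inj_eq val_inj) (ltn_eqF lt) lt.
Qed.

Lemma root_multiple_lr (a b : 'I_n) : a != b ->
  root_multiple (lshift m a) (rev_ord (lshift m b)).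
Proof.
move=> ne; wlog lt : a b ne / (b < a)%N.
  move=> th; case: (ltngtP b a) => [|lt|/val_inj e]; first exact: th.
    by rewrite -[lshift m a]rev_ordK; apply/root_multiple_rev/th; rewrite // eq_sym.
  by rewrite e eqxx in ne.
have := root_multiple_row (a, b).
by rewrite /root_row /root_col /= (negbTE ne) ltnNge (ltnW lt).
Qed.
End Upper.

Let sign_odd (i : 'I_(n + n.+1)) : C := 1.
Let sign_even (i : 'I_(n + n)) : C := (-1) ^+ (n <= i)%N.
Let jd_odd (a : 'I_n) := middle n.
Let jd_even (a : 'I_n) : 'I_(n + n) := rev_ord (lshift n a).

Let sq_odd i : sign_odd i * sign_odd i = 1. Proof. exact: mulr1. Qed.
Let sq_even i : sign_even i * sign_even i = 1.
Proof. by rewrite /sign_even -expr2 sqrr_sign. Qed.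
Let rev_odd i j : sign_odd (rev_ord i) * sign_odd (rev_ord j) = sign_odd i * sign_odd j.
Proof. by []. Qed.
Let rev_evenN i : sign_even (rev_ord i) = - sign_even i.
Proof.
rewrite /sign_even /=; have -> : (n <= n + n - i.+1)%N = ~~ (n <= i)%N.
  by have := ltn_ord i; case: leqP; case: leqP => //=; lia.
by case: (n <= i)%N; rewrite ?opprK.
Qed.
Let rev_even i j : sign_even (rev_ord i) * sign_even (rev_ord j) = sign_even i * sign_even j.
Proof. by rewrite !rev_evenN mulrNN. Qed.

Lemma l_neq_middle (a : 'I_n) : (lshift n.+1 a == middle n) = false.
Proof. by apply/eqP => /(congr1 val) /=; have := ltn_ord a; lia. Qed.

Lemma rev_neq_middle (a : 'I_n) : (rev_ord (lshift n.+1 a) == middle n) = false.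
Proof. by rewrite -rev_middle (inj_eq rev_ord_inj) l_neq_middle. Qed.

Lemma ltn_l_rev m (a b : 'I_n) : (n <= m)%N -> (lshift m a < rev_ord (lshift m b))%N.
Proof. by move=> /=; have := ltn_ord a; have := ltn_ord b; lia. Qed.

Let odd_rev0 i : Xmx sign_odd i (rev_ord i) = 0.
Proof.
have := Xmx_rev sq_odd rev_odd i (rev_ord i); rewrite rev_ordK /sign_odd mulr1 scaleN1r.
by move/eqP; rewrite -addr_eq0 -mulr2n -scaler_nat scaler_eq0 pnatr_eq0 => /eqP.
Qed.

Let mem_odd (A : 'M[C]_(n + n.+1)) : A \in so_odd C n <->
  (forall i j, A i j = - (sign_odd i * sign_odd j * A (rev_ord j) (rev_ord i))).
Proof.
rewrite -(form_algebraE sq_odd rev_odd) /so_odd.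
have -> : (\matrix_(i, j) (j == rev_ord i)%:R : 'M[C]_(n + n.+1)) =
  \matrix_(i, j) if j == rev_ord i then sign_odd i else 0 => //.
by apply/matrixP => i j; rewrite !mxE; case: eqP.
Qed.

Let root_odd (a : 'I_n) : (1.*2)%:Z *: delta_mx 0 a =
  2 *: (coord_weight (lshift n.+1 a) - coord_weight (jd_odd a)).
Proof.
congr (_ *: _); apply/rowP => c; rewrite !mxE eqxx /= /jd_odd.
rewrite [middle n == lshift _ _]eq_sym l_neq_middle [middle n == rev_ord _]eq_sym rev_neq_middle !subr0.
have -> : (lshift n.+1 a == rev_ord (lshift n.+1 c)) = false.
  by apply/eqP => e; have := @ltn_l_rev n.+1 a c (leqnSn _); rewrite e ltnn.
by rewrite (inj_eq (@lshift_inj _ _)) [c == a]eq_sym subr0.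
Qed.

Let opp_odd x : root_col jd_odd x = rev_ord (root_row n.+1 x) ->
    sign_odd (root_row n.+1 x) * sign_odd (root_col jd_odd x) = -1.
Proof.
rewrite /root_col /root_row /jd_odd; case: eqP => [_ /eqP|ne].
  by rewrite eq_sym rev_neq_middle.
case: ifP => _ e.
  by have := @ltn_l_rev n.+1 x.2 x.1 (leqnSn _); rewrite e ltnn.
by case: ne; apply/(@lshift_inj n n.+1)/rev_ord_inj.
Qed.

Let coord_odd (i : 'I_(n + n.+1)) :
    (exists c, i = lshift n.+1 c \/ i = rev_ord (lshift n.+1 c)) \/
    (rev_ord i = i /\ forall c : 'I_n, i != lshift n.+1 c).
Proof.
case: (ord_odd_cases i) => [|->]; [by left | right; split; first exact: rev_middle].
by move=> c; rewrite eq_sym l_neq_middle.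
Qed.

Let upper_odd (i j : 'I_(n + n.+1)) : (i < j)%N -> root_multiple sign_odd jd_odd i j.
Proof.
have lm a : root_multiple sign_odd jd_odd (lshift n.+1 a) (middle n).
  have := root_multiple_row sign_odd jd_odd (a, a).
  by rewrite /root_row /root_col /= eqxx.
case: (ord_odd_cases i) => [[a [->|->]]|->]; case: (ord_odd_cases j) => [[b [->|->]]|->] lt.
- exact: root_multiple_ll.
- have [<-|ne] := eqVneq a b; last exact: root_multiple_lr.
  by left; apply: odd_rev0.
- exact: lm.
- by have := ltn_trans lt (@ltn_l_rev n.+1 b a (leqnSn _)); rewrite ltnn.
- apply: root_multiple_rev => //; apply: root_multiple_ll.
  by move: lt => /=; have := ltn_ord a; have := ltn_ord b; lia.
- by move: lt => /=; have := ltn_ord a; lia.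
- by move: lt => /=; have := ltn_ord b; lia.
- by rewrite -rev_middle; apply: root_multiple_rev.
- by rewrite ltnn in lt.
Qed.

Let sum_odd (W : lmodType C) (f : 'I_(n + n.+1) -> 'I_(n + n.+1) -> W) :
    (forall i j, f (rev_ord j) (rev_ord i) = f i j) ->
    (forall i j, Xmx sign_odd i j = 0 -> f i j = 0) ->
    2 *: \sum_i \sum_j f i j = 4 *: (\sum_a f (lshift n.+1 a) (lshift n.+1 a)) +
      \sum_x (4 / root_mult jd_odd C x) *:
        (f (root_row n.+1 x) (root_col jd_odd x) + f (root_col jd_odd x) (root_row n.+1 x)).
Proof.
move=> fE f0.
have fr0 a : f a (rev_ord a) = 0 by apply/f0/odd_rev0.
have mult1 x : root_mult jd_odd C x = 1.
  rewrite /root_mult; case: eqP => // /opp_odd; rewrite /sign_odd mulr1.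
  by move/eqP; rewrite -addr_eq0 -(natrD _ 1 1) pnatr_eq0.
rewrite [X in _ = _ + X](eq_bigr (fun x : 'I_n * 'I_n => if x.1 == x.2 then
    4 *: (f (lshift n.+1 x.1) (middle n) + f (middle n) (lshift n.+1 x.1)) else
    4 *: (f (root_row n.+1 x) (root_col jd_odd x) + f (root_col jd_odd x) (root_row n.+1 x))));
  last by move=> x _; rewrite mult1 divr1 /root_row /root_col; case: eqP.
rewrite sum_pairs_diag /= -scaler_sumr.
have := sum_root_pairs fE jd_odd.
rewrite [\sum_a (f _ (rev_ord _) + _)]big1 => [|a _]; last first.
  by rewrite fr0 -{2}[lshift n.+1 a]rev_ordK fr0 addr0.
rewrite scaler0 add0r => e; rewrite addrCA -e.
have -> : \sum_i \sum_j f i j = \sum_a \sum_b (f (lshift n.+1 a) (lshift n.+1 b) +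
    f (lshift n.+1 a) (rev_ord (lshift n.+1 b)) + f (rev_ord (lshift n.+1 a)) (lshift n.+1 b) +
    f (rev_ord (lshift n.+1 a)) (rev_ord (lshift n.+1 b))) +
   2 *: (\sum_a (f (lshift n.+1 a) (middle n) + f (middle n) (lshift n.+1 a))).
  have mid a : f (rev_ord a) (middle n) = f (middle n) a by rewrite -fE rev_ordK rev_middle.
  have mid' a : f (middle n) (rev_ord a) = f a (middle n) by rewrite -mid rev_ordK.
  have fmm : f (middle n) (middle n) = 0 by rewrite -{2}rev_middle fr0.
  rewrite sum_ord_odd [\sum_j f (middle n) j]sum_ord_odd.
  rewrite fmm addr0 -big_split scaler_sumr -big_split; apply: eq_bigr => a _ /=.
  rewrite !sum_ord_odd mid mid' [X in X + _]addrACA -big_split -addrA; congr (_ + _).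
    by apply: eq_bigr => b _ /=; rewrite addrA.
  by rewrite scaler_nat mulr2n [X in _ + X]addrC.
rewrite scalerDr scalerA -natrM; exact: addrC.
Qed.

(** Kept transparent: the spinor representation computes with its signs, all 1. *)
Definition so_root_datum : root_datum 1 (so_odd C n).
Proof.
refine (RootDatum (rd_sign := sign_odd) (rd_col := jd_odd) _ sq_odd rev_odd mem_odd _ _ root_odd opp_odd coord_odd
  upper_odd sum_odd) => //.
- by move=> a b; apply: ltn_l_rev.
- by move=> a /=; rewrite addn0.
Defined.

Let mem_even (A : 'M[C]_(n + n)) : A \in sp_even C n <->
  (forall i j, A i j = - (sign_even i * sign_even j * A (rev_ord j) (rev_ord i))).
Proof. by rewrite -(form_algebraE sq_even rev_even). Qed.

Let root_even (a : 'I_n) : (2.*2)%:Z *: delta_mx 0 a =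
  2 *: (coord_weight (lshift n a) - coord_weight (jd_even a)).
Proof.
apply/rowP => c; rewrite !mxE eqxx /= /jd_even.
rewrite (inj_eq rev_ord_inj) !(inj_eq (@lshift_inj _ _)) [c == a]eq_sym.
have ne (b b' : 'I_n) : (lshift n b == rev_ord (lshift n b')) = false.
  by apply/eqP => e; have := @ltn_l_rev n b b' (leqnn _); rewrite e ltnn.
by rewrite [rev_ord _ == lshift _ _]eq_sym !ne; case: eqP.
Qed.

Let opp_even x : root_col jd_even x = rev_ord (root_row n x) ->
    sign_even (root_row n x) * sign_even (root_col jd_even x) = -1.
Proof. by move=> ->; rewrite rev_evenN mulrN sq_even. Qed.

Let coord_even (i : 'I_(n + n)) :
    (exists c, i = lshift n c \/ i = rev_ord (lshift n c)) \/
    (rev_ord i = i /\ forall c : 'I_n, i != lshift n c).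
Proof. by left; apply: ord_even_cases. Qed.

Let upper_even (i j : 'I_(n + n)) : (i < j)%N -> root_multiple sign_even jd_even i j.
Proof.
case: (ord_even_cases i) => a [->|->]; case: (ord_even_cases j) => b [->|->] lt.
- exact: root_multiple_ll.
- have [<-|ne] := eqVneq a b; last exact: root_multiple_lr.
  have := root_multiple_row sign_even jd_even (a, a).
  by rewrite /root_row /root_col /= eqxx.
- by have := ltn_trans lt (@ltn_l_rev n b a (leqnn _)); rewrite ltnn.
apply: root_multiple_rev => //; apply: root_multiple_ll.
by move: lt => /=; have := ltn_ord a; have := ltn_ord b; lia.
Qed.

Let sum_even (W : lmodType C) (f : 'I_(n + n) -> 'I_(n + n) -> W) :
    (forall i j, f (rev_ord j) (rev_ord i) = f i j) ->
    (forall i j, Xmx sign_even i j = 0 -> f i j = 0) ->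
    2 *: \sum_i \sum_j f i j = 4 *: (\sum_a f (lshift n a) (lshift n a)) +
      \sum_x (4 / root_mult jd_even C x) *:
        (f (root_row n x) (root_col jd_even x) + f (root_col jd_even x) (root_row n x)).
Proof.
move=> fE _.
rewrite (eq_bigr (fun x : 'I_n * 'I_n => if x.1 == x.2 then
    2 *: (f (lshift n x.1) (rev_ord (lshift n x.1)) + f (rev_ord (lshift n x.1)) (lshift n x.1)) else
    4 *: (f (root_row n x) (root_col jd_even x) + f (root_col jd_even x) (root_row n x)))); last first.
  move=> x _; rewrite /root_mult /root_row /root_col; case: (x.1 =P x.2) => [_|ne].
    by rewrite /jd_even eqxx (_ : 4 / 2 = 2 :> C) //; field.
  case: (x.1 < x.2)%N.
    case: (_ =P rev_ord _) => [e|_]; last by rewrite divr1.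
    by have := @ltn_l_rev n x.2 x.1 (leqnn _); rewrite e ltnn.
  case: (_ =P rev_ord _) => [e|_]; last by rewrite divr1.
  by case: ne; apply/(@lshift_inj n n)/rev_ord_inj.
rewrite sum_pairs_diag /= -scaler_sumr -sum_root_pairs //; congr (_ *: _).
rewrite sum_ord_even; apply: eq_bigr => a _; rewrite !sum_ord_even -big_split.
by apply: eq_bigr => b _ /=; rewrite addrA.
Qed.

Definition sp_root_datum : root_datum 2 (sp_even C n).
Proof.
refine (RootDatum (rd_sign := sign_even) (rd_col := jd_even) _ sq_even rev_even mem_even _ _ root_even opp_even
  coord_even upper_even sum_even) => //.
- by move=> a b; apply: ltn_l_rev.
- by move=> a; apply: ltn_l_rev.
Defined.
End RootData.

(** * Exterior and spinor representations *)

Section Bilinear.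
Variables (C : numClosedFieldType) (N d : nat) (p m : 'I_N -> 'M[C]_d).

Definition bilin (X : 'M[C]_N) : 'M[C]_d := \sum_i \sum_j X i j *: (p i *m m j).

Lemma bilinD a X Y : bilin (a *: X + Y) = a *: bilin X + bilin Y.
Proof.
rewrite scaler_sumr -big_split; apply: eq_bigr => i _ /=.
rewrite scaler_sumr -big_split; apply: eq_bigr => j _ /=.
by rewrite !mxE scalerDl scalerA.
Qed.

Lemma bilin_delta i j : bilin (delta_mx i j) = p i *m m j.
Proof.
rewrite /bilin (bigD1 i) //= [X in _ + X]big1 ?addr0 => [|i' ne]; last first.
  by rewrite big1 // => j' _; rewrite mxE (negbTE ne) scale0r.
rewrite (bigD1 j) //= mxE !eqxx scale1r big1 ?addr0 // => j' ne.
by rewrite mxE (negbTE ne) andbF scale0r.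
Qed.

(** If X acts on the [p k] as on basis vectors and on the [m k] as on the dual basis, then by the
    Leibniz rule [p i *m m j] behaves like a matrix unit. It is applied to fermions and to Clifford
    generators. *)
Lemma bilin_bracket X Y :
  (forall k, lie_bracket (bilin X) (p k) = \sum_i X i k *: p i) ->
  (forall k, lie_bracket (bilin X) (m k) = - \sum_j X k j *: m j) ->
  lie_bracket (bilin X) (bilin Y) = bilin (lie_bracket X Y).
Proof.
move=> Xp Xm; rewrite /lie_bracket.
have dbr i j : bilin X *m (p i *m m j) - (p i *m m j) *m bilin X =
    \sum_k X k i *: (p k *m m j) - \sum_k X j k *: (p i *m m k).
  have -> : bilin X *m (p i *m m j) - (p i *m m j) *m bilin X =
      lie_bracket (bilin X) (p i) *m m j + p i *m lie_bracket (bilin X) (m j).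
    rewrite /lie_bracket mulmxBl mulmxBr !mulmxA addrA.
    by rewrite -[in RHS](addrA (_ *m _)) addNr addr0.
  rewrite Xp Xm mulmxN mulmx_suml mulmx_sumr.
  by congr (_ - _); apply: eq_bigr => k _; rewrite -?scalemxAl -?scalemxAr.
rewrite {2}/bilin mulmx_sumr [X in _ - X]mulmx_suml -sumrB.
rewrite (eq_bigr (fun i => \sum_j (Y i j *: \sum_k X k i *: (p k *m m j)
   - Y i j *: \sum_k X j k *: (p i *m m k)))); last first.
  move=> i _; rewrite mulmx_sumr mulmx_suml -sumrB; apply: eq_bigr => j _.
  by rewrite -scalemxAr -scalemxAl -scalerBr dbr scalerBr.
under eq_bigr do rewrite sumrB.
rewrite sumrB; have -> : bilin (X *m Y - Y *m X) = bilin (X *m Y) - bilin (Y *m X).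
  by rewrite [X *m Y - _]addrC -scaleN1r bilinD scaleN1r addrC.
congr (_ - _).
  rewrite exchange_big /= /bilin [RHS]exchange_big /=; apply: eq_bigr => j _.
  under eq_bigr do rewrite scaler_sumr.
  rewrite exchange_big; apply: eq_bigr => k _ /=.
  rewrite mxE scaler_suml; apply: eq_bigr => i _; by rewrite scalerA mulrC.
rewrite /bilin; apply: eq_bigr => i _.
under eq_bigr do rewrite scaler_sumr.
rewrite exchange_big; apply: eq_bigr => k _ /=.
by rewrite mxE scaler_suml; apply: eq_bigr => j _; rewrite scalerA.
Qed.

Lemma adjm_bilin X : (forall i j, adjm (p i *m m j) = p j *m m i) -> adjm (bilin X) = bilin (adjm X).
Proof.
move=> e; rewrite /bilin adjm_sum [RHS]exchange_big; apply: eq_bigr => i _.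
by rewrite adjm_sum; apply: eq_bigr => j _; rewrite adjmZ e !mxE.
Qed.

Lemma bilin_bracketE X z :
  lie_bracket (bilin X) z = \sum_i \sum_j X i j *:
    (p i *m (m j *m z + z *m m j) - (p i *m z + z *m p i) *m m j).
Proof.
rewrite /lie_bracket /bilin mulmx_suml mulmx_sumr -sumrB; apply: eq_bigr => i _.
rewrite mulmx_suml mulmx_sumr -sumrB; apply: eq_bigr => j _.
rewrite -scalemxAl -scalemxAr -scalerBr mulmxDr mulmxDl !mulmxA; congr (_ *: _).
by rewrite opprD addrA addrK.
Qed.

End Bilinear.

Section Fermions.
Variables (C : numClosedFieldType) (d : nat).
Local Notation fock := #|{: {set 'I_d}}|.

Definition toggle (i : 'I_d) (U : {set 'I_d}) : {set 'I_d} := [set x | (x == i) (+) (x \in U)].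

Lemma in_toggle x i U : (x \in toggle i U) = (x == i) (+) (x \in U).
Proof. by rewrite inE. Qed.

Lemma toggleK i : involutive (toggle i).
Proof. by move=> U; apply/setP => x; rewrite !in_toggle addbA addbb. Qed.

Lemma toggleC i j U : toggle i (toggle j U) = toggle j (toggle i U).
Proof. by apply/setP => x; rewrite !in_toggle addbCA. Qed.

(** The Jordan-Wigner sign. As k is a natural number, k = d is allowed and gives the parity of the
    cardinal of U. *)
Definition fsign (k : nat) (U : {set 'I_d}) : C := \prod_(x in U) (-1) ^+ (x < k)%N.

Lemma fsign_toggle k j U : fsign k (toggle j U) = (-1) ^+ (j < k)%N * fsign k U.
Proof.
rewrite /fsign big_mkcond [in RHS]big_mkcond (bigD1 j) //= [in RHS](bigD1 j) //= in_toggle eqxx.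
rewrite mulrA; congr (_ * _); last first.
  by apply: eq_bigr => x /negbTE ne; rewrite in_toggle ne.
by case: (j \in U); case: (j < k)%N; rewrite /= ?expr0 ?expr1 ?mulr1 ?mulrNN ?mulr1.
Qed.

Lemma fsign_sq k U : fsign k U * fsign k U = 1.
Proof. by rewrite -big_split big1 // => x _; rewrite /= -expr2 sqrr_sign. Qed.

Lemma fsign_conj k U : (fsign k U)^* = fsign k U.
Proof. by rewrite rmorph_prod; apply: eq_bigr => x _; rewrite rmorphXn rmorphN1. Qed.

Definition sof (t : 'I_fock) : {set 'I_d} := enum_val t.

Definition evec (U : {set 'I_d}) : 'cV[C]_fock := delta_mx (enum_rank U) 0.

Lemma evec_ext (A B : 'M[C]_fock) : (forall U, A *m evec U = B *m evec U) -> A = B.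
Proof.
move=> e; apply/matrixP => i j; have := e (sof j).
by rewrite /evec /sof enum_valK -!colE => /colP/(_ i); rewrite !mxE.
Qed.

Lemma mulmx_evec (A : 'M[C]_fock) t u : A t u = (A *m evec (sof u)) t 0.
Proof. by rewrite /evec /sof enum_valK -colE mxE. Qed.

Lemma evecE U t : evec U t 0 = (sof t == U)%:R.
Proof. by rewrite mxE eqxx andbT -(inj_eq enum_val_inj) enum_rankK. Qed.

(* Creation for b = false, annihilation for b = true. *)
Definition fermi (b : bool) (i : 'I_d) : 'M[C]_fock := \matrix_(t, u)
  ((((i \in sof u) == b)%:R * fsign i (sof u)) * (sof t == toggle i (sof u))%:R).

Definition parity : 'M[C]_fock := diag_mx (\row_u fsign d (sof u)).

Lemma fermiE b i U : fermi b i *m evec U = (((i \in U) == b)%:R * fsign i U) *: evec (toggle i U).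
Proof. by apply/colP => t; rewrite -colE !mxE /sof enum_rankK -evecE mxE. Qed.

Lemma parityE U : parity *m evec U = fsign d U *: evec U.
Proof.
apply/colP => t; rewrite mul_diag_mx [LHS]mxE [RHS]mxE evecE mxE.
by case: eqP => [->|_]; rewrite ?mulr0.
Qed.

Lemma fermi_anticomm b b' i j :
  fermi b i *m fermi b' j + fermi b' j *m fermi b i = ((i == j) && (b != b'))%:R%:M.
Proof.
apply: evec_ext => U; rewrite mulmxDl -!mulmxA !fermiE -!scalemxAr !fermiE !scalerA.
rewrite mul_scalar_mx !in_toggle !fsign_toggle.
have [<-|ne] := eqVneq i j.
  rewrite toggleK ltnn -scalerDl; congr (_ *: _).
  have := fsign_sq i U; move: (fsign i U) => x xx.
  by case: (i \in U); case: b; case: b';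
    rewrite /= ?(mul0r, mulr0, mul1r, mulr1, expr0, addr0, add0r, xx).
rewrite toggleC -scalerDl scale0r /=.
rewrite [X in X *: _](_ : _ = 0) ?scale0r //.
move: (fsign i U) (fsign j U) => x y; have := ne; rewrite eq_sym -(inj_eq val_inj) /=.
by case: ltngtP => // _ _; rewrite expr0 expr1; ring.
Qed.

Lemma parity_fermi b i : parity *m fermi b i + fermi b i *m parity = 0.
Proof.
apply: evec_ext => U; rewrite mulmxDl -!mulmxA fermiE parityE -!scalemxAr parityE fermiE mul0mx.
rewrite fsign_toggle ltn_ord !scalerA -scalerDl expr1.
by rewrite [X in X *: _](_ : _ = 0) ?scale0r //; ring.
Qed.

Lemma parity_sq : parity *m parity = 1%:M.
Proof.
by apply: evec_ext => U; rewrite -mulmxA parityE -scalemxAr parityE scalerA fsign_sq scale1r mul1mx.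
Qed.

Lemma adjm_fermi b i : adjm (fermi b i) = fermi (~~ b) i.
Proof.
apply/matrixP => t u; rewrite !mxE !rmorphM /= fsign_conj !rmorph_nat.
have -> : (sof u == toggle i (sof t)) = (sof t == toggle i (sof u)).
  by apply/eqP/eqP => ->; rewrite toggleK.
case: (sof t =P _) => [->|_]; last by rewrite !mulr0.
by rewrite in_toggle eqxx fsign_toggle ltnn expr0 mul1r; case: (_ \in _); case: b.
Qed.

Lemma adjm_parity : adjm parity = parity.
Proof.
apply/matrixP => t u; rewrite !mxE rmorphMn /= fsign_conj eq_sym.
by case: eqP => [->|].
Qed.

Lemma sign_card (A : {set 'I_d}) (P : pred 'I_d) :
  (-1) ^+ #|[set x in A | P x]| = \prod_(x in A) (-1) ^+ P x :> C.
Proof.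
rewrite -prodr_const big_mkcond [RHS]big_mkcond; apply: eq_bigr => x _.
by rewrite inE; case: (x \in A); case: (P x).
Qed.

(** The two Jordan-Wigner signs multiply to the parity of the number of elements below exactly one
    of s and i, which is the sign in [wedge_subst]. *)
Lemma fermi_subst i s t u : (fermi false i *m fermi true s) t u =
  if s \in sof u then wedge_subst C (sof u) s i (sof t) else 0.
Proof.
rewrite mulmx_evec -mulmxA fermiE -scalemxAr fermiE scalerA mxE evecE.
move: (sof t) (sof u) => T U; case: ifP => sU; last by rewrite /= !mul0r.
have tE : toggle s U = U :\ s.
  by apply/setP => x; rewrite in_toggle !inE; case: eqP => [->|]; rewrite ?sU.
rewrite tE /wedge_subst; case: (boolP (i \in U :\ s)) => iU /=; first by rewrite !mul0r mulr0 mul0r.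
have -> : toggle i (U :\ s) = i |: (U :\ s).
  apply/setP => x; rewrite in_toggle in_setU1; have [->|_] := eqVneq x i; last by [].
  by rewrite (negbTE iU).
case: eqP => _; last by rewrite mulr0.
have -> : fsign s U = fsign s (U :\ s).
  by rewrite -tE fsign_toggle ltnn mul1r.
rewrite !mul1r mulr1 sign_card /fsign -big_split; apply: eq_bigr => x _ /=.
by rewrite signr_addb.
Qed.

Lemma ext_mxE (X : 'M[C]_d) : ext_mx X = bilin (fermi false) (fermi true) X.
Proof.
apply/matrixP => t u; rewrite mxE /bilin [in RHS]exchange_big summxE /= big_mkcond.
apply: eq_bigr => s _; rewrite summxE; case: ifP => sU; last first.
  by rewrite big1 // => i _; rewrite mxE fermi_subst /sof sU mulr0.
by apply: eq_bigr => i _; rewrite mxE fermi_subst /sof sU.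
Qed.

End Fermions.

Section ExtRepresentation.
Variables (C : numClosedFieldType) (n m h : nat) (g : pred 'M[C]_(n + m)) (D : root_datum h g).
Local Notation X := (Xmx (rd_sign D)).
Local Notation l := (lshift m).

Lemma adjm_Xmx i j : adjm (X i j) = X j i.
Proof.
have sR k : (rd_sign D k)^* = rd_sign D k.
  have /eqP : rd_sign D k ^+ 2 = 1 by rewrite expr2 rd_sq.
  by rewrite sqrf_eq1 => /orP[] /eqP->; rewrite ?rmorphN rmorph1.
apply/matrixP => a b; rewrite /Xmx /skew_part !adj_transp_delta; try exact: rd_rev.
rewrite !mxE rmorphB rmorphM rmorphM /= !sR !rmorph_nat [rd_sign D i * _]mulrC.
by rewrite [(b == i) && _]andbC [(b == _) && _]andbC.
Qed.

Lemma Xmx_l c : X (l c) (l c) = delta_mx (l c) (l c) - delta_mx (rev_ord (l c)) (rev_ord (l c)).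
Proof. by rewrite /Xmx /skew_part adj_transp_delta ?rd_sq ?scale1r //; apply: rd_rev. Qed.

Lemma bilinB N d (p q : 'I_N -> 'M[C]_d) A B : bilin p q (A - B) = bilin p q A - bilin p q B.
Proof. by rewrite -scaleN1r addrC bilinD scaleN1r addrC. Qed.

Lemma fermi_number d b (i : 'I_d) : fermi C b i *m fermi C (~~ b) i =
  diag_mx (\row_t ((i \in sof t) (+) b)%:R).
Proof.
apply: evec_ext => U; rewrite -mulmxA fermiE -scalemxAr fermiE toggleK scalerA fsign_toggle ltnn.
apply/colP => t; rewrite mul_diag_mx [LHS]mxE [RHS]mxE evecE mxE in_toggle eqxx.
case: (sof t =P U) => [->|_]; last by rewrite !mulr0.
rewrite expr0 mul1r mulrACA fsign_sq !mulr1 -natrM mulnb.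
by case: (i \in U); case: b.
Qed.

Lemma ext_star_weights : star_weights D (V := ext_act (natural_act C (n + m)))
  (fun t => \row_c (2 * ((l c \in sof t)%:R - (rev_ord (l c) \in sof t)%:R))).
Proof.
split=> [|i j|c] /=.
- split=> [a A B _ _|A B _ _] /=; rewrite !ext_mxE ?bilinD // -bilin_bracket // => k.
    rewrite bilin_bracketE; apply: eq_bigr => i _.
    rewrite (bigD1 k) //= big1 ?addr0 => [|j ne]; rewrite !fermi_anticomm ?eqxx ?(negbTE ne) /=.
      by rewrite mulmx1 andbF mul_scalar_mx scale0r subr0.
    by rewrite andbF mul_mx_scalar mul_scalar_mx !scale0r subr0 scaler0.
  rewrite bilin_bracketE (bigD1 k) //= [X in _ + X]big1 ?addr0 => [|i ne].
    rewrite -sumrN; apply: eq_bigr => j _.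
    by rewrite !fermi_anticomm !eqxx andbF /= mul_mx_scalar scale0r mul_scalar_mx scale1r sub0r scalerN.
  rewrite big1 // => j _; rewrite !fermi_anticomm andbF (negbTE ne) /=.
  by rewrite mul_mx_scalar mul_scalar_mx !scale0r subr0 scaler0.
- rewrite !ext_mxE adjm_bilin ?adjm_Xmx // => a b.
  by rewrite adjmM !adjm_fermi.
rewrite ext_mxE Xmx_l bilinB !bilin_delta.
rewrite (fermi_number false) (fermi_number false) -linearB /=; congr diag_mx; apply/rowP => t.
rewrite !mxE !addbF rmorphM rmorphB /= mulrAC mulfV ?mul1r ?pnatr_eq0 //.
by rewrite !rmorph_nat.
Qed.
End ExtRepresentation.

(** * The spinor representation on the Clifford module *)

Section Spin.
Variables (C : numClosedFieldType) (n : nat).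
Local Notation D := (so_root_datum C n).
Local Notation X := (Xmx (rd_sign D)).
Local Notation l := (lshift n.+1).
Local Notation mid := (middle n).
Local Notation fermi := (@fermi C n).

(* Generators of the Clifford algebra of the form of so_(2n+1). *)
Definition clifford (i : 'I_(n + n.+1)) : 'M[C]_#|{: {set 'I_n}}| :=
  if insub (val i) is Some a then fermi false a
  else if insub (val (rev_ord i)) is Some a then fermi true a
  else (sqrtC 2)^-1 *: parity C n.

Lemma clifford_l a : clifford (l a) = fermi false a.
Proof. by rewrite /clifford /= valK. Qed.

Lemma clifford_rev a : clifford (rev_ord (l a)) = fermi true a.
Proof.
rewrite /clifford insubF; last by apply/negbTE; rewrite -leqNgt /=; have := ltn_ord a; lia.
by rewrite rev_ordK /= valK.
Qed.

Lemma clifford_mid : clifford mid = (sqrtC 2)^-1 *: parity C n.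
Proof.
rewrite /clifford insubF; last by apply/negbTE; rewrite -leqNgt /= addn0.
by rewrite insubF // rev_middle; apply/negbTE; rewrite -leqNgt /= addn0.
Qed.

Lemma l_eq_rev (a b : 'I_n) : (l a == rev_ord (l b)) = false.
Proof. by apply/eqP => e; have := @ltn_l_rev n n.+1 a b (leqnSn _); rewrite e ltnn. Qed.

Lemma rev_eq_l (a b : 'I_n) : (rev_ord (l a) == l b) = false.
Proof. by rewrite eq_sym l_eq_rev. Qed.

(** The middle basis vector has norm 1 for the form, so its generator must square to 1/2; hence the
    scaling of the parity operator. *)
Lemma sqrt2_sq : (sqrtC 2)^-1 * (sqrtC 2)^-1 = 2^-1 :> C.
Proof. by rewrite -invfM -expr2 sqrtCK. Qed.

Lemma adjm_clifford i : adjm (clifford i) = clifford (rev_ord i).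
Proof.
case: (ord_odd_cases i) => [[a [->|->]]|->].
- by rewrite clifford_l clifford_rev adjm_fermi.
- by rewrite rev_ordK clifford_l clifford_rev adjm_fermi.
rewrite rev_middle clifford_mid adjmZ adjm_parity; congr (_ *: _).
by rewrite geC0_conj // invr_ge0 sqrtC_ge0 ler0n.
Qed.

Lemma clifford_anticomm i j :
  clifford i *m clifford j + clifford j *m clifford i = (j == rev_ord i)%:R%:M.
Proof.
have pf b a : clifford mid *m fermi b a + fermi b a *m clifford mid = 0.
  by rewrite clifford_mid -scalemxAl -scalemxAr -scalerDr parity_fermi scaler0.
have fp b a : fermi b a *m clifford mid + clifford mid *m fermi b a = 0 by rewrite addrC pf.
case: (ord_odd_cases i) => [[a [->|->]]|->]; case: (ord_odd_cases j) => [[b [->|->]]|->];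
  rewrite ?rev_ordK ?rev_middle ?(inj_eq rev_ord_inj) ?(inj_eq (@lshift_inj _ _)) ?l_eq_rev ?rev_eq_l
    ?[mid == rev_ord _]eq_sym ?[mid == l _]eq_sym ?l_neq_middle ?rev_neq_middle
    ?clifford_l ?clifford_rev ?pf ?fp ?fermi_anticomm ?andbF ?andbT ?raddf0 //; try by rewrite eq_sym.
rewrite eqxx clifford_mid -scalemxAl -scalemxAr scalerA parity_sq sqrt2_sq -scalerDl.
by rewrite -mulr2n -[X in X *: _]mulr_natr mulVf ?pnatr_eq0 // scale1r.
Qed.

(** By [clifford_anticomm] the generator of index [rev_ord j] is dual to that of j. The factor 1/2
    compensates for the symmetry (i, j) -> (rev j, rev i) of the matrices in so_(2n+1), which counts
    each entry twice. *)
Definition spin_act : mxact C (n + n.+1) :=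
  MxAct (bilin clifford (fun j => 2^-1 *: clifford (rev_ord j))).

Lemma spin_actE A : spin_act A = bilin clifford (fun j => 2^-1 *: clifford (rev_ord j)) A.
Proof. by []. Qed.

Lemma spin_clifford A k : A \in so_odd C n ->
  lie_bracket (spin_act A) (clifford k) = \sum_i A i k *: clifford i.
Proof.
move=> gA; rewrite bilin_bracketE.
have pm i j : clifford i *m (2^-1 *: clifford (rev_ord j) *m clifford k +
    clifford k *m (2^-1 *: clifford (rev_ord j))) -
    (clifford i *m clifford k + clifford k *m clifford i) *m (2^-1 *: clifford (rev_ord j)) =
    2^-1 *: ((j == k)%:R *: clifford i - (i == rev_ord k)%:R *: clifford (rev_ord j)).
  rewrite -scalemxAl -!scalemxAr -scalerDr !clifford_anticomm rev_ordK -scalemxAr -scalerBr.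
  rewrite mul_mx_scalar mul_scalar_mx [k == rev_ord i]eq_sym (can2_eq (@rev_ordK _) (@rev_ordK _)).
  by rewrite [k == j]eq_sym.
under eq_bigr do under eq_bigr do rewrite pm scalerA mulrC -scalerA scalerBr !scalerA.
under eq_bigr do rewrite -scaler_sumr sumrB.
rewrite -scaler_sumr sumrB.
have -> : \sum_i \sum_j (A i j * (j == k)%:R) *: clifford i = \sum_i A i k *: clifford i.
  apply: eq_bigr => i _; rewrite (bigD1 k) //= eqxx mulr1 big1 ?addr0 // => j /negbTE->.
  by rewrite mulr0 scale0r.
have -> : \sum_i \sum_j (A i j * (i == rev_ord k)%:R) *: clifford (rev_ord j) =
    - \sum_i A i k *: clifford i.
  rewrite (bigD1 (rev_ord k)) //= [X in _ + X]big1 ?addr0 => [|i /negbTE ne]; last first.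
    by rewrite big1 // => j _; rewrite ne mulr0 scale0r.
  rewrite (reindex_inj rev_ord_inj) -sumrN; apply: eq_bigr => j _.
  by rewrite eqxx mulr1 rev_ordK ((rd_mem D A).1 gA) !mul1r !rev_ordK scaleNr.
by rewrite opprK -mulr2n -scaler_nat scalerA mulVf ?pnatr_eq0 // scale1r.
Qed.

Lemma spin_rep : is_rep (so_odd C n) spin_act.
Proof.
split=> [a A B _ _|A B gA gB]; first exact: bilinD.
rewrite /= -bilin_bracket // => k; first exact: spin_clifford.
have -> : lie_bracket (bilin clifford (fun j => 2^-1 *: clifford (rev_ord j)) A)
  (2^-1 *: clifford (rev_ord k)) = 2^-1 *: lie_bracket (spin_act A) (clifford (rev_ord k)).
  by rewrite /lie_bracket -scalemxAr -scalemxAl -scalerBr.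
rewrite spin_clifford // scaler_sumr (reindex_inj rev_ord_inj) -sumrN; apply: eq_bigr => j _.
by rewrite ((rd_mem D A).1 gA) !mul1r !rev_ordK scaleNr scalerN scalerA mulrC -scalerA.
Qed.

Lemma spin_X i j : i != j -> spin_act (X i j) = clifford i *m clifford (rev_ord j).
Proof.
move=> ne; rewrite spin_actE /Xmx /skew_part adj_transp_delta; last exact: (rd_rev D).
rewrite !mul1r scale1r bilinB !bilin_delta rev_ordK -!scalemxAr -scalerBr.
have /eqP := clifford_anticomm i (rev_ord j); rewrite (inj_eq rev_ord_inj) [j == i]eq_sym (negbTE ne).
rewrite raddf0 addrC addr_eq0 => /eqP->; rewrite opprK -mulr2n -scaler_nat scalerA.
by rewrite mulVf ?pnatr_eq0 // scale1r.
Qed.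

Lemma spin_star_weights : star_weights D (V := spin_act)
  (fun t => \row_c (if c \in sof t then 1 else -1)).
Proof.
split=> [|i j|c].
- exact: spin_rep.
- rewrite !spin_actE adjm_bilin ?adjm_Xmx // => a b.
  rewrite -!scalemxAr adjmZ adjmM !adjm_clifford rev_ordK; congr (_ *: _).
  by rewrite geC0_conj // invr_ge0 ler0n.
rewrite spin_actE Xmx_l bilinB !bilin_delta -!scalemxAr rev_ordK clifford_l clifford_rev -scalerBr.
rewrite (@fermi_number C n false) (@fermi_number C n true) -linearB -linearZ /=; congr diag_mx; apply/rowP => t.
by rewrite !mxE mulrC; case: ifP => _ /=; rewrite ?subr0 ?sub0r ?rmorphN rmorph1.
Qed.

Let g_X i j : X i j \in so_odd C n.
Proof. exact: (Xmx_g (rd_sq D) (rd_rev D) (rd_mem D)). Qed.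

Lemma evec_neq0 (T : {set 'I_n}) : evec C T != 0.
Proof.
apply/eqP => /colP/(_ (enum_rank T)) /eqP.
by rewrite evecE /sof enum_rankK eqxx mxE oner_eq0.
Qed.

Lemma fsign_neq0 k (T : {set 'I_n}) : fsign C k T != 0.
Proof. by apply/eqP => e; have /eqP := fsign_sq C k T; rewrite e mul0r eq_sym oner_eq0. Qed.

Lemma evec_sum (v : 'cV[C]_#|{: {set 'I_n}}|) : v = \sum_t v t 0 *: evec C (sof t).
Proof.
apply/colP => t; rewrite summxE (bigD1 t) //= mxE evecE eqxx mulr1 big1 ?addr0 // => t' ne.
by rewrite mxE evecE (inj_eq enum_val_inj) eq_sym (negbTE ne) mulr0.
Qed.

Lemma spin_hwv : highest_weight_vector (so_odd C n) (V := spin_act) (half_weight n) (evec C setT).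
Proof.
have mu_xi c : half_weight n 0 c = ((const_mx 1 : 'rV[int]_n) 0 c)%:~R / 2 by rewrite !mxE.
apply/(hwvP (xi := const_mx 1) D spin_rep mu_xi (evec_neq0 setT)); split=> [x|c].
  have lt := root_row_lt_col D x; have ne : root_row n.+1 x != root_col (rd_col D) x.
    by apply: contraTneq lt => ->; rewrite ltnn.
  rewrite spin_X //.
  have /eqP := clifford_anticomm (root_row n.+1 x) (rev_ord (root_col (rd_col D) x)).
  rewrite (inj_eq rev_ord_inj) [_ == root_row _ _]eq_sym (negbTE ne) raddf0 addr_eq0 => /eqP->.
  by rewrite mulNmx -mulmxA clifford_l fermiE in_setT /= mul0r scale0r mulmx0 oppr0.
have [_ _ ->] := spin_star_weights; apply/colP => t.
rewrite mul_diag_mx [LHS]mxE [RHS]mxE evecE !mxE.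
by case: (sof t =P _) => [->|_]; rewrite ?mulr0 // in_setT.
Qed.

Lemma spin_toggle (T : {set 'I_n}) c : exists2 A, A \in so_odd C n &
  exists2 k, k != 0 & spin_act A *m evec C T = k *: evec C (toggle c T).
Proof.
have s0 : (sqrtC 2)^-1 != 0 :> C by rewrite invr_eq0 sqrtC_eq0 pnatr_eq0.
have [cT|cT] := boolP (c \in T).
  exists (X mid (l c)) => //; exists ((sqrtC 2)^-1 * fsign C c T * fsign C n (toggle c T)).
    by rewrite !mulf_neq0 ?fsign_neq0.
  rewrite spin_X ?clifford_rev ?clifford_mid 1?eq_sym ?l_neq_middle // -mulmxA fermiE cT mul1r.
  by rewrite -scalemxAr -scalemxAl parityE !scalerA [fsign _ _ _ * _]mulrC.
exists (X (l c) mid) => //; exists ((sqrtC 2)^-1 * fsign C n T * fsign C c T).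
  by rewrite !mulf_neq0 ?fsign_neq0.
rewrite spin_X ?l_neq_middle // rev_middle clifford_l clifford_mid -mulmxA -scalemxAl parityE.
by rewrite -!scalemxAr fermiE (negbTE cT) mul1r !scalerA.
Qed.

(** The basis vectors have distinct weights, so Cartan elements isolate one of them inside any
    nonzero stable U; the root vectors of the short roots then toggle the elements of the index set
    one by one. *)
Lemma spin_irreducible :
  irreducible_sub (so_odd C n) (fullv : {vspace 'cV[C]_(act_dim spin_act)}).
Proof.
split=> [A v _ _|e|U stU _]; first exact: memvf.
  have : evec C setT \in (fullv : {vspace 'cV[C]_(act_dim spin_act)}) by rewrite memvf.
  by rewrite e memv0 (negbTE (evec_neq0 _)).
have [->|U0] := eqVneq U 0%VS; [by left | right].
set u : 'cV_ _ := vpick U; have uU : u \in U := memv_pick U.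
have [t ut] : exists t, u t 0 != 0.
  apply/existsP; rewrite -vpick0 in U0; apply: contra_neqT U0 => /existsPn e.
  by apply/colP => t; rewrite mxE; apply/eqP; rewrite -[_ == _]negbK e.
have proj (r : seq 'I_n) : exists2 w : 'cV_(act_dim spin_act), w \in U &
    forall t', w t' 0 = (all (fun c => (c \in sof t') == (c \in sof t)) r)%:R * u t' 0.
  elim: r => [|c r [w wU wE]]; first by exists u => // t'; rewrite mul1r.
  (* The Cartan element acts by 1/2 or -1/2, so 1/2 plus e times it projects onto the basis vectors
     that agree with [sof t] at c. *)
  pose e : C := if c \in sof t then 1 else -1.
  exists (2^-1 *: w + e *: (spin_act (X (l c) (l c)) *m w)).
    by rewrite memvD // memvZ // stU.
  move=> t'; have [_ _ ->] := spin_star_weights.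
  rewrite mul_diag_mx !mxE wE /= /e; case: (c \in sof t'); case: (c \in sof t);
    rewrite /= ?mul0r ?rmorphN ?rmorph1; field; by rewrite ?pnatr_eq0.
have {proj} tU : evec C (sof t) \in U.
  have [w wU wE] := proj (enum 'I_n).
  suff -> : evec C (sof t) = (u t 0)^-1 *: w by rewrite memvZ.
  apply/colP => t'; rewrite evecE mxE wE.
  have -> : all (fun c => (c \in sof t') == (c \in sof t)) (enum 'I_n) = (sof t' == sof t).
    apply/allP/eqP => [e|-> //]; apply/setP => c; apply/eqP/e; exact: mem_enum.
  by case: eqP => [/enum_val_inj->|_]; rewrite ?mul0r ?mulr0 // mul1r mulVf.
have reach (T : {set 'I_n}) (r : seq 'I_n) : exists2 S, evec C S \in U &
    forall c, c \in r -> (c \in S) = (c \in T).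
  elim: r => [|c r [S SU SE]]; first by exists (sof t).
  have [e|ne] := eqVneq (c \in S) (c \in T).
    by exists S => // c'; rewrite inE => /orP[/eqP->|/SE].
  have [A gA [k k0 Ae]] := spin_toggle S c.
  exists (toggle c S).
    rewrite -[evec _ _]scale1r -(mulVf k0) -scalerA memvZ // -Ae.
    exact: stU.
  move=> c'; rewrite inE in_toggle; have [->|nc] := eqVneq c' c.
    by move=> _; move: ne; case: (c \in S); case: (c \in T).
  exact: SE.
apply/eqP; rewrite eqEsubv subvf; apply/subvP => v _.
rewrite (evec_sum v); apply: memv_suml => t' _; apply: memvZ.
have [S SU SE] := reach (sof t') (enum 'I_n).
suff -> : sof t' = S by [].
by apply/setP => c; rewrite SE // mem_enum.
Qed.

Lemma spin_irrep : is_hw_irrep (so_odd C n) (half_weight n) spin_act.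
Proof.
split; [exact: spin_rep | split; first exact: spin_irreducible].
by exists (evec C setT); [apply: memvf | apply: spin_hwv].
Qed.
End Spin.

(** * Uniqueness of highest weight representations *)

Lemma mulmx_ext (C : pzRingType) m n (A B : 'M[C]_(m, n)) :
  (forall x : 'cV_n, A *m x = B *m x) -> A = B.
Proof.
move=> e; apply/matrixP => i j; have := e (delta_mx j 0).
by rewrite -!colE => /colP/(_ i); rewrite !mxE.
Qed.

Section Heights.
Variables (C : numFieldType) (n m h : nat) (g : pred 'M[C]_(n + m)) (D : root_datum h g).
Local Notation X := (Xmx (rd_sign D)).
Local Notation l := (lshift m).
Let g_X i j : X i j \in g := Xmx_g (rd_sq D) (rd_rev D) (rd_mem D) i j.

(* Twice the height of the i-th coordinate vector. *)
Definition coord_height (i : 'I_(n + m)) : C := (rev_ord i)%:R - i%:R.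

Definition height_mx : 'M[C]_(n + m) := diag_mx (\row_i coord_height i).

Lemma height_mx_g : height_mx \in g.
Proof.
apply/(rd_mem D) => i j; rewrite !mxE (inj_eq rev_ord_inj) [j == i]eq_sym.
have [<-|ne] := eqVneq i j; last by rewrite !mulr0n mulr0 oppr0.
by rewrite !mulr1n rd_sq mul1r /coord_height rev_ordK opprB.
Qed.

Variable V : mxact C (n + m).
Hypothesis Vrep : is_rep g V.

Let H := V height_mx.

Lemma height_bracket i j :
  H *m V (X i j) = V (X i j) *m H + (coord_height i - coord_height j) *: V (X i j).
Proof.
apply/eqP; rewrite addrC -subr_eq /H.
rewrite (rep_Xmx_bracket (rd_sq D) (rd_rev D) (rd_mem D) Vrep) ?height_mx_g // scalerBl.
apply/eqP; congr (_ - _).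
  rewrite (bigD1 i) //= big1 ?addr0 => [|k ne]; rewrite !mxE ?eqxx ?mulr1n //.
  by rewrite (negbTE ne) mulr0n scale0r.
rewrite (bigD1 j) //= big1 ?addr0 => [|k ne]; rewrite !mxE ?eqxx ?mulr1n //.
by rewrite eq_sym (negbTE ne) mulr0n scale0r.
Qed.

Variables (a : C) (v : 'cV[C]_(act_dim V)).
Hypothesis Hv : H *m v = a *: v.

(** Being killed by a product of such factors expresses lower height without assuming that H is
    diagonalizable. *)
Let T1 (k : nat) : 'M[C]_(act_dim V) := H - (a - 2 * k.+1%:R)%:M.
Let T (s : seq nat) : 'M[C]_(act_dim V) := foldr (fun k B => T1 k *m B) 1%:M s.

(* Sums of vectors of heights lower than that of v. *)
Let low (z : 'cV[C]_(act_dim V)) := exists s, T s *m z = 0.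

Let T_comm1 k s : T1 k *m T s = T s *m T1 k.
Proof.
elim: s => [|k' s IH] /=; first by rewrite mulmx1 mul1mx.
rewrite -mulmxA -IH !mulmxA; congr (_ *m _).
have -> : T1 k' = T1 k + (2 * k'.+1%:R - 2 * k.+1%:R)%:M.
  rewrite /T1; move: (H) => K; apply/matrixP => i j; rewrite !mxE.
  by case: (i == j); rewrite ?mulr1n ?mulr0n; ring.
move: (T1 k) => U; rewrite mulmxDr mulmxDl; congr (_ + _).
by rewrite mul_mx_scalar mul_scalar_mx.
Qed.

Let T_cat s1 s2 : T (s1 ++ s2) = T s1 *m T s2.
Proof. by elim: s1 => [|k s IH] /=; rewrite ?mul1mx // IH mulmxA. Qed.

Let T_comm s1 s2 : T s1 *m T s2 = T s2 *m T s1.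
Proof.
elim: s1 => [|k s IH] /=; first by rewrite mulmx1 mul1mx.
by rewrite -mulmxA IH !mulmxA T_comm1.
Qed.

Let lowD x y : low x -> low y -> low (x + y).
Proof.
move=> [s es] [s' es']; exists (s ++ s').
by rewrite mulmxDr T_cat -[X in _ + X]mulmxA es' mulmx0 addr0 T_comm -mulmxA es mulmx0.
Qed.

Let lowZ c x : low x -> low (c *: x).
Proof. by move=> [s e]; exists s; rewrite -scalemxAr e scaler0. Qed.

Let coord_heightB (i j : 'I_(n + m)) : (j < i)%N -> coord_height i - coord_height j = - (2 * (i - j)%:R).
Proof.
move=> lt; rewrite /coord_height /= !natrB ?(ltnW lt) // -!natr1; ring.
Qed.

Let low_X (i j : 'I_(n + m)) x : (j < i)%N -> low x -> low (V (X i j) *m x).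
Proof.
move=> lt [s e]; exists (map (addn (i - j)) s).
suff -> : T (map (addn (i - j)) s) *m (V (X i j) *m x) = V (X i j) *m (T s *m x).
  by rewrite e mulmx0.
rewrite !mulmxA; congr (_ *m _); elim: {e} s => [|k s IH] /=; first by rewrite mulmx1 mul1mx.
rewrite -mulmxA IH !mulmxA; congr (_ *m _).
rewrite /T1 mulmxBl mulmxBr height_bracket mul_scalar_mx mul_mx_scalar -addrA -scalerBl.
rewrite coord_heightB // -scaleNr; congr (_ + _ *: _).
by rewrite -addnS natrD; ring.
Qed.

Let low_Xv (i j : 'I_(n + m)) : (j < i)%N -> low (V (X i j) *m v).
Proof.
move=> lt; exists [:: (i - j).-1]; rewrite /= mulmx1 /T1 prednK ?subn_gt0 //.
rewrite mulmxBl mulmxA height_bracket mulmxDl -mulmxA Hv -scalemxAr -scalemxAl mul_scalar_mx.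
by rewrite -scalerDl -scalerBl coord_heightB // subrr scale0r.
Qed.

(** The multiples of v up to lower terms. Lowering operators preserve this, so by the induction in
    [cyclic_submodule] it holds throughout the submodule that v generates. *)
Definition tops (z : 'cV[C]_(act_dim V)) := exists c, low (z - c *: v).

Lemma tops_v : tops v.
Proof. by exists 1, [::]; rewrite scale1r subrr mulmx0. Qed.

Lemma tops_lin c x y : tops x -> tops y -> tops (c *: x + y).
Proof.
move=> [b lx] [b' ly]; exists (c * b + b').
have -> : c *: x + y - (c * b + b') *: v = c *: (x - b *: v) + (y - b' *: v).
  by rewrite scalerBr scalerDl scalerA opprD addrACA.
exact: lowD (lowZ _ lx) ly.
Qed.

Lemma tops_X (i j : 'I_(n + m)) x : (j < i)%N -> tops x -> tops (V (X i j) *m x).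
Proof.
move=> lt [b lx]; exists 0; rewrite scale0r subr0 -[x](subrK (b *: v)) mulmxDr -scalemxAr.
by apply: lowD; [apply: low_X | apply/lowZ/low_Xv].
Qed.

(** Some T s kills z - c v, but this vector has height a, where T s is the nonzero scalar product of
    the 2(k + 1). *)
Lemma tops_height z : tops z -> H *m z = a *: z -> exists c, z = c *: v.
Proof.
move=> [c [s e]] Hz; exists c; apply/eqP; rewrite -subr_eq0; move: e.
have : H *m (z - c *: v) = a *: (z - c *: v).
  by rewrite mulmxBr -scalemxAr Hz Hv scalerBr !scalerA mulrC.
move: (z - c *: v) => w Hw.
have -> : T s *m w = (\prod_(k <- s) (2 * k.+1%:R)) *: w.
  elim: s => [|k s IH] /=; first by rewrite mul1mx big_nil scale1r.
  rewrite -mulmxA IH -scalemxAr big_cons mulrC -scalerA; congr (_ *: _).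
  rewrite mulmxBl Hw mul_scalar_mx -scalerBl; congr (_ *: _).
  by rewrite opprB addrC subrK.
move/eqP; rewrite scaler_eq0 => /orP[|//]; rewrite prodf_seq_eq0 => /hasP[k _].
by rewrite /= -natrM pnatr_eq0.
Qed.
End Heights.

Section Uniqueness.
Variables (C : numFieldType) (n m h : nat) (g : pred 'M[C]_(n + m)) (D : root_datum h g).
Variables (mu : weight n) (V W : mxact C (n + m)).
Hypotheses (Virr : is_hw_irrep g mu V) (Wirr : is_hw_irrep g mu W).
Local Notation X := (Xmx (rd_sign D)).
Let g_X i j : X i j \in g := Xmx_g (rd_sq D) (rd_rev D) (rd_mem D) i j.

Definition dsum_act : mxact C (n + m) := MxAct (fun A => block_mx (V A) 0 0 (W A)).

Let dsumE A (x : 'cV[C]_(act_dim V)) (y : 'cV[C]_(act_dim W)) :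
  dsum_act A *m (col_mx x y : 'cV[C]_(act_dim dsum_act)) = col_mx (V A *m x) (W A *m y).
Proof. by rewrite /= mul_block_col !mul0mx addr0 add0r. Qed.

Let dsum_rep : is_rep g dsum_act.
Proof.
have [[Vlin Vbr] _] := Virr; have [[Wlin Wbr] _] := Wirr.
split=> [a A B gA gB|A B gA gB] /=.
  by rewrite Vlin // Wlin // scale_block_mx add_block_mx !scaler0 !addr0.
rewrite Vbr // Wbr // /lie_bracket !mulmx_block !mul0mx !mulmx0 !addr0 !add0r.
by rewrite opp_block_mx add_block_mx !oppr0 !addr0.
Qed.

(** Z is generated by the pair (v, w). Its intersection with either summand is stable, so zero or
    the whole summand; the latter would put (v, 0) or (0, w) in Z, and a vector of Z of top height
    is a multiple of (v, w). The projections of Z are nonzero, hence onto. *)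
Let graph : exists Z : {vspace 'cV[C]_(act_dim V + act_dim W)},
  [/\ stable_sub (V := dsum_act) g Z,
   (forall x, col_mx x 0 \in Z -> x = 0) /\ (forall y, col_mx 0 y \in Z -> y = 0),
   forall x, exists y, col_mx x y \in Z &
   forall y, exists x, col_mx x y \in Z].
Proof.
have [Vrep [[_ V0 Vi] [v _ [v0 vup vdg]]]] := Virr.
have [Wrep [[_ W0 Wi] [w _ [w0 wup wdg]]]] := Wirr.
pose z : 'cV[C]_(act_dim dsum_act) := col_mx v w.
have zup (i j : 'I_(n + m)) : (i < j)%N -> dsum_act (X i j) *m z = 0.
  move=> lt; have up := Xmx_strictly_upper D lt.
  by rewrite dsumE vup // wup // col_mx0.
have zdg A : A \in g -> is_diag_mx A -> exists c, dsum_act A *m z = c *: z.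
  move=> gA dA; exists (\sum_(i < n) ratr (mu 0 i) * A (lshift m i) (lshift m i)).
  by rewrite dsumE vdg // wdg // scale_col_mx.
have [|Z [zZ stZ Zind]] := cyclic_submodule dsum_rep zup.
  by move=> i; have [c ->] := zdg _ (g_X i i) (Xmx_is_diag D i); rewrite memvZ ?memv_line.
have dH : is_diag_mx (height_mx C n m) by apply: diag_mx_is_diag.
have gH : height_mx C n m \in g := height_mx_g D.
have [a za] := zdg _ gH dH.
have top x : x \in Z -> dsum_act (height_mx C n m) *m x = a *: x -> exists c, x = c *: z.
  move=> xZ Hx; apply: (tops_height za _ Hx); move: x xZ {Hx}; apply: Zind.
  - exact: tops_v.
  - exact: tops_lin.
  - by move=> i j x lt; apply: (tops_X D dsum_rep za).
have [va wa] : V (height_mx C n m) *m v = a *: v /\ W (height_mx C n m) *m w = a *: w.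
  by have := za; rewrite dsumE scale_col_mx => /eq_col_mx.
pose f1 : 'Hom('cV[C]_(act_dim V), 'cV[C]_(act_dim V + act_dim W)) := linfun (mulmx (col_mx 1%:M 0)).
pose f2 : 'Hom('cV[C]_(act_dim W), 'cV[C]_(act_dim V + act_dim W)) := linfun (mulmx (col_mx 0 1%:M)).
pose p1 : 'Hom('cV[C]_(act_dim V + act_dim W), 'cV[C]_(act_dim V)) := linfun (mulmx (row_mx 1%:M 0)).
pose p2 : 'Hom('cV[C]_(act_dim V + act_dim W), 'cV[C]_(act_dim W)) := linfun (mulmx (row_mx 0 1%:M)).
have f1E x : f1 x = col_mx x 0 by rewrite lfunE /= mul_col_mx mul1mx mul0mx.
have f2E x : f2 x = col_mx 0 x by rewrite lfunE /= mul_col_mx mul1mx mul0mx.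
have p1E x y : p1 (col_mx x y) = x by rewrite lfunE /= mul_row_col mul1mx mul0mx addr0.
have p2E x y : p2 (col_mx x y) = y by rewrite lfunE /= mul_row_col mul1mx mul0mx add0r.
exists Z; split=> //.
- split=> x xZ.
    have [|e|e] := Vi (f1 @^-1: Z)%VS _ (subvf _).
    + move=> A y gA; rewrite -!memv_preim !f1E => yZ.
      by have := stZ A _ gA yZ; rewrite dsumE mulmx0.
    + by apply/eqP; rewrite -memv0 -e -memv_preim f1E.
    have vZ : col_mx v 0 \in Z by rewrite -f1E memv_preim e memvf.
    have [|c] := top _ vZ; first by rewrite dsumE mulmx0 va scale_col_mx scaler0.
    rewrite scale_col_mx => /eq_col_mx[ev /esym/eqP].
    rewrite scaler_eq0 (negbTE w0) orbF => /eqP c0.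
    by case/eqP: v0; rewrite ev c0 scale0r.
  have [|e|e] := Wi (f2 @^-1: Z)%VS _ (subvf _).
  + move=> A y gA; rewrite -!memv_preim !f2E => yZ.
    by have := stZ A _ gA yZ; rewrite dsumE mulmx0.
  + by apply/eqP; rewrite -memv0 -e -memv_preim f2E.
  have wZ : col_mx 0 w \in Z by rewrite -f2E memv_preim e memvf.
  have [|c] := top _ wZ; first by rewrite dsumE mulmx0 wa scale_col_mx scaler0.
  rewrite scale_col_mx => /eq_col_mx[/esym/eqP ev ew]; move: ev.
  rewrite scaler_eq0 (negbTE v0) orbF => /eqP c0.
  by case/eqP: w0; rewrite ew c0 scale0r.
- have st1 : stable_sub g (p1 @: Z)%VS.
    move=> A y gA /memv_imgP[u uZ ->]; rewrite -[u]vsubmxK p1E.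
    rewrite -(p1E (V A *m usubmx u) (W A *m dsubmx u)) -dsumE vsubmxK.
    by apply: memv_img; apply: stZ.
  have [e|e] := Vi _ st1 (subvf _).
    have := memv_img p1 zZ; rewrite e p1E memv0 => /eqP ev; by rewrite ev eqxx in v0.
  move=> x; have : x \in (p1 @: Z)%VS by rewrite e memvf.
  by move=> /memv_imgP[u uZ ->]; exists (dsubmx u); rewrite -{1}[u]vsubmxK p1E vsubmxK.
have st2 : stable_sub g (p2 @: Z)%VS.
  move=> A y gA /memv_imgP[u uZ ->]; rewrite -[u]vsubmxK p2E.
  rewrite -(p2E (V A *m usubmx u) (W A *m dsubmx u)) -dsumE vsubmxK.
  by apply: memv_img; apply: stZ.
have [e|e] := Wi _ st2 (subvf _).
  have := memv_img p2 zZ; rewrite e p2E memv0 => /eqP ev; by rewrite ev eqxx in w0.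
move=> x; have : x \in (p2 @: Z)%VS by rewrite e memvf.
by move=> /memv_imgP[u uZ ->]; exists (usubmx u); rewrite -{2}[u]vsubmxK p2E vsubmxK.
Qed.

Lemma hw_irrep_unique : exists (B : 'M[C]_(act_dim W, act_dim V)) (B' : 'M[C]_(act_dim V, act_dim W)),
  [/\ B *m B' = 1%:M, B' *m B = 1%:M & forall A, A \in g -> B *m V A = W A *m B].
Proof.
have [Z [stZ [Z1 Z2] ex1 ex2]] := graph.
have exB : exists B : 'M[C]_(act_dim W, act_dim V), forall x, col_mx x (B *m x) \in Z.
  pose f x := xchoose (ex1 x); have fP x : col_mx x (f x) \in Z := xchooseP (ex1 x).
  (* The chosen partners need not depend linearly on x; only those of basis vectors are used, and
     linearity of Z does the rest. *)
  exists (\matrix_(i, j) f (delta_mx j 0) i 0) => x.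
  set B := \matrix_(_, _) _; have BE j : B *m delta_mx j 0 = f (delta_mx j 0).
    by apply/colP => i; rewrite -colE !mxE.
  have e y : col_mx y (B *m y) = col_mx 1%:M B *m y by rewrite mul_col_mx mul1mx.
  rewrite e (matrix_sum_delta x) mulmx_sumr; apply: memv_suml => j _.
  by rewrite big_ord1 -scalemxAr memvZ // -e BE fP.
have exB' : exists B : 'M[C]_(act_dim V, act_dim W), forall y, col_mx (B *m y) y \in Z.
  pose f y := xchoose (ex2 y); have fP y : col_mx (f y) y \in Z := xchooseP (ex2 y).
  exists (\matrix_(i, j) f (delta_mx j 0) i 0) => x.
  set B := \matrix_(_, _) _; have BE j : B *m delta_mx j 0 = f (delta_mx j 0).
    by apply/colP => i; rewrite -colE !mxE.
  have e y : col_mx (B *m y) y = col_mx B 1%:M *m y by rewrite mul_col_mx mul1mx.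
  rewrite e (matrix_sum_delta x) mulmx_sumr; apply: memv_suml => j _.
  by rewrite big_ord1 -scalemxAr memvZ // -e BE fP.
have [B BZ] := exB; have [B' B'Z] := exB'.
have uniq x y y' : col_mx x y \in Z -> col_mx x y' \in Z -> y = y'.
  move=> yZ y'Z; apply/eqP; rewrite -subr_eq0; apply/eqP/Z2.
  by rewrite -(subrr x) -add_col_mx -opp_col_mx memvB.
have uniq' x x' y : col_mx x y \in Z -> col_mx x' y \in Z -> x = x'.
  move=> xZ x'Z; apply/eqP; rewrite -subr_eq0; apply/eqP/Z1.
  by rewrite -(subrr y) -add_col_mx -opp_col_mx memvB.
exists B, B'; split=> [||A gA]; apply: mulmx_ext => x.
- by rewrite -mulmxA mul1mx; apply: uniq (BZ _) (B'Z x).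
- by rewrite -mulmxA mul1mx; apply: uniq' (B'Z _) (BZ x).
rewrite -!mulmxA; apply: uniq (BZ _) _.
by rewrite -dsumE; apply: stZ.
Qed.
End Uniqueness.

(** * Counting walks *)

Section WeightCount.
Variables (C : numClosedFieldType) (n m h : nat) (g : pred 'M[C]_(n + m)) (D : root_datum h g).

Lemma dominant_posroot (xi : 'rV[int]_n) : (forall i, 0 <= xi 0 i) ->
  (forall i j : 'I_n, (i <= j)%N -> xi 0 j <= xi 0 i) -> forall x, 0 <= ipz xi (posroot h x).
Proof.
move=> xi0 xi_dec x; rewrite /posroot; case: eqP => _.
  by rewrite ipz_delta mulr_ge0.
rewrite ipzDr !ipz_delta; case: ifP => lt; last by rewrite addr_ge0 // mulr_ge0.
by rewrite mulNr subr_ge0 ler_pM2l // xi_dec // ltnW.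
Qed.

Lemma tens_pow_multiplicity (E : finType) (w : E -> int) (V : mxact C (n + m)) wt
    (phi : 'I_(act_dim V) -> {ffun 'I_n -> E}) k (xi : 'rV[int]_n) (mu : weight n) :
  star_weights D wt -> bijective phi -> (forall t i, wt t 0 i = w (phi t i)) ->
  (forall i, 0 <= xi 0 i) -> (forall i j : 'I_n, (i <= j)%N -> xi 0 j <= xi 0 i) ->
  (forall c, mu 0 c = (xi 0 c)%:~R / 2) ->
  exists2 r, has_multiplicity g mu (tens_pow V k) r &
    r%:R = \det (\matrix_(i < n, j < n)
      ((walks w k (xi 0 i + weyl_vector n h 0 i - weyl_vector n h 0 j))%:R -
       (walks w k (xi 0 i + weyl_vector n h 0 i + weyl_vector n h 0 j))%:R)) :> rat.
Proof.
move=> swV bij wtE xi0 xi_dec mu_xi.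
have [wtk [[repk stark dgk] cardk]] := tens_pow_star_weights k swV bij wtE.
have [r mult rE] := star_multiplicity repk stark dgk (dominant_posroot xi0 xi_dec) mu_xi.
exists r => //.
pose gw (i : 'I_n) (u : int) : rat := (walks w k (xi 0 i + weyl_vector n h 0 i - u))%:R.
have := denominator_formula (rd_h D) gw; rewrite /gw => e.
have {e} -> : \det (\matrix_(i < n, j < n)
      ((walks w k (xi 0 i + weyl_vector n h 0 i - weyl_vector n h 0 j))%:R -
       (walks w k (xi 0 i + weyl_vector n h 0 i + weyl_vector n h 0 j))%:R)) =
   \sum_(S : {set 'I_n * 'I_n}) (-1) ^+ #|S| * \prod_i gw i (rho_minus h S 0 i).
  rewrite [RHS]e; congr (\det _); apply/matrixP => i j; rewrite !mxE.
  by rewrite opprK.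
apply: (fmorph_inj (@ratr C)); rewrite rmorph_nat rE rmorph_sum; apply: eq_bigr => S _ /=.
rewrite rmorphM rmorphXn rmorphN1 cardk natr_prod rmorph_prod; congr (_ * _).
apply: eq_bigr => i _; rewrite /gw rmorph_nat; congr (walks w k _)%:R.
by rewrite /rho_minus !mxE opprB addrCA addrK addrC.
Qed.
End WeightCount.

Definition spin_step (b : bool) : int := if b then 1 else -1.
Definition ext_step (b : bool * bool) : int := 2 * (b.1%:R - b.2%:R).

Lemma walks_spin k u :
  walks spin_step k.+1 u = (walks spin_step k (u - 1) + walks spin_step k (u + 1))%N.
Proof. by rewrite /= big_bool /= opprK. Qed.

Lemma walks_ext k u : walks ext_step k.+1 u =
  (walks ext_step k (u - 2) + walks ext_step k u + walks ext_step k u + walks ext_step k (u + 2))%N.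
Proof.
rewrite /= (eq_bigr (fun e : bool * bool => walks ext_step k (u - ext_step (e.1, e.2)))) => [|[]] //.
rewrite -(pair_bigA _ (fun a b => walks ext_step k (u - ext_step (a, b)))) /= !big_bool /=.
rewrite (_ : ext_step (true, true) = 0) // (_ : ext_step (false, false) = 0) //.
rewrite (_ : ext_step (true, false) = 2) // (_ : ext_step (false, true) = - 2) // opprK !subr0.
by move: (walks _ _ _) (walks _ _ _) (walks _ _ _) => x y z; lia.
Qed.

(** Two spin steps make one exterior step. This is the link between the spinors of B_n and the
    exterior algebra of C_n. *)
Lemma walks_double k u : walks spin_step (2 * k) u = walks ext_step k u.
Proof.
elim: k u => [//|k IH] u; rewrite mulnS walks_ext !walks_spin !IH.
have -> : u - 1 - 1 = u - 2 by lia.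
have -> : u - 1 + 1 = u by lia.
have -> : u + 1 - 1 = u by lia.
have -> : u + 1 + 1 = u + 2 by lia.
by rewrite !addnA.
Qed.

Lemma walks_extN k u : walks ext_step k (- u) = walks ext_step k u.
Proof.
elim: k u => [|k IH] u; first by rewrite /= oppr_eq0.
rewrite !walks_ext (_ : - u - 2 = - (u + 2)); last by lia.
rewrite (_ : - u + 2 = - (u - 2)); last by lia.
by rewrite !IH; move: (walks _ _ _) (walks _ _ _) (walks _ _ _) => x y z; lia.
Qed.

Lemma hops_iter k (f : nat -> rat) : hops 1 1 k f = iter k (hop 1 1) f.
Proof. by elim: k => //= k ->; rewrite addn1 !expr1n. Qed.

Lemma hops_iter0 k (f : nat -> rat) : hops 1 0 k.+1 f = iter k (hop 1 1) f.
Proof. by elim: k => //= k <-; rewrite /= !expr1n. Qed.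

(** The reflection principle for the barrier at L = -1: the image of the starting point r is - r -
    2, and distances are doubled. *)
Lemma iter_hop k (r L : nat) : iter k (hop 1 1) (dirac rat r) L =
  (walks ext_step k (2 * (L%:Z - r%:Z)))%:R - (walks ext_step k (2 * (L%:Z + r%:Z) + 4))%:R.
Proof.
elim: k L => [|k IH] L.
  rewrite /= /dirac (_ : 2 * (L%:Z + r%:Z) + 4 == 0 = false); last by lia.
  by rewrite subr0 (_ : (2 * (L%:Z - r%:Z) == 0) = (L == r)); last by lia.
(* The difference vanishes at the barrier, which is the boundary rule of a hop at L = 0. *)
have low : forall x : int, x + 1 = 0 ->
  (walks ext_step k (2 * (x - r%:Z)))%:R - (walks ext_step k (2 * (x + r%:Z) + 4))%:R = 0 :> rat.
  move=> x x0; rewrite -walks_extN (_ : - (2 * (x - r%:Z)) = 2 * (x + r%:Z) + 4) ?subrr //; lia.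
have -> : iter k.+1 (hop 1 1) (dirac rat r) L =
  2 * iter k (hop 1 1) (dirac rat r) L +
  (if L is L'.+1 then iter k (hop 1 1) (dirac rat r) L' else 0) + iter k (hop 1 1) (dirac rat r) L.+1.
  by rewrite iterS hopE !mul1r; case: L => [|L] /=; rewrite ?mul0r ?mul1r.
have -> : (if L is L'.+1 then iter k (hop 1 1) (dirac rat r) L' else 0) =
   (walks ext_step k (2 * (L%:Z - r%:Z) - 2))%:R - (walks ext_step k (2 * (L%:Z + r%:Z) + 4 - 2))%:R.
  case: L => [|L]; last by rewrite IH; congr (_%:R - _%:R); congr (walks _ _ _); lia.
  rewrite -(low (-1)) //; congr (_%:R - _%:R); congr (walks _ _ _); lia.
rewrite !IH !walks_ext !natrD.
rewrite (_ : 2 * (L.+1%:Z - r%:Z) = 2 * (L%:Z - r%:Z) + 2); last by lia.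
rewrite (_ : 2 * (L.+1%:Z + r%:Z) + 4 = 2 * (L%:Z + r%:Z) + 4 + 2); last by lia.
ring.
Qed.

(** For spinors the entries of the Weyl determinant are sums of two transfers, with neighbouring
    starting points; a unitriangular change of columns undoes this. *)
Lemma det_adjacent_sum n (U : nat -> nat -> rat) (L : 'I_n -> nat) :
  \det (\matrix_(i < n, j < n) (U (rev_ord j) (L i) + if nat_of_ord (rev_ord j) is r.+1 then U r (L i) else 0)) =
  \det (\matrix_(i < n, j < n) U (rev_ord i) (L j)).
Proof.
rewrite -[RHS]det_tr -[RHS]mulr1.
pose T : 'M[rat]_n := \matrix_(k, j) ((k == j)%:R + (k == j.+1 :> nat)%:R).
have dT : \det T = 1.
  rewrite det_trig; last first.
    apply/is_trig_mxP => i j lt; rewrite mxE -(inj_eq val_inj) /= !ltn_eqF ?addr0 //.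
    exact: ltn_trans lt _.
  by rewrite big1 // => i _; rewrite mxE eqxx ltn_eqF ?addr0.
rewrite -dT -det_mulmx; congr (\det _); apply/matrixP => i j; rewrite !mxE.
under eq_bigr do rewrite !mxE mulrDr; rewrite big_split /=; congr (_ + _).
  by rewrite (bigD1 j) //= eqxx mulr1 big1 ?addr0 // => k /negbTE->; rewrite mulr0.
have [lt|ge] := ltnP j.+1 n.
  have rE : (n - j.+1)%N = (rev_ord (Ordinal lt)).+1 by move=> /=; lia.
  rewrite rE (bigD1 (Ordinal lt)) //= eqxx mulr1 big1 ?addr0 // => k ne.
  by rewrite (_ : (k == j.+1 :> nat) = false) ?mulr0 //; apply: contraNF ne => /eqP e; apply/eqP/val_inj.
have -> : (n - j.+1)%N = 0%N by have := ltn_ord j; lia.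
by rewrite big1 // => k _; rewrite ltn_eqF ?mulr0 //; apply: leq_trans ge.
Qed.

Lemma MBC1_transfer n k (lam : 'I_n -> nat) p : (p <= 1)%N -> (0 < k)%N ->
  MBC (1 : rat) k lam p =
  \det (\matrix_(i < n, j < n) transfer 1 p k (dirac rat (rev_ord i)) (lam j + rev_ord j)).
Proof.
move=> p1 k0; have := MBC_transfer qint_rat_neq0 lam p1 k0.
rewrite !big1 ?mul1r // => i _; first by rewrite big1 // => i' _; rewrite expr1n.
by rewrite expr1n.
Qed.

(** The odd step splits each count in two. Of the four terms two form the half-line count from r and
    two that from r - 1; for r = 0 the latter two cancel. *)
Lemma spin_entry_odd k l ri r :
  (walks spin_step (2 * k + 1) ((l.*2 + 1)%N%:Z + (ri.*2 + 1)%N%:Z - (r.*2 + 1)%N%:Z))%:R -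
  (walks spin_step (2 * k + 1) ((l.*2 + 1)%N%:Z + (ri.*2 + 1)%N%:Z + (r.*2 + 1)%N%:Z))%:R =
  transfer 1 1 k (dirac rat r) (l + ri) +
  (if r is r'.+1 then transfer 1 1 k (dirac rat r') (l + ri) else 0).
Proof.
have -> : (l.*2 + 1)%N%:Z + (ri.*2 + 1)%N%:Z - (r.*2 + 1)%N%:Z = 2 * ((l + ri)%N%:Z - r%:Z) + 1 by lia.
have -> : (l.*2 + 1)%N%:Z + (ri.*2 + 1)%N%:Z + (r.*2 + 1)%N%:Z = 2 * ((l + ri)%N%:Z + r%:Z) + 3 by lia.
rewrite addn1 !walks_spin !walks_double /transfer !natrD; move: (l + ri)%N => L.
have -> : 2 * (L%:Z - r%:Z) + 1 - 1 = 2 * (L%:Z - r%:Z) by lia.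
have -> : 2 * (L%:Z + r%:Z) + 3 + 1 = 2 * (L%:Z + r%:Z) + 4 by lia.
rewrite hops_iter iter_hop; case: r => [|r].
  rewrite (_ : 2 * (L%:Z - 0%:Z) + 1 + 1 = 2 * (L%:Z + 0%:Z) + 3 - 1); last by lia.
  by ring.
rewrite hops_iter iter_hop (_ : 2 * (L%:Z - r.+1%:Z) + 1 + 1 = 2 * (L%:Z - r%:Z)); last by lia.
rewrite (_ : 2 * (L%:Z + r.+1%:Z) + 3 - 1 = 2 * (L%:Z + r%:Z) + 4); last by lia.
ring.
Qed.

Lemma walks_low k r :
  (walks ext_step k (2 * (0%:Z - r%:Z) - 2))%:R - (walks ext_step k (2 * (0%:Z + r%:Z) + 2))%:R = 0 :> rat.
Proof.
rewrite -walks_extN (_ : - (2 * (0%:Z - r%:Z) - 2) = 2 * (0%:Z + r%:Z) + 2) ?subrr //; lia.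
Qed.

Lemma transfer0E k r L : transfer 1 0 k.+1 (dirac rat r) L =
  ((walks ext_step k (2 * (L%:Z - r%:Z)))%:R - (walks ext_step k (2 * (L%:Z + r%:Z) + 4))%:R) +
  ((walks ext_step k (2 * (L%:Z - r%:Z) - 2))%:R - (walks ext_step k (2 * (L%:Z + r%:Z) + 2))%:R).
Proof.
rewrite /transfer /up_step hops_iter0 !iter_hop; congr (_ + _); case: L => [|L].
  by rewrite mul0r walks_low.
by rewrite mul1r; congr (_%:R - _%:R); congr (walks _ _ _) => /=; lia.
Qed.

(** Here the reflection exchanges r and - r - 1. The factor 1 + D that T_0 lacks is restored by
    adding the starting point r - 1. *)
Lemma spin_entry_even k l ri r :
  (walks spin_step (2 * k.+1) ((l.*2)%N%:Z + (ri.*2 + 1)%N%:Z - (r.*2 + 1)%N%:Z))%:R -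
  (walks spin_step (2 * k.+1) ((l.*2)%N%:Z + (ri.*2 + 1)%N%:Z + (r.*2 + 1)%N%:Z))%:R =
  transfer 1 0 k.+1 (dirac rat r) (l + ri) +
  (if r is r'.+1 then transfer 1 0 k.+1 (dirac rat r') (l + ri) else 0).
Proof.
have -> : (l.*2)%N%:Z + (ri.*2 + 1)%N%:Z - (r.*2 + 1)%N%:Z = 2 * ((l + ri)%N%:Z - r%:Z) by lia.
have -> : (l.*2)%N%:Z + (ri.*2 + 1)%N%:Z + (r.*2 + 1)%N%:Z = 2 * ((l + ri)%N%:Z + r%:Z) + 2 by lia.
rewrite !walks_double !walks_ext transfer0E !natrD; move: (l + ri)%N => L.
rewrite (_ : 2 * (L%:Z + r%:Z) + 2 + 2 = 2 * (L%:Z + r%:Z) + 4); last by lia.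
rewrite (_ : 2 * (L%:Z + r%:Z) + 2 - 2 = 2 * (L%:Z + r%:Z)); last by lia.
case: r => [|r].
  rewrite (_ : 2 * (L%:Z + 0%:Z) = 2 * (L%:Z - 0%:Z)); last by lia.
  by ring.
rewrite transfer0E (_ : 2 * (L%:Z - r.+1%:Z) + 2 = 2 * (L%:Z - r%:Z)); last by lia.
rewrite (_ : 2 * (L%:Z - r%:Z) - 2 = 2 * (L%:Z - r.+1%:Z)); last by lia.
rewrite (_ : 2 * (L%:Z + r%:Z) + 4 = 2 * (L%:Z + r.+1%:Z) + 2); last by lia.
rewrite (_ : 2 * (L%:Z + r%:Z) + 2 = 2 * (L%:Z + r.+1%:Z)); last by lia.
ring.
Qed.

Lemma bool_ffun_bij n : bijective (fun t : 'I_#|{: {set 'I_n}}| => [ffun i => i \in sof t]).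
Proof.
exists (fun f : {ffun 'I_n -> bool} => enum_rank [set i | f i]) => [t|f].
  rewrite /= -[RHS]enum_valK; congr enum_rank; apply/setP => i; by rewrite inE ffunE.
by apply/ffunP => i; rewrite ffunE /sof enum_rankK inE.
Qed.

Section Multiplicities.
Variables (C : numClosedFieldType) (n k : nat) (lam : 'I_n -> nat).
Hypotheses (k0 : (0 < k)%N) (hlam : part_in_rect k lam).

Let xi p : 'rV[int]_n := \row_i ((lam i).*2 + p)%N%:Z.

Let xi_ge0 p i : 0 <= xi p 0 i. Proof. by rewrite mxE. Qed.

Let xi_dec p (i j : 'I_n) : (i <= j)%N -> xi p 0 j <= xi p 0 i.
Proof. by move=> le; rewrite !mxE; have := hlam.1 i j le; lia. Qed.

Lemma spin_multiplicity p (mu : weight n) (S : mxact C (n + n.+1)) : (p <= 1)%N ->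
  (forall c, mu 0 c = (lam c)%:R + p%:R / 2) ->
  is_hw_irrep (so_odd C n) (half_weight n) S ->
  exists2 r : nat, has_multiplicity (so_odd C n) mu (tens_pow S (2 * k + p)) r &
    MBC (1 : rat) k lam p = r%:R.
Proof.
move=> p1 muE irrS; pose D := so_root_datum C n.
have mu_xi c : mu 0 c = (xi p 0 c)%:~R / 2.
  by rewrite muE mxE -pmulrn natrD -muln2 natrM mulrDl mulfK.
have wtE t i : (\row_c (if c \in sof t then 1 else -1) : 'rV[int]_n) 0 i =
    spin_step ([ffun i => i \in sof t] i) by rewrite mxE ffunE.
have [r mult rE] := @tens_pow_multiplicity C n n.+1 1 _ D _ spin_step (spin_act C n) _ _
  (2 * k + p) (xi p) mu (spin_star_weights C n) (@bool_ffun_bij n) wtE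
  (xi_ge0 p) (@xi_dec p) mu_xi.
exists r.
  (* The count was made for the Clifford model; an isomorphism with S induces one of the tensor
     powers, which carries it over. *)
  have [B [B' [e1 e2 e3]]] := hw_irrep_unique D irrS (spin_irrep C n).
  have [Bk [Bk' [f1 f2 f3]]] := tens_pow_intertwiner e1 e2 e3 (2 * k + p).
  exact: (multiplicity_transfer f1 f2 f3 mult).
rewrite rE MBC1_transfer //.
rewrite -(det_adjacent_sum (fun r L => transfer 1 p k (dirac rat r) L) (fun j => lam j + rev_ord j)%N).
congr (\det _); apply/matrixP => i j; rewrite !mxE.
case: p p1 {wtE mult rE muE mu_xi} => [|[|//]] _; last by rewrite spin_entry_odd.
case: k k0 => // k' _; rewrite !addn0.
by rewrite spin_entry_even.
Qed.

(** With h = 2 the entries of the Weyl determinant are those of [iter_hop] after transposition, with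
    no change of columns. *)
Lemma ext_multiplicity : exists2 r : nat,
    has_multiplicity (sp_even C n) (part_weight lam)
      (tens_pow (ext_act (natural_act C (n + n))) k) r &
    MBC (1 : rat) k lam 1 = r%:R.
Proof.
pose D := sp_root_datum C n.
have mu_xi c : part_weight lam 0 c = (xi 0 0 c)%:~R / 2.
  by rewrite !mxE addn0 -pmulrn -muln2 natrM mulfK.
pose phi (t : 'I_#|{: {set 'I_(n + n)}}|) : {ffun 'I_n -> bool * bool} :=
  [ffun c => (lshift n c \in sof t, rev_ord (lshift n c) \in sof t)].
have wtE t i : (\row_c (2 * ((lshift n c \in sof t)%:R - (rev_ord (lshift n c) \in sof t)%:R)) : 'rV[int]_n) 0 i =
    ext_step (phi t i) by rewrite mxE ffunE.
have phi_bij : bijective phi.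
  apply: inj_card_bij => [t u /ffunP e|].
    apply: enum_val_inj; apply/setP => i; rewrite -!/(sof _).
    by case: (ord_even_cases i) => c [->|->]; have := e c; rewrite !ffunE => -[].
  have -> : #|{: 'I_(#|{: {set 'I_(n + n)}}|) }| = (2 ^ (n + n))%N.
    by rewrite card_ord -cardsT -powersetT card_powerset cardsT card_ord.
  by rewrite card_ffun card_ord card_prod card_bool expnD expnMn.
have [r mult rE] := @tens_pow_multiplicity C n n 2 _ D _ ext_step (ext_act (natural_act C (n + n))) _ _
  k (xi 0) (part_weight lam) (ext_star_weights D) phi_bij wtE
  (xi_ge0 0) (@xi_dec 0) mu_xi.
exists r => //; rewrite rE MBC1_transfer // -det_tr.
congr (\det _); apply/matrixP => i j; rewrite !mxE /transfer hops_iter iter_hop addn0.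
by congr (_%:R - _%:R); congr (walks _ _ _); rewrite -!muln2; lia.
Qed.
End Multiplicities.

Theorem theorem4p9 (R : realType) (n k : nat) (lam : 'I_n -> nat)
    (hn : (0 < n)%N) (hk : (0 < k)%N) (hlam : part_in_rect k lam) :
  (* p = 0 *)
  [/\ MBC qvar k lam 0 * \prod_(1 <= a < k) (qvar ^+ a + 1) =
        qvar ^+ part_norm (compl_part k lam) *
        qdimD qvar (part_weight (conj_part k (compl_part k lam))
                    + half_weight k),
      (forall S : mxact R[i] (n + n.+1),
        is_hw_irrep (so_odd R[i] n) (half_weight n) S ->
        exists2 m : nat,
          has_multiplicity (so_odd R[i] n) (part_weight lam)
            (tens_pow S (2 * k)) m &
          MBC (1 : rat) k lam 0 = m%:R)
    & is_nat_poly (MBC qvar k lam 0)]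
  /\
  (* p = 1 *)
  [/\ MBC qvar k lam 1 =
        qvar ^+ part_norm (compl_part k lam) *
        qdimC qvar (part_weight (conj_part k (compl_part k lam))),
      is_nat_poly (MBC qvar k lam 1),
      (forall S : mxact R[i] (n + n.+1),
        is_hw_irrep (so_odd R[i] n) (half_weight n) S ->
        exists2 m : nat,
          has_multiplicity (so_odd R[i] n) (part_weight lam + half_weight n)
            (tens_pow S (2 * k).+1) m &
          MBC (1 : rat) k lam 1 = m%:R)
    & exists2 m : nat,
        has_multiplicity (sp_even R[i] n) (part_weight lam)
          (tens_pow (ext_act (natural_act R[i] (n + n))) k) m &
        MBC (1 : rat) k lam 1 = m%:R].
Proof.
have weight0 c : part_weight lam 0 c = (lam c)%:R + 0%:R / 2 by rewrite mxE mul0r addr0.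
have weight1 c : (part_weight lam + half_weight n) 0 c = (lam c)%:R + 1%:R / 2 by rewrite !mxE.
split; split.
- exact: (MBC_qdimD qint_qvar_neq0 qvar_neq0 qvar_neq1 hlam).
- by move=> S irrS; have := spin_multiplicity hk hlam (leq0n 1) weight0 irrS; rewrite addn0.
- exact: nat_poly_MBC.
- exact: (MBC_qdimC qint_qvar_neq0 qvar_neq0 qvar_neq1 hlam).
- exact: nat_poly_MBC.
- by move=> S irrS; have := spin_multiplicity hk hlam (leqnn 1) weight1 irrS; rewrite addn1.
exact: ext_multiplicity.
Qed.
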